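(* Consider the closed-loop sampled-data system described in the context: exosystem, encoder–decoder pair (with integer $N$ and sampling interval $T>0$), plant, and regulator (with parameters $\kappa>0$ and $k>0$), i.e. \[ \begin{array}{rcl} \dot w&=&s(w),\\ \dot w_{\rm d}&=&s(w_{\rm d}),\qquad w_{\rm d}(jT)=w_{\rm d}(jT^-)+w_{\rm q}(j)\,\dfrac{L(j)}{N},\quad j=0,1,2,\dots\\ \dot z&=&f(z,y,\mu),\\ \dot y&=&q(z,y,\mu)+\Gamma\xi-k\,(y-y_{\rm r}(w_{\rm d})),\\ \dot\xi&=&\Phi_{\rm c}(\xi)-Gk\,(y-y_{\rm r}(w_{\rm d})). \end{array} \] Suppose assumptions (A0), (A1), (A2), (A3) of the context hold. Then there exists $\kappa^\ast>0$ such that for every $\kappa\ge\kappa^\ast$ the following holds: there exist $T^\ast>0$ and $k^\ast>0$ such that, for every sampling interval $T>T^\ast$ satisfying $N>\sqrt r\,M(T)$ and every $k>k^\ast$, along every trajectory of the closed-loop system with $\mu\in P$, $w(0)\in W_0$, $w_{\rm d}(0^-)\in W_0$, $z(0)\in Z$, $y(0)\in Y$, $\xi(0)\in\Xi$, the tracking error $e(t)=y(t)-y_{\rm r}(w(t))$ satisfies \[ \lim_{t\to\infty}e(t)=0 . \]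
   Context: **Exosystem and sets.** $s:\mathbb R^r\to\mathbb R^r$, $y_{\rm r}:\mathbb R^r\to\mathbb R$; the exosystem is $\dot w=s(w)$. $|\cdot|$ is the Euclidean norm, and $|x|_S=\min_{y\in S}|x-y|$ for a compact set $S$. (A0) $s$ is locally Lipschitz and the initial conditions $w(0)$ of the exosystem lie in a fixed compact set $W_0\subset\mathbb R^r$ invariant for $\dot w=s(w)$. Let $L_0=\max_{1\le i\le r}\max_{(x,y)\in W_0\times W_0}|x_i-y_i|$. Given the number of bits $N_b$ of the channel, $N$ is the largest positive integer with $N_b\ge r\lceil\log_2N\rceil$. (A1) There is a compact set $W\supset W_0$, invariant for $\dot w=s(w)$, such that $\bar w\notin W$ implies $|\bar w|_{W_0}>\sqrt r\,\frac{L_0}{2N}$. $M:\mathbb R_{\ge0}\to\mathbb R_{>0}$ is a fixed nondecreasing function with $M(0)=1$ such that for any two solutions $w_1,w_2$ of $\dot w=s(w)$ with $w_1(0),w_2(0)\in W$, $|w_1(t)-w_2(t)|\le M(t)|w_1(0)-w_2(0)|$ for all $t\ge0$. **Encoder–decoder.** Encoder and decoder have the same state $w_{\rm d}=w_{\rm e}$, with $w_{\rm d}(0^-)\in W_0$. Between sampling times, $\dot w_{\rm d}=s(w_{\rm d})$; at each $jT$, $j=0,1,2,\dots$, $w_{\rm d}$ is reset by $w_{\rm d}(jT)=w_{\rm d}(jT^-)+w_{\rm q}(j)L(j)/N$, where $L(0)=L_0$, $L(j+1)=\sqrt r\,\frac{M(T)}{N}L(j)$, and for $i=1,\dots,r$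 \[ w_{{\rm q},i}(j)=\mathrm{sgn}\big(w_i(jT)-w_{{\rm d},i}(jT^-)\big)\cdot \begin{cases}\left\lceil \frac{N|w_i(jT)-w_{{\rm d},i}(jT^-)|}{L(j)}\right\rceil-\frac12,& N\text{ even},\\[1mm] \left\lceil \frac{N|w_i(jT)-w_{{\rm d},i}(jT^-)|}{L(j)}-\frac12\right\rceil,& N\text{ odd}.\end{cases} \] The variables $z,y,\xi$ are continuous in time. **Plant.** $\dot z=f(z,y,\mu)$, $z\in\mathbb R^n$; $\dot y=q(z,y,\mu)+u$, $y\in\mathbb R$; $\mu$ is a constant unknown parameter vector in a compact set $P$. $Z\subset\mathbb R^n$ and $Y\subset\mathbb R$ are compact sets of initial conditions. The functions $f,q,s,y_{\rm r}$ are differentiable sufficiently many times for the map $\tau$ below to be well defined and $C^1$. **Zero-error system.** Let ${\bf z}=(\mu,w,z)$ and write $\dot{\bf z}={\bf f}_0({\bf z})$ for the system $\dot\mu=0$, $\dot w=s(w)$, $\dot z=f(z,y_{\rm r}(w),\mu)$ on $P\times W\times\mathbb R^n$. Let ${\bf q}_0({\bf z})=L_sy_{\rm r}(w)-q(z,y_{\rm r}(w),\mu)$, where $L_sy_{\rm r}$ is the derivative of $y_{\rm r}$ along $s$. Let ${\bf Z}=P\times W\times Z$. The $\omega$-limit set $\omega(X)$ of a set $X$ is the set of all limits of sequences $\phi(t_i,x_i)$ with $x_i\in X$, $t_i\to\infty$, $\phi$ being the flow. (A2) There is a compact subset of $P\times W\times\mathbb R^n$ containing the positive orbit of ${\bf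 Z}$ under $\dot{\bf z}={\bf f}_0({\bf z})$, and $\mathcal A_0:=\omega({\bf Z})$ is a differentiable submanifold (with boundary) of $P\times W\times\mathbb R^n$. There is $d_1>0$ such that ${\bf z}\in P\times W\times\mathbb R^n$, $|{\bf z}|_{\mathcal A_0}\le d_1$ imply ${\bf z}\in{\bf Z}$. There are $m\ge1$, $a>0$, $0<d_2\le d_1$ such that every solution with ${\bf z}(0)\in P\times W\times\mathbb R^n$, $|{\bf z}(0)|_{\mathcal A_0}\le d_2$ satisfies $|{\bf z}(t)|_{\mathcal A_0}\le me^{-at}|{\bf z}(0)|_{\mathcal A_0}$ for $t\ge0$. (A3) There are an integer $d>0$ and a locally Lipschitz $\varphi:\mathbb R^d\to\mathbb R$ such that, for every solution ${\bf z}(t)$ of $\dot{\bf z}={\bf f}_0({\bf z})$ with ${\bf z}(0)\in\mathcal A_0$, the function $u(t)={\bf q}_0({\bf z}(t))$ satisfies $u^{(d)}(t)+\varphi(u(t),u^{(1)}(t),\dots,u^{(d-1)}(t))=0$. **Regulator.** Let $\tau_1={\bf q}_0$, $\tau_{i+1}=\frac{\partial\tau_i}{\partial{\bf z}}{\bf f}_0$ for $i=1,\dots,d-1$, and $\tau=(\tau_1,\dots,\tau_d)$. Let $\varphi_{\rm c}:\mathbb R^d\to\mathbb R$ be any locally Lipschitz function with compact support that agrees with $\varphi$ on $\tau(\mathcal A_0)$. Set $\Phi_{\rm c}(\xi)=(\xi_2,\dots,\xi_d,-\varphi_{\rm c}(\xi_1,\dots,\xi_d))^{\rm T}$, $G=(\kappa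 c_{d-1},\kappa^2c_{d-2},\dots,\kappa^dc_0)^{\rm T}$, $\Gamma=(1,0,\dots,0)$, where $c_0,\dots,c_{d-1}$ are fixed with $\lambda^d+c_{d-1}\lambda^{d-1}+\dots+c_0$ Hurwitz. The control is $u=\Gamma\xi-k(y-y_{\rm r}(w_{\rm d}))$. $\Xi\subset\mathbb R^d$ is a given, arbitrarily large, compact set of initial conditions for $\xi$. *)

(* Defs.v *)
(* R^m is represented by row vectors, 'rV[R]_m. *)
From HB Require Import structures.
From mathcomp Require Export all_boot all_order all_algebra.
From mathcomp Require Export all_classical all_reals all_analysis.
From mathcomp Require Import complex.

Set Implicit Arguments.
Unset Strict Implicit.
Unset Printing Implicit Defensive.

Export Order.TTheory GRing.Theory Num.Theory.
Export numFieldNormedType.Exports.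

Local Open Scope classical_set_scope.
Local Open Scope ring_scope.

(* The library norm on 'rV[R]_m is the sup norm (same topology); quantitative
   bounds below are in the Euclidean norm. *)
Definition enorm (R : realType) (m : nat) (x : 'rV[R]_m) : R :=
  Num.sqrt (\sum_(i < m) x 0 i ^+ 2).

(* [inf] is a minimum for S compact and nonempty; on the empty set it is 0. *)
Definition edist (R : realType) (m : nat) (S : set 'rV[R]_m) (x : 'rV[R]_m) : R :=
  inf [set enorm (x - y) | y in S].

(* In the library notation "locally" quantifies over all pairs of points; off
   the diagonal it says no more than local boundedness of g. *)
Definition locally_lipschitz (R : realType) (U V : normedModType R) (g : U -> V) :=
  [locally [lipschitz g x | x in [set: U]]].

(* U is meant to be open. *)
Definition C1_on (R : realType) (V V' : normedModType R) (U : set V) (g : V -> V') :=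
  forall x, U x -> differentiable g x /\
    forall v, {for x, continuous (fun a => 'D_v g a)}.

(* The interval [0, b) of real numbers, b possibly infinite. *)
Definition horizon (R : realType) (b : \bar R) : set R :=
  [set t | 0 <= t /\ (t%:E < b)%E].

(* Solution of x' = F(x) on [0, b): one-sided differentiability at 0 follows
   from continuity there when F is continuous. *)
Definition solution (R : realType) (V : normedModType R) (F : V -> V)
    (b : \bar R) (x : R -> V) : Prop :=
  {within horizon b, continuous x} /\
  forall t : R, 0 < t -> (t%:E < b)%E -> is_derive t 1 x (F (x t)).

(* Through every point of S passes a solution defined, and in S, for all
   positive and negative times (F is locally Lipschitz in all uses). *)
Definition invariant_set (R : realType) (V : normedModType R) (F : V -> V)
    (S : set V) : Prop :=
  forall x0, S x0 -> exists x : R -> V,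
    x 0 = x0 /\ forall t : R, is_derive t 1 x (F (x t)) /\ S (x t).

Definition omega_limit (R : realType) (V : normedModType R) (F : V -> V)
    (X : set V) : set V :=
  [set l | exists (t_ : nat -> R) (x_ : nat -> R -> V),
     [/\ t_ i @[i --> \oo] --> +oo,
         forall i, solution F +oo%E (x_ i) /\ X (x_ i 0) &
         x_ i (t_ i) @[i --> \oo] --> l]].

(* The half-space {x_0 >= 0} of the coordinate subspace R^k x {0} of R^m. *)
Definition half_slice (R : realType) (m k : nat) : set 'rV[R]_m :=
  [set x | (forall i : 'I_m, (k <= i)%N -> x 0 i = 0) /\
           (forall i : 'I_m, (i < k)%N -> i = 0%N :> nat -> 0 <= x 0 i)].

(* Embedded C^1 submanifold of R^m, possibly with boundary, of some dimension
   k. A chart at an interior point is one taking it to {x_0 > 0}, so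
   half-space charts suffice. *)
Definition submanifold_with_boundary (R : realType) (m : nat)
    (A : set 'rV[R]_m) : Prop :=
  exists2 k : nat, (k <= m)%N & forall a, A a ->
    exists (U V : set 'rV[R]_m) (psi chi : 'rV[R]_m -> 'rV[R]_m),
      [/\ open U /\ U a, open V,
          C1_on U psi /\ C1_on V chi,
          (forall x, U x -> V (psi x) /\ chi (psi x) = x) /\
          (forall y, V y -> U (chi y) /\ psi (chi y) = y) &
          forall x, U x -> (A x <-> half_slice k (psi x))].

(* A maximum when W0 is compact and nonempty and r > 0. *)
Definition initial_range (R : realType) (r : nat) (W0 : set 'rV[R]_r) : R :=
  sup [set l | exists x y (i : 'I_r), [/\ W0 x, W0 y & l = `|x 0 i - y 0 i|]].

(* N is the largest positive integer with Nb >= r * ceil (log2 N);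
   [up_log 2 N] is ceil (log2 N) for N >= 1. *)
Definition channel_levels (r Nb N : nat) : Prop :=
  [/\ (0 < N)%N, (r * up_log 2 N <= Nb)%N &
      forall N', (0 < N')%N -> (r * up_log 2 N' <= Nb)%N -> (N' <= N)%N].

Fixpoint quantization_range (R : realType) (r : nat) (W0 : set 'rV[R]_r)
    (N : nat) (M : R -> R) (T : R) (j : nat) : R :=
  if j is j'.+1
  then Num.sqrt r%:R * (M T / N%:R) * quantization_range W0 N M T j'
  else initial_range W0.

(* When l = 0 the quotient is 0 by convention, and the reset
   w_q(j) L(j) / N vanishes whatever the value of w_q(j). *)
Definition quantize (R : realType) (r N : nat) (l : R) (w wd : 'rV[R]_r) : 'rV[R]_r :=
  \row_(i < r) let a := N%:R * `|w 0 i - wd 0 i| / l in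
    Num.sg (w 0 i - wd 0 i) *
    (if odd N then (Num.ceil (a - 2^-1))%:~R else (Num.ceil a)%:~R - 2^-1).

(* The state bold z = (mu, w, z) lives in R^(p + (r + n)). *)
Definition mu_of (R : realType) (p r n : nat) (x : 'rV[R]_(p + (r + n))) : 'rV[R]_p :=
  lsubmx x.
Definition w_of (R : realType) (p r n : nat) (x : 'rV[R]_(p + (r + n))) : 'rV[R]_r :=
  lsubmx (rsubmx x).
Definition z_of (R : realType) (p r n : nat) (x : 'rV[R]_(p + (r + n))) : 'rV[R]_n :=
  rsubmx (rsubmx x).

Definition prod_set (R : realType) (p r n : nat) (P : set 'rV[R]_p)
    (W : set 'rV[R]_r) (Z : set 'rV[R]_n) : set 'rV[R]_(p + (r + n)) :=
  [set x | [/\ P (mu_of x), W (w_of x) & Z (z_of x)]].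

Definition f0 (R : realType) (p r n : nat) (s : 'rV[R]_r -> 'rV[R]_r)
    (yr : 'rV[R]_r -> R) (f : 'rV[R]_n -> R -> 'rV[R]_p -> 'rV[R]_n)
    (x : 'rV[R]_(p + (r + n))) : 'rV[R]_(p + (r + n)) :=
  row_mx 0 (row_mx (s (w_of x)) (f (z_of x) (yr (w_of x)) (mu_of x))).

Definition q0 (R : realType) (p r n : nat) (s : 'rV[R]_r -> 'rV[R]_r)
    (yr : 'rV[R]_r -> R) (q : 'rV[R]_n -> R -> 'rV[R]_p -> R)
    (x : 'rV[R]_(p + (r + n))) : R :=
  'D_(s (w_of x)) yr (w_of x) - q (z_of x) (yr (w_of x)) (mu_of x).

(* [tau_fun i] is tau_(i+1): indices start at 0. *)
Fixpoint tau_fun (R : realType) (p r n : nat) (s : 'rV[R]_r -> 'rV[R]_r)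
    (yr : 'rV[R]_r -> R) (f : 'rV[R]_n -> R -> 'rV[R]_p -> 'rV[R]_n)
    (q : 'rV[R]_n -> R -> 'rV[R]_p -> R) (i : nat) : 'rV[R]_(p + (r + n)) -> R :=
  if i is i'.+1
  then fun x => 'D_(f0 s yr f x) (tau_fun s yr f q i') x
  else q0 s yr q.

Definition tau (R : realType) (p r n : nat) (s : 'rV[R]_r -> 'rV[R]_r)
    (yr : 'rV[R]_r -> R) (f : 'rV[R]_n -> R -> 'rV[R]_p -> 'rV[R]_n)
    (q : 'rV[R]_n -> R -> 'rV[R]_p -> R) (d : nat)
    (x : 'rV[R]_(p + (r + n))) : 'rV[R]_d :=
  \row_(i < d) tau_fun s yr f q i x.

Definition steady_state_set (R : realType) (p r n : nat) (s : 'rV[R]_r -> 'rV[R]_r)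
    (yr : 'rV[R]_r -> R) (f : 'rV[R]_n -> R -> 'rV[R]_p -> 'rV[R]_n)
    (P : set 'rV[R]_p) (W : set 'rV[R]_r) (Z : set 'rV[R]_n) :
    set 'rV[R]_(p + (r + n)) :=
  omega_limit (f0 s yr f) (prod_set P W Z).

(* The C^1 regularity is that of the data on the whole space, jointly in all
   arguments, together with that of the iterated derivatives tau_1 .. tau_d. *)
Definition smooth_data (R : realType) (p r n : nat) (s : 'rV[R]_r -> 'rV[R]_r)
    (yr : 'rV[R]_r -> R) (f : 'rV[R]_n -> R -> 'rV[R]_p -> 'rV[R]_n)
    (q : 'rV[R]_n -> R -> 'rV[R]_p -> R) (d : nat) : Prop :=
  [/\ C1_on setT s, C1_on setT yr,
      C1_on setT (fun x : 'rV[R]_n * R * 'rV[R]_p => f x.1.1 x.1.2 x.2),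
      C1_on setT (fun x : 'rV[R]_n * R * 'rV[R]_p => q x.1.1 x.1.2 x.2) &
      forall i, (i < d)%N -> C1_on setT (tau_fun s yr f q i)].

Definition steady_state_assumption (R : realType) (p r n : nat)
    (s : 'rV[R]_r -> 'rV[R]_r) (yr : 'rV[R]_r -> R)
    (f : 'rV[R]_n -> R -> 'rV[R]_p -> 'rV[R]_n)
    (P : set 'rV[R]_p) (W : set 'rV[R]_r) (Z : set 'rV[R]_n) : Prop :=
  let F0 := f0 s yr f in
  let A0 := steady_state_set s yr f P W Z in
  let space := prod_set P W [set: 'rV[R]_n] in
  [/\ exists K, [/\ compact K, K `<=` space &
        forall x0, prod_set P W Z x0 -> exists x,
          [/\ solution F0 +oo%E x, x 0 = x0 & forall t, 0 <= t -> K (x t)]],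
      A0 `<=` space /\ submanifold_with_boundary A0 &
      exists2 d1 : R, 0 < d1 &
        (forall x, space x -> edist A0 x <= d1 -> prod_set P W Z x) /\
        exists m a d2 : R, [/\ 1 <= m, 0 < a, 0 < d2, d2 <= d1 &
          forall x, solution F0 +oo%E x -> space (x 0) -> edist A0 (x 0) <= d2 ->
            forall t, 0 <= t ->
              edist A0 (x t) <= m * expR (- (a * t)) * edist A0 (x 0)]].

(* Since u is only determined by a solution on t >= 0, the equation is
   required for t > 0. *)
Definition immersion_assumption (R : realType) (p r n : nat)
    (s : 'rV[R]_r -> 'rV[R]_r) (yr : 'rV[R]_r -> R)
    (f : 'rV[R]_n -> R -> 'rV[R]_p -> 'rV[R]_n)
    (q : 'rV[R]_n -> R -> 'rV[R]_p -> R)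
    (P : set 'rV[R]_p) (W : set 'rV[R]_r) (Z : set 'rV[R]_n)
    (d : nat) (phi : 'rV[R]_d -> R) : Prop :=
  forall x, solution (f0 s yr f) +oo%E x -> steady_state_set s yr f P W Z (x 0) ->
    let u := fun t => q0 s yr q (x t) in
    forall t, 0 < t ->
      (forall i, (i < d)%N -> derivable (derive1n i u) t 1) /\
      derive1n d u t + phi (\row_(i < d) derive1n i u t) = 0.

(* X^d + c_(d-1) X^(d-1) + ... + c_0 *)
Definition char_poly_of (R : realType) (d : nat) (c : 'I_d -> R) : {poly R} :=
  'X^d + \sum_(i < d) c i *: 'X^i.

Definition hurwitz (R : realType) (P : {poly R}) : Prop :=
  forall l : R[i],
    root (map_poly (real_complex R) P) l -> complex.Re l < 0.

Definition Phi (R : realType) (d : nat) (phic : 'rV[R]_d -> R) (xi : 'rV[R]_d) :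
    'rV[R]_d :=
  \row_(i < d) if insub i.+1 is Some i' then xi 0 (i' : 'I_d) else - phic xi.

(* [rev_ord i] is d - 1 - i: the 0-indexed entry i is kappa^(i+1) c_(d-1-i). *)
Definition gainG (R : realType) (d : nat) (c : 'I_d -> R) (kappa : R) : 'rV[R]_d :=
  \row_(i < d) (kappa ^+ i.+1 * c (rev_ord i)).

Definition outGamma (R : realType) (d : nat) : 'rV[R]_d :=
  \row_(i < d) (i == 0%N :> nat)%:R.

(* [tr_wdm j] is the left limit w_d(jT^-); [tr_wdm 0] is the initial value
   w_d(0^-), while [tr_wd 0] is the value after the first reset. *)
Record trajectory (R : realType) (r n d : nat) := Trajectory {
  tr_w : R -> 'rV[R]_r;
  tr_wd : R -> 'rV[R]_r;
  tr_wdm : nat -> 'rV[R]_r;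
  tr_z : R -> 'rV[R]_n;
  tr_y : R -> R;
  tr_xi : R -> 'rV[R]_d }.

(* X is a trajectory of the closed loop on the time interval [0, b). *)
Record closed_loop (R : realType) (p r n d : nat)
    (s : 'rV[R]_r -> 'rV[R]_r) (yr : 'rV[R]_r -> R)
    (f : 'rV[R]_n -> R -> 'rV[R]_p -> 'rV[R]_n)
    (q : 'rV[R]_n -> R -> 'rV[R]_p -> R)
    (W0 : set 'rV[R]_r) (N : nat) (M : R -> R) (T : R)
    (phic : 'rV[R]_d -> R) (c : 'I_d -> R) (kappa k : R)
    (mu : 'rV[R]_p) (b : \bar R) (X : trajectory R r n d) : Prop := ClosedLoop {
  cl_w : solution s b (tr_w X);
  cl_wd : forall (j : nat) t, j%:R * T < t -> t < j.+1%:R * T -> (t%:E < b)%E ->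
    is_derive t 1 (tr_wd X) (s (tr_wd X t));
  cl_wd_right : forall j : nat, ((j%:R * T)%:E < b)%E ->
    tr_wd X t @[t --> (j%:R * T)^'+] --> tr_wd X (j%:R * T);
  cl_wd_left : forall j : nat, (0 < j)%N -> ((j%:R * T)%:E < b)%E ->
    tr_wd X t @[t --> (j%:R * T)^'-] --> tr_wdm X j;
  cl_wd_reset : forall j : nat, ((j%:R * T)%:E < b)%E ->
    let l := quantization_range W0 N M T j in
    tr_wd X (j%:R * T) =
      tr_wdm X j + (l / N%:R) *: quantize N l (tr_w X (j%:R * T)) (tr_wdm X j);
  cl_cont : [/\ {within horizon b, continuous (tr_z X)},
                {within horizon b, continuous (tr_y X)} &
                {within horizon b, continuous (tr_xi X)}];
  cl_plant : forall t, 0 < t -> (t%:E < b)%E -> (forall j : nat, t != j%:R * T) ->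
    let v := k * (tr_y X t - yr (tr_wd X t)) in
    [/\ is_derive t 1 (tr_z X) (f (tr_z X t) (tr_y X t) mu),
        is_derive t 1 (tr_y X) (q (tr_z X t) (tr_y X t) mu
           + \sum_(i < d) outGamma R d 0 i * tr_xi X t 0 i - v) &
        is_derive t 1 (tr_xi X) (Phi phic (tr_xi X t) - v *: gainG c kappa)] }.

Definition agree_on (R : realType) (r n d : nat) (T : R) (b : \bar R)
    (X X' : trajectory R r n d) : Prop :=
  (forall t, horizon b t ->
     [/\ tr_w X t = tr_w X' t, tr_wd X t = tr_wd X' t, tr_z X t = tr_z X' t,
         tr_y X t = tr_y X' t & tr_xi X t = tr_xi X' t]) /\
  (forall j : nat, ((j%:R * T)%:E < b)%E -> tr_wdm X j = tr_wdm X' j).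

(* Trajectories are taken maximally extended to the right, so that finite
   escape times are not excluded beforehand. *)
Definition maximal_closed_loop (R : realType) (p r n d : nat)
    (s : 'rV[R]_r -> 'rV[R]_r) (yr : 'rV[R]_r -> R)
    (f : 'rV[R]_n -> R -> 'rV[R]_p -> 'rV[R]_n)
    (q : 'rV[R]_n -> R -> 'rV[R]_p -> R)
    (W0 : set 'rV[R]_r) (N : nat) (M : R -> R) (T : R)
    (phic : 'rV[R]_d -> R) (c : 'I_d -> R) (kappa k : R)
    (mu : 'rV[R]_p) (b : \bar R) (X : trajectory R r n d) : Prop :=
  [/\ (0 < b)%E, closed_loop s yr f q W0 N M T phic c kappa k mu b X &
      forall b' X', (b < b')%E -> agree_on T b X X' ->
        ~ closed_loop s yr f q W0 N M T phic c kappa k mu b' X'].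

(* Main.v *)
(* In the coordinates x = (mu, w_d, z), e = y - yr(w_d), eta = xi - G e the gain
   k enters the equation of e only, and for e = 0 the rest is the system
   x' = f0(x), eta' = Phi_c(eta) - eta_1 G + q0(x) G. For large kappa the map
   eta |-> Phi_c(eta) - eta_1 G is a contraction in a quadratic norm, because its
   linear part is similar to kappa times a Hurwitz companion matrix, and by (A3)
   tau solves the second equation along A0. Hence the graph of tau over A0
   attracts that system uniformly, and exponentially near the graph. For large k
   the closed loop follows it over a time window of fixed length, so that a
   sampling interval longer than the window halves the squared distance to the
   graph. The resets of w_d are bounded by the quantization range, which decays
   geometrically since sqrt r M(T) < N, whence the distance tends to 0. The same
   estimates bound the state, which excludes finite escape times. *)
Require Import Defs.
From mathcomp Require Import ring lra spectral complex.

Set Implicit Arguments.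
Unset Strict Implicit.
Unset Printing Implicit Defensive.

Local Open Scope classical_set_scope.
Local Open Scope ring_scope.

(** * Quadratic norms and Gronwall inequalities *)

Section vectors.
Variables (R : realType) (m : nat).
Implicit Types x y z : 'rV[R]_m.

(** The gain [k_star] must serve every large [T], while a comparison with the zero dynamics over a
    whole sampling interval would need a gain that grows with its length. Comparisons are therefore
    made over windows of length at most [2 * th], and a longer interval is cut into windows, each of
    which ends closer to the graph than it began. This works down to distance zero because the drift
    of e vanishes on the graph, where eta_1 = q0: near it, the error of a comparison is the squared
    distance itself times a factor of order 1 / k, with no fixed residue. The choices are ordered:
    kappa, hence the quadratic norm; then bounds [H], [Eb] on the state just after a reset; then the
    window, the radius [dl] and the gain. To avoid a circle, [H] and [Eb] cover all states produced
    by a reset from squared distance at most 1, and [dl <= 1] is chosen afterwards. A reset costs a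
    factor 5/4 on the squared distance, plus a term of the order of the squared quantization range.
    Once that term is a quarter of the distance, 3/2 times the old value is halved, which gives the
    rate 3/4 per sample. *)

Definition dot x y : R := \sum_(i < m) x 0 i * y 0 i.
(** Squared Euclidean norms are differentiable everywhere, unlike [enorm], so the differential
    inequalities below are written for [sq]. *)
Definition sq x : R := dot x x.

Lemma coord_norm_le x i : `|x 0 i| <= `|x|.
Proof.
rewrite [leRHS]/Num.Def.normr/= mx_normrE.
by apply: (le_trans _ (le_bigmax _ (fun ij => `|x ij.1 ij.2|) (0, i))).
Qed.

Lemma norm_le_coord x (c : R) : 0 <= c -> (forall i, `|x 0 i| <= c) -> `|x| <= c.
Proof.
move=> c0 xc; rewrite /Num.Def.normr/= mx_normrE (bigmax_le _ c0)//= => -[i j] _.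
by rewrite ord1; exact: xc.
Qed.

Lemma dotC x y : dot x y = dot y x.
Proof. by apply: eq_bigr => i _; rewrite mulrC. Qed.

Lemma dotDl x y z : dot (x + y) z = dot x z + dot y z.
Proof. by rewrite -big_split; apply: eq_bigr => i _; rewrite mxE mulrDl. Qed.

Lemma dotDr x y z : dot z (x + y) = dot z x + dot z y.
Proof. by rewrite dotC dotDl !(dotC z). Qed.

Lemma dotZl (a : R) x y : dot (a *: x) y = a * dot x y.
Proof. by rewrite mulr_sumr; apply: eq_bigr => i _; rewrite mxE mulrA. Qed.

Lemma dotZr (a : R) x y : dot x (a *: y) = a * dot x y.
Proof. by rewrite dotC dotZl dotC. Qed.

Lemma dotNl x y : dot (- x) y = - dot x y.
Proof. by rewrite -scaleN1r dotZl mulN1r. Qed.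

Lemma dotNr x y : dot x (- y) = - dot x y.
Proof. by rewrite dotC dotNl dotC. Qed.

Lemma sq_ge0 x : 0 <= sq x.
Proof. by apply: sumr_ge0 => i _; rewrite -expr2 sqr_ge0. Qed.

Lemma sq0 : sq 0 = 0.
Proof. by apply: big1 => i _; rewrite mxE mul0r. Qed.

Lemma sqN x : sq (- x) = sq x.
Proof. by rewrite /sq dotNl dotNr opprK. Qed.

Lemma sq_subC x y : sq (x - y) = sq (y - x).
Proof. by rewrite -sqN opprB. Qed.

Lemma sqZ (a : R) x : sq (a *: x) = a ^+ 2 * sq x.
Proof. by rewrite /sq dotZl dotZr mulrA expr2. Qed.

Lemma enorm_sq x : enorm x ^+ 2 = sq x.
Proof.
rewrite /enorm sqr_sqrtr; first by apply: eq_bigr => i _; rewrite expr2.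
by apply: sumr_ge0 => i _; rewrite sqr_ge0.
Qed.

Lemma enorm_ge0 x : 0 <= enorm x.
Proof. exact: sqrtr_ge0. Qed.

Lemma coord_sq_le x i : x 0 i ^+ 2 <= sq x.
Proof.
rewrite /sq /dot (bigD1 i)//= -expr2 lerDl; apply: sumr_ge0 => j _.
by rewrite -expr2 sqr_ge0.
Qed.

Lemma norm_sq_le x : `|x| ^+ 2 <= sq x.
Proof.
have le_sqrt : `|x| <= Num.sqrt (sq x).
  apply: norm_le_coord => [|i]; first exact: sqrtr_ge0.
  by rewrite -sqrtr_sqr ler_wsqrtr// coord_sq_le.
by rewrite -(sqr_sqrtr (sq_ge0 x)) lerXn2r// nnegrE ?sqrtr_ge0.
Qed.

Lemma sq_le_norm x : sq x <= m%:R * `|x| ^+ 2.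
Proof.
rewrite -[X in X%:R]card_ord mulr_natl -sumr_const; apply: ler_sum => i _.
by rewrite -expr2 -real_normK ?num_real// lerXn2r// ?nnegrE// coord_norm_le.
Qed.

Lemma sq_eq0 x : sq x = 0 -> x = 0.
Proof.
move=> x0; apply/rowP => i; rewrite mxE; have := coord_sq_le x i; rewrite x0 => le0.
by apply/eqP; rewrite -sqrf_eq0 eq_le le0 sqr_ge0.
Qed.

Lemma dot_amgm (c : R) x y : 0 < c -> 2 * dot x y <= c * sq x + c^-1 * sq y.
Proof.
move=> c0; have := sq_ge0 (c *: x - y).
rewrite /sq dotDl !dotDr !dotNl !dotNr !dotZl !dotZr opprK (dotC y) => h.
rewrite -(ler_pM2l c0) mulrDr [leRHS]addrC mulVKf ?gt_eqF//; lra.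
Qed.

Lemma dot_amgm1 x y : 2 * dot x y <= sq x + sq y.
Proof. by have := dot_amgm x y (ltr01); rewrite invr1 !mul1r. Qed.

(** Young's inequality with a free weight. The choice c = 1/4 gives the factor 5/4, small enough to
    preserve a contraction by 1/2. *)
Lemma sqD_amgm (c : R) x y :
  0 < c -> sq (x + y) <= (1 + c) * sq x + (1 + c^-1) * sq y.
Proof.
move=> c0; rewrite {1}/sq dotDl !dotDr -/(sq x) -/(sq y) (dotC y).
have := dot_amgm x y c0; lra.
Qed.

Lemma sqD x y : sq (x + y) <= 2 * sq x + 2 * sq y.
Proof. by have := @sqD_amgm 1 x y ltr01; rewrite invr1. Qed.

Lemma sq_sub_mid z x y : sq (x - y) <= 2 * sq (x - z) + 2 * sq (z - y).
Proof. by apply: le_trans (sqD _ _); rewrite addrA subrK. Qed.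

End vectors.

Lemma sq_row_mx (R : realType) (m n : nat) (x : 'rV[R]_m) (y : 'rV[R]_n) :
  sq (row_mx x y) = sq x + sq y.
Proof.
rewrite /sq /dot big_split_ord/=.
by congr (_ + _); apply: eq_bigr => i _; rewrite ?row_mxEl ?row_mxEr.
Qed.

Lemma sq_mulmx (R : realType) (m n : nat) (E : 'M[R]_(m, n)) :
  exists2 C : R, 0 < C & forall x : 'rV[R]_m, sq (x *m E) <= C * sq x.
Proof.
exists (1 + \sum_(j < n) \sum_(i < m) m%:R * E i j ^+ 2).
  rewrite ltr_pwDl//; apply: sumr_ge0 => j _; apply: sumr_ge0 => i _.
  by rewrite mulr_ge0// sqr_ge0.
move=> x; rewrite mulrDl mul1r; apply: (@le_trans _ _
  ((\sum_(j < n) \sum_(i < m) m%:R * E i j ^+ 2) * sq x)); last first.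
  by rewrite lerDr sq_ge0.
rewrite mulr_suml; apply: ler_sum => j _.
have normx : `|(x *m E) 0 j| <= \sum_(i < m) (`|x| * `|E i j|).
  rewrite mxE; apply: (le_trans (ler_norm_sum _ _ _)); apply: ler_sum => i _.
  by rewrite normrM ler_wpM2r// coord_norm_le.
(* Cauchy-Schwarz against the constant vector, read off from the identity sum_i (m |E_ij| - S)^2 = m
   (m Q - S^2). The case m = 0 is separate because m has to be cancelled. *)
have cauchy : (\sum_(i < m) `|E i j|) ^+ 2 <= m%:R * \sum_(i < m) E i j ^+ 2.
  have := sq_ge0 (\row_(i < m) (m%:R * `|E i j| - \sum_(i < m) `|E i j|) : 'rV[R]_m).
  set S := \sum_(i < m) `|E i j|; set Q := \sum_(i < m) E i j ^+ 2.
  have -> : sq (\row_(i < m) (m%:R * `|E i j| - S) : 'rV[R]_m) =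
      m%:R * (m%:R * Q - S ^+ 2).
    rewrite /sq /dot (eq_bigr (fun i : 'I_m => m%:R ^+ 2 * E i j ^+ 2
        - 2 * m%:R * S * `|E i j| + S ^+ 2)); last first.
      by move=> i _; rewrite !mxE -[E i j ^+ 2]real_normK ?num_real//; ring.
    rewrite big_split/= sumrB -!mulr_sumr sumr_const card_ord -/S -/Q -mulr_natl; ring.
  have [m0|m0] := posnP m; last by rewrite pmulr_rge0 ?ltr0n// subr_ge0.
  move=> _; rewrite m0 mul0r /S big1 ?expr0n// => i _.
  by have := ltn_ord i; rewrite {2}m0.
rewrite -expr2 -real_normK ?num_real//.
apply: (@le_trans _ _ ((`|x| * \sum_(i < m) `|E i j|) ^+ 2)).
  by rewrite lerXn2r ?nnegrE ?mulr_ge0 ?sumr_ge0// mulr_sumr.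
rewrite exprMn mulrC -mulr_sumr; apply: ler_pM; rewrite ?sqr_ge0//.
exact: norm_sq_le.
Qed.

Section calculus.
Variable R : realType.

Lemma is_derive_coord (V : normedModType R) m n (x : V -> 'M[R]_(m, n)) t v (dx : 'M[R]_(m, n)) i j :
  is_derive t v x dx -> is_derive t v (fun t => x t i j) (dx i j).
Proof.
move=> [dx1 dx2]; apply: DeriveDef; first by move/derivable_mxP: dx1.
by rewrite -dx2 derive_mx// mxE.
Qed.

Lemma is_derive_mx (V : normedModType R) m n (x : V -> 'M[R]_(m, n)) t v (dx : 'M[R]_(m, n)) :
  (forall i j, is_derive t v (fun t => x t i j) (dx i j)) -> is_derive t v x dx.
Proof.
move=> dxij; have D : derivable x t v by apply/derivable_mxP => i j; case: (dxij i j).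
apply: DeriveDef => //; rewrite derive_mx//; apply/matrixP => i j; rewrite mxE.
by case: (dxij i j).
Qed.

Lemma is_derive_row_mx m n (x : R -> 'rV[R]_m) (y : R -> 'rV[R]_n) (t : R)
    (dx : 'rV[R]_m) (dy : 'rV[R]_n) :
  is_derive t 1 x dx -> is_derive t 1 y dy ->
  is_derive t 1 (fun t => row_mx (x t) (y t)) (row_mx dx dy).
Proof.
move=> Dx Dy; apply: is_derive_mx => i j; rewrite mxE.
rewrite (_ : (fun _ => _) = (fun t => match fintype.split j with
  | inl j1 => x t i j1 | inr j2 => y t i j2 end)); last first.
  by apply/funext => u; rewrite mxE.
by case: fintype.split => j'; exact: is_derive_coord.
Qed.

Lemma is_derive_lsubmx m n (x : R -> 'rV[R]_(m + n)) (t : R) (dx : 'rV[R]_(m + n)) :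
  is_derive t 1 x dx -> is_derive t 1 (fun t => lsubmx (x t)) (lsubmx dx).
Proof.
move=> Dx; apply: is_derive_mx => i j; rewrite mxE.
rewrite (_ : (fun _ => _) = (fun t => x t i (lshift n j))).
  exact: is_derive_coord.
by apply/funext => u; rewrite mxE.
Qed.

Lemma is_derive_rsubmx m n (x : R -> 'rV[R]_(m + n)) (t : R) (dx : 'rV[R]_(m + n)) :
  is_derive t 1 x dx -> is_derive t 1 (fun t => rsubmx (x t)) (rsubmx dx).
Proof.
move=> Dx; apply: is_derive_mx => i j; rewrite mxE.
rewrite (_ : (fun _ => _) = (fun t => x t i (rshift m j))).
  exact: is_derive_coord.
by apply/funext => u; rewrite mxE.
Qed.

Lemma is_derive_mulmx m n (E : 'M[R]_(m, n)) (x : R -> 'rV[R]_m) (t : R) (dx : 'rV[R]_m) :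
  is_derive t 1 x dx -> is_derive t 1 (fun t => x t *m E) (dx *m E).
Proof.
move=> Dx; apply: is_derive_mx => i j; rewrite mxE.
rewrite (_ : (fun _ => _) = \sum_(k < m) (fun t => x t i k * E k j)).
  apply: is_derive_sum => k; have Dk := is_derive_coord i k Dx.
  by apply: is_derive_eq; rewrite scaler0 add0r [_ *: _]mulrC.
by apply/funext => u; rewrite mxE fct_sumE.
Qed.

Lemma is_derive_sq m (x : R -> 'rV[R]_m) (t : R) (dx : 'rV[R]_m) :
  is_derive t 1 x dx -> is_derive t 1 (fun t => sq (x t)) (2 * dot (x t) dx).
Proof.
move=> Dx; rewrite (_ : (fun _ => _) = \sum_(k < m) (fun t => x t 0 k * x t 0 k)).
  rewrite (_ : _ * _ = \sum_(k < m) (x t 0 k *: dx 0 k + x t 0 k *: dx 0 k)).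
    by apply: is_derive_sum => k; apply: is_deriveM; exact: is_derive_coord.
  rewrite /dot mulr_sumr; apply: eq_bigr => i _.
  by rewrite /GRing.scale/=; ring.
by apply/funext => u; rewrite fct_sumE.
Qed.

Lemma is_derive_chain (V V' : normedModType R) (g : V -> V') (x : R -> V) (t : R) dx :
  is_derive t 1 x dx -> differentiable g (x t) ->
  is_derive t 1 (g \o x) ('D_dx g (x t)).
Proof.
move=> [Dx dxE] dg; have Dx' : differentiable x t by apply/derivable1_diffP.
have dgx : differentiable (g \o x) t by exact: differentiable_comp.
apply: DeriveDef; first exact: diff_derivable.
by rewrite deriveE// diff_comp//= [RHS]deriveE// -dxE deriveE.
Qed.

(** The function exp(- c t) (u + d / c) is nonincreasing. Allowing both signs of c yields the growth
    and the decay estimates from one proof. *)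
Lemma gronwall (u : R -> R) (a b c d : R) : a <= b -> c != 0 ->
  {within `[a, b], continuous u} ->
  (forall t, a < t -> t < b -> exists2 du : R, is_derive t 1 u du & du <= c * u t + d) ->
  u b + d / c <= expR (c * (b - a)) * (u a + d / c).
Proof.
move=> ab c0 cu du.
pose g t := expR (- (c * t)) * (u t + d / c).
have gD t : a < t -> t < b -> exists2 dg, is_derive t 1 g dg & dg <= 0.
  move=> at_ tb; have [du1 Du le_du] := du t at_ tb.
  exists (expR (- (c * t)) * (du1 - c * u t - d)).
    rewrite /g; apply: is_derive_eq.
    rewrite /GRing.scale/=; field; exact: c0.
  by rewrite mulr_ge0_le0 ?expR_ge0//; lra.
have gle : g b <= g a.
  have h := @ler0_derive1_le_cc R g a b.
  apply: h; rewrite ?in_itv/= ?lexx ?ab//.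
  - by move=> t; rewrite in_itv/= => /andP[a1 b1]; have [dg []] := gD t a1 b1.
  - move=> t; rewrite in_itv/= => /andP[a1 b1]; have [dg [D E]] := gD t a1 b1.
    by rewrite derive1E E.
  - move=> t; apply: cvgM; last by apply: cvgD; [exact: cu|exact: cvg_cst].
    apply: continuous_subspaceT => x.
    apply: (@continuous_comp _ _ _ (fun t => - (c * t)) expR).
      by apply: cvgN; apply: cvgM; [exact: cvg_cst|exact: cvg_id].
    exact: continuous_expR.
have e : g b = expR (- (c * b)) * (u b + d / c) by [].
rewrite -(ler_pM2l (expR_gt0 (- (c * b)))) -e mulrA -expRD.
by rewrite (_ : - (c * b) + _ = - (c * a)); [exact: gle|ring].
Qed.

Lemma gronwall_grow (u : R -> R) (a b c d : R) : a <= b -> 0 < c -> 0 <= d ->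
  {within `[a, b], continuous u} ->
  (forall t, a < t -> t < b -> exists2 du : R, is_derive t 1 u du & du <= c * u t + d) ->
  u b <= expR (c * (b - a)) * (u a + d / c).
Proof.
move=> ab c0 d0 cu du; have := gronwall ab (lt0r_neq0 c0) cu du.
by apply: le_trans; rewrite lerDl divr_ge0 // ltW.
Qed.

Lemma gronwall_decay (u : R -> R) (a b c d : R) : a <= b -> 0 < c -> 0 <= d ->
  {within `[a, b], continuous u} ->
  (forall t, a < t -> t < b -> exists2 du : R, is_derive t 1 u du & du <= - c * u t + d) ->
  u b <= expR (- c * (b - a)) * u a + d / c.
Proof.
move=> ab c0 d0 cu du.
have nc0 : - c != 0 by rewrite oppr_eq0 gt_eqF.
have := gronwall ab nc0 cu du; rewrite invrN mulrN mulrBr.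
have : 0 <= expR (- c * (b - a)) * (d / c).
  by rewrite mulr_ge0 ?expR_ge0// divr_ge0// ltW.
lra.
Qed.

End calculus.

(** * Maps that are Lipschitz on bounded sets *)

Section lipschitz.
Variable R : realType.

(** One Lipschitz constant per ball centred at 0. Unlike the local notion, this form composes
    directly and gives constants that are uniform over all trajectories in a bounded set. *)
Definition lip_bdd (V V' : normedModType R) (g : V -> V') :=
  forall rho : R, exists2 L : R, 0 <= L &
    forall x y, `|x| <= rho -> `|y| <= rho -> `|g x - g y| <= L * `|x - y|.

Lemma compact_norm_le (V : normedModType R) (A : set V) : compact A ->
  exists2 B : R, 0 < B & forall x, A x -> `|x| <= B.
Proof.
by move=> /compact_bounded /ex_strict_bound_gt0[B B0 hB]; exists B => // x /hB/ltW.
Qed.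

Lemma lip_bdd_bounded (V V' : normedModType R) (g : V -> V') (rho : R) :
  lip_bdd g -> exists2 B : R, 0 < B & forall x, `|x| <= rho -> `|g x| <= B.
Proof.
move=> /(_ `|rho|)[L L0 lipL]; exists (`|g 0| + L * `|rho| + 1).
  by rewrite ltr_pwDr// addr_ge0// mulr_ge0.
move=> x xrho; have {}xrho := le_trans xrho (ler_norm _).
have := lipL x 0 xrho; rewrite normr0 subr0 => /(_ (normr_ge0 _)) le1.
have : L * `|x| <= L * `|rho| by rewrite ler_wpM2l.
have := ler_normD (g x - g 0) (g 0); rewrite subrK; lra.
Qed.

Lemma lip_bdd_comp (V1 V2 V3 : normedModType R) (g : V2 -> V3) (h : V1 -> V2) :
  lip_bdd g -> lip_bdd h -> lip_bdd (g \o h).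
Proof.
move=> lg lh rho; have [B _ hB] := lip_bdd_bounded rho lh.
have [L L0 hL] := lh rho; have [L' L'0 hL'] := lg B.
exists (L' * L) => [|x y xr yr /=]; first exact: mulr_ge0.
apply: (le_trans (hL' _ _ (hB _ xr) (hB _ yr))).
by rewrite -mulrA ler_wpM2l// hL.
Qed.

Lemma lip_bdd_lin (V V' : normedModType R) (g : V -> V') (L : R) : 0 <= L ->
  (forall x y, `|g x - g y| <= L * `|x - y|) -> lip_bdd g.
Proof. by move=> L0 hL rho; exists L. Qed.

Lemma lip_bddD (V V' : normedModType R) (g h : V -> V') :
  lip_bdd g -> lip_bdd h -> lip_bdd (fun x => g x + h x).
Proof.
move=> lg lh rho; have [L L0 hL] := lg rho; have [K K0 hK] := lh rho.
exists (L + K) => [|x y xr yr]; first exact: addr_ge0.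
rewrite opprD addrACA mulrDl (le_trans (ler_normD _ _))// lerD ?hL ?hK//.
Qed.

Lemma lip_bddN (V V' : normedModType R) (g : V -> V') :
  lip_bdd g -> lip_bdd (fun x => - g x).
Proof.
move=> lg rho; have [L L0 hL] := lg rho; exists L => // x y xr yr.
by rewrite -opprD normrN hL.
Qed.

Lemma lip_bddB (V V' : normedModType R) (g h : V -> V') :
  lip_bdd g -> lip_bdd h -> lip_bdd (fun x => g x - h x).
Proof. by move=> lg lh; apply: lip_bddD => //; exact: lip_bddN. Qed.

Lemma lip_bddZ (V : normedModType R) (V' : normedModType R) (a : R) (g : V -> V') :
  lip_bdd g -> lip_bdd (fun x => a *: g x).
Proof.
move=> lg rho; have [L L0 hL] := lg rho; exists (`|a| * L) => [|x y xr yr].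
  exact: mulr_ge0.
by rewrite -scalerBr normrZ -mulrA ler_wpM2l// hL.
Qed.

Lemma lip_bdd_cst (V V' : normedModType R) (a : V') : lip_bdd (fun _ : V => a).
Proof.
by apply: (@lip_bdd_lin _ _ _ 0) => // x y; rewrite subrr normr0 mul0r.
Qed.

Lemma lip_bdd_id (V : normedModType R) : lip_bdd (@idfun V).
Proof. by apply: (@lip_bdd_lin _ _ _ 1) => // x y; rewrite mul1r. Qed.

Lemma lip_bdd_pair (V V1 V2 : normedModType R) (g : V -> V1) (h : V -> V2) :
  lip_bdd g -> lip_bdd h -> lip_bdd (fun x => (g x, h x)).
Proof.
move=> lg lh rho; have [L L0 hL] := lg rho; have [K K0 hK] := lh rho.
exists (L + K) => [|x y xr yr]; first exact: addr_ge0.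
have lx := hL x y xr yr; have kx := hK x y xr yr.
have Ln : 0 <= L * `|x - y| by rewrite mulr_ge0.
have Kn : 0 <= K * `|x - y| by rewrite mulr_ge0.
by rewrite prod_normE/= ge_max; apply/andP; split; lra.
Qed.

Lemma lip_bdd_fst (V1 V2 : normedModType R) : lip_bdd (@fst V1 V2).
Proof.
apply: (@lip_bdd_lin _ _ _ 1) => // x y; rewrite mul1r [leRHS]prod_normE/=.
by rewrite le_max lexx.
Qed.

Lemma lip_bdd_snd (V1 V2 : normedModType R) : lip_bdd (@snd V1 V2).
Proof.
apply: (@lip_bdd_lin _ _ _ 1) => // x y; rewrite mul1r [leRHS]prod_normE/=.
by rewrite le_max lexx orbT.
Qed.

Lemma lip_bdd_continuous (V V' : normedModType R) (g : V -> V') :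
  lip_bdd g -> continuous g.
Proof.
move=> lg x; have [L L0 hL] := lg (`|x| + 1); apply/cvgrPdist_le => e e0.
near=> y.
have yx : `|x - y| <= Num.min 1 (e / (L + 1)).
  near: y; apply: cvgr_dist_le; first exact: cvg_id.
  by rewrite lt_min ltr01 divr_gt0// ltr_pwDr.
move: yx; rewrite le_min => /andP[yx1 yxe].
have yn : `|y| <= `|x| + 1.
  rewrite -[y](subrK x) addrC (le_trans (ler_normD _ _))// lerD2l.
  by rewrite -normrN opprB.
apply: le_trans (hL x y _ yn) _; first by rewrite lerDl.
apply: (@le_trans _ _ ((L + 1) * `|x - y|)).
  by rewrite ler_wpM2r// lerDl.
by rewrite mulrC -ler_pdivlMr ?ltr_pwDr.
Unshelve. all: by end_near. Qed.

Lemma lip_bdd_rV (V : normedModType R) m (g : V -> 'rV[R]_m) :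
  (forall i, lip_bdd (fun x => g x 0 i)) -> lip_bdd g.
Proof.
move=> lg rho; have {}lg i := lg i rho.
have [L hL] := choice (fun i => let: ex_intro2 L L0 H := lg i in
  ex_intro (fun L => 0 <= L /\ _) L (conj L0 H)).
exists (\sum_i L i) => [|x y xr yr].
  by apply: sumr_ge0 => i _; case: (hL i).
have L0 i : 0 <= L i by case: (hL i).
apply: norm_le_coord => [|i]; first by rewrite mulr_ge0// sumr_ge0.
rewrite !mxE; apply: (le_trans ((hL i).2 x y xr yr)); rewrite ler_wpM2r//.
by rewrite (bigD1 i)//= lerDl sumr_ge0.
Qed.

Lemma lip_bdd_coord m i : lip_bdd (fun x : 'rV[R]_m => x 0 i).
Proof.
apply: (@lip_bdd_lin _ _ _ 1) => // x y; rewrite mul1r.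
by have := coord_norm_le (x - y) i; rewrite !mxE.
Qed.

Lemma norm_row_mx_le m n (x : 'rV[R]_m) (y : 'rV[R]_n) (c : R) :
  `|x| <= c -> `|y| <= c -> `|row_mx x y| <= c.
Proof.
move=> xc yc; apply: norm_le_coord => [|i]; first exact: le_trans xc.
by rewrite mxE; case: fintype.split => j; apply: le_trans (coord_norm_le _ _) _.
Qed.

Lemma norm_lsubmx_le m n (x : 'rV[R]_(m + n)) : `|lsubmx x| <= `|x|.
Proof. by apply: norm_le_coord => // i; rewrite mxE coord_norm_le. Qed.

Lemma norm_rsubmx_le m n (x : 'rV[R]_(m + n)) : `|rsubmx x| <= `|x|.
Proof. by apply: norm_le_coord => // i; rewrite mxE coord_norm_le. Qed.

Lemma lip_bdd_lsubmx m n : lip_bdd (@lsubmx R 1 m n).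
Proof.
apply: (@lip_bdd_lin _ _ _ 1) => // x y; rewrite mul1r.
by rewrite -linearB norm_lsubmx_le.
Qed.

Lemma lip_bdd_rsubmx m n : lip_bdd (@rsubmx R 1 m n).
Proof.
apply: (@lip_bdd_lin _ _ _ 1) => // x y; rewrite mul1r.
by rewrite -linearB norm_rsubmx_le.
Qed.

Lemma lip_bdd_row_mx (V : normedModType R) m n (g : V -> 'rV[R]_m) (h : V -> 'rV[R]_n) :
  lip_bdd g -> lip_bdd h -> lip_bdd (fun x => row_mx (g x) (h x)).
Proof.
move=> lg lh; apply: lip_bdd_rV => i.
rewrite (_ : (fun _ => _) = (fun x => match fintype.split i with
  | inl i1 => g x 0 i1 | inr i2 => h x 0 i2 end)); last first.
  by apply/funext => x; rewrite mxE.
case: fintype.split => j.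
  exact: (lip_bdd_comp (@lip_bdd_coord m j) lg).
exact: (lip_bdd_comp (@lip_bdd_coord n j) lh).
Qed.

Lemma cball_compact m (rho : R) : compact [set x : 'rV[R]_m | `|x| <= rho].
Proof.
apply: bounded_closed_compact.
  by exists rho; split; [exact: num_real|move=> M rM x /= /le_trans; apply; exact: ltW].
apply: (@preimage_closed _ _ (fun x : 'rV[R]_m => `|x|) [set t | t <= rho]).
  by move=> x _; exact: norm_continuous.
exact: closed_le.
Qed.

(** Mean value theorem along the segment from y to x, which stays in the ball by convexity; the
    partial derivatives are continuous, hence bounded on the compact ball. *)
Lemma lip_bdd_of_partials m (g : 'rV[R]_m -> R) :
  (forall x, differentiable g x) ->
  (forall i, continuous (fun a => 'D_('e_i) g a)) -> lip_bdd g.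
Proof.
move=> dg cg rho.
have bnd i : exists2 B : R, 0 < B & forall a, `|a| <= rho -> `|'D_('e_i) g a| <= B.
  have cpt : compact ((fun a => 'D_('e_i) g a) @` [set x | `|x| <= rho]).
    apply: (continuous_compact _ (@cball_compact m rho)).
    by apply: continuous_subspaceT; exact: cg.
  have [B B0 hB] := compact_norm_le cpt; exists B => // a ar; apply: hB.
  by exists a.
have [B hB] := choice (fun i => let: ex_intro2 B B0 H := bnd i in
  ex_intro (fun B => 0 < B /\ _) B (conj B0 H)).
have B0 : 0 <= \sum_i B i by apply: sumr_ge0 => i _; apply: ltW; case: (hB i).
exists (\sum_i B i) => // x y xr yr.
pose h t := g (y + t *: (x - y)).
have Dh (t : R) : is_derive t 1 h ('D_(x - y) g (y + t *: (x - y))).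
  apply: (@is_derive_chain _ _ _ g (fun t => y + t *: (x - y))) => //.
  apply: is_derive_mx => i j.
  rewrite (_ : (fun _ => _) = (fun t => y i j + t * (x - y) i j)); last first.
    by apply/funext => u; rewrite !mxE.
  by apply: is_derive_eq; rewrite /GRing.scale/=; ring.
have [c] : exists2 c, c \in `]0, 1[ & h 1 - h 0 = 'D_(x - y) g (y + c *: (x - y)) * (1 - 0).
  apply: (@MVT R h (fun t => 'D_(x - y) g (y + t *: (x - y)))) => //.
  apply: continuous_subspaceT => t.
  by apply: differentiable_continuous; apply/derivable1_diffP; case: (Dh t).
rewrite in_itv/= => /andP[c0 c1]; rewrite /h scale1r scale0r addr0 subrKC subr0 mulr1.
move=> ->; set z := y + c *: (x - y).
have zr : `|z| <= rho.
  rewrite /z scalerBr addrCA -{1}(scale1r y) -scalerBl.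
  rewrite (le_trans (ler_normD _ _))// !normrZ (gtr0_norm c0) gtr0_norm ?subr_gt0//.
  have : c * `|x| <= c * rho by rewrite ler_wpM2l// ltW.
  have : (1 - c) * `|y| <= (1 - c) * rho by rewrite ler_wpM2l// subr_ge0 ltW.
  lra.
rewrite deriveE// {1}(row_sum_delta (x - y)) linear_sum mulr_suml.
apply: (le_trans (ler_norm_sum _ _ _)); apply: ler_sum => i _.
rewrite linearZ -deriveE// normrM mulrC ler_pM//; last exact: coord_norm_le.
by case: (hB i) => _; apply.
Qed.

Lemma lip_bdd_C1 m (g : 'rV[R]_m -> R) : C1_on setT g -> lip_bdd g.
Proof.
by move=> g1; apply: lip_bdd_of_partials => [x|i x]; [case: (g1 x)|apply: (g1 x I).2].
Qed.

Lemma lip_bdd_C1_rV m n (g : 'rV[R]_m -> 'rV[R]_n) : C1_on setT g -> lip_bdd g.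
Proof.
move=> g1; apply: lip_bdd_rV => j; apply: lip_bdd_of_partials => [x|i x].
  apply: (@differentiable_comp _ _ _ _ g (fun y : 'rV[R]_n => y 0 j)).
    by case: (g1 x I).
  exact: differentiable_coord.
rewrite (_ : (fun _ => _) = (fun a => ('D_('e_i) g a) 0 j)).
  apply: (@continuous_comp _ _ _ (fun a => 'D_('e_i) g a) (fun y : 'rV[R]_n => y 0 j)).
    by apply: (g1 x I).2.
  exact: coord_continuous.
apply/funext => a; rewrite derive_mx ?mxE//; apply: diff_derivable.
by case: (g1 a I).
Qed.

(** The local hypothesis holds near every pair of points, on or off the diagonal. Compactness of the
    product of two balls turns the local constants into a single one. *)
Lemma locally_lipschitz_bdd m (g : 'rV[R]_m -> R) :
  locally_lipschitz g -> lip_bdd g.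
Proof.
move=> lg rho.
have cpt := compact_setX (@cball_compact m rho) (@cball_compact m rho).
have [|L [_ hL]] := (compact_near_coveringP _).1 cpt R +oo_R
    (fun L xy => `|g xy.1 - g xy.2| <= L * `|xy.1 - xy.2|).
  move=> [x y] _.
  have := lg (x, y); rewrite /lipschitz_on/= => /(_ (conj I I)).
  move=> /pinfty_ex_gt0[L L0]; rewrite /dominated_by /within/= => hL.
  exists ([set xy | `|g xy.1 - g xy.2| <= L * `|xy.1 - xy.2|], [set M | L <= M]).
    split=> /=; first by apply: filterS hL => z; apply.
    exact: (nbhs_pinfty_ge (num_real L)).
  move=> [xy M]/= [hxy LM]; apply: (le_trans hxy).
  by rewrite ler_wpM2r.
exists (`|L| + 1) => [|x y xr yr]; first by rewrite addr_ge0.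
by apply: (hL (`|L| + 1) _ (x, y)); [rewrite (le_lt_trans (ler_norm _))// ltrDl|split].
Unshelve. all: by end_near. Qed.

(** Inside the ball of radius r + 1 the constant is the local one. If x lies outside it, then [g x]
    is 0, and either [g y] is 0 too or the two points are at distance at least 1, so that a bound on
    g acts as a Lipschitz constant. *)
Lemma lipschitz_compact_support m (g : 'rV[R]_m -> R) : locally_lipschitz g ->
  compact (closure [set x | g x != 0]) ->
  exists2 L : R, 0 < L & forall x y, `|g x - g y| <= L * `|x - y|.
Proof.
move=> lg cg; have {}lg := locally_lipschitz_bdd lg.
have [r r0 hr] := compact_norm_le cg.
have gr x : r < `|x| -> g x = 0.
  move=> rx; apply/eqP; apply/negP => /negP gx; move: rx; rewrite ltNge hr//.
  exact: subset_closure.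
have [L L0 hL] := lg (r + 1); have [B B0 hB] := lip_bdd_bounded (r + 1) lg.
exists (L + B); first by rewrite ltr_wpDl.
have far x y : r + 1 < `|x| -> `|g x - g y| <= (L + B) * `|x - y|.
  move=> rx; rewrite (gr x) ?(lt_trans _ rx) ?ltrDl// sub0r normrN.
  have [ry|ry] := ltP r `|y|; first by rewrite (gr y)// normr0 mulr_ge0// addr_ge0// ltW.
  apply: (@le_trans _ _ (B * 1)).
    by rewrite mulr1 hB// (le_trans ry)// lerDl.
  have xy : 1 <= `|x - y| by have := ler_normD (x - y) y; rewrite subrK; lra.
  have := mulr_ge0 L0 (normr_ge0 (x - y)).
  have : B * 1 <= B * `|x - y| by rewrite ler_wpM2l// ltW.
  rewrite mulrDl; lra.
move=> x y; have [rx|rx] := ltP (r + 1) `|x|; first exact: far.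
have [ry|ry] := ltP (r + 1) `|y|; first by rewrite distrC (distrC x) far.
by rewrite (le_trans (hL _ _ rx ry))// ler_wpM2r// lerDl ltW.
Qed.

End lipschitz.

(** * Bootstrap argument for a scalar bound *)

Section continuation.
Variable R : realType.

(** At the supremum of the times up to which g <= c holds, the step gives the strict inequality, and
    continuity carries the bound further. The improvement from weak to strict is what closes the
    argument. *)
Lemma continuation (g : R -> R) (c l : R) : {within `[0, l], continuous g} ->
  (forall t, 0 <= t -> t <= l -> (forall s, 0 <= s -> s < t -> g s <= c) -> g t < c) ->
  forall t, 0 <= t -> t <= l -> g t < c.
Proof.
move=> cg step t1 t10 t1l; apply: contrapT => gt1.
pose S := [set t | 0 <= t <= t1 /\ forall s, 0 <= s -> s <= t -> g s <= c].
have S0 : S 0.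
  split=> [|s s0 s0']; first by rewrite lexx.
  have -> : s = 0 by apply/le_anti/andP.
  apply/ltW/step => //; first exact: le_trans t1l.
  by move=> u u0 /(le_lt_trans u0); rewrite ltxx.
have hS : has_sup S by split; [exists 0|exists t1 => t [/andP[]]].
set tau := sup S.
have tau0 : 0 <= tau by apply: ub_le_sup S0; case: hS.
have taut1 : tau <= t1 by apply: ge_sup; [exists 0|move=> t [/andP[]]].
have below s : 0 <= s -> s < tau -> g s <= c.
  move=> s0 st; have d0 : 0 < tau - s by rewrite subr_gt0.
  have [t [_ ht]] := sup_adherent d0 hS; rewrite -/tau => lt_st.
  by apply: ht => //; lra.
have taul := le_trans taut1 t1l.
have gtau := step tau tau0 taul below.
have taultt1 : tau < t1.
  by rewrite lt_neqAle taut1 andbT; apply/eqP => e; apply: gt1; rewrite -e.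
have : \forall s \near tau, s \in `[0, l] -> g s < c.
  have tauI : `[0, l]%classic tau by rewrite /= in_itv/= tau0.
  move/subspace_continuousP : (cg) => /(_ tau tauI) /cvgr_lt/(_ _ gtau).
  by move=> h; move: h; rewrite near_withinE; apply: filterS => s hs sI; apply: hs.
move=> /nbhs_ballP[e /= e0 he].
pose t2 := Num.min t1 (tau + e / 2).
have tau2 : tau < t2 by rewrite lt_min taultt1 ltrDl divr_gt0.
have t2t1 : t2 <= t1 by rewrite ge_min lexx.
have t2e : t2 <= tau + e / 2 by rewrite ge_min lexx orbT.
suff /(ub_le_sup hS.2) : S t2 by rewrite leNgt tau2.
split=> [|s s0 st2]; first by rewrite t2t1 andbT (le_trans tau0)// ltW.
have [st|ts] := ltP s tau; first exact: below.
apply/ltW/he.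
  rewrite /ball/=/ball_/= ler0_norm ?subr_le0//; lra.
by rewrite in_itv/= s0 (le_trans st2)// (le_trans t2t1).
Qed.

Lemma continuous_max2 (T : topologicalType) (f g : T -> R) :
  continuous f -> continuous g -> continuous (fun x => Num.max (f x) (g x)).
Proof.
move=> cf cg x.
rewrite (_ : (fun x => _) = (fun x => (f x + g x + `|f x - g x|) / 2)).
  apply: cvgM; last exact: cvg_cst.
  apply: cvgD; first by apply: cvgD; [exact: cf|exact: cg].
  by apply: cvg_norm; apply: cvgB; [exact: cf|exact: cg].
by apply/funext => y; rewrite maxr_absE.
Qed.

End continuation.

(** * A quadratic norm in which the observer contracts *)

Section complex_matrices.
Variable R : realType.
Local Notation C := R[i].
Local Notation rc := (real_complex R).
Local Notation ReC := (@complex.Re R).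
Local Notation ImC := (@complex.Im R).

Lemma Re_sum (I : Type) (r : seq I) (P : pred I) (F : I -> C) :
  ReC (\sum_(i <- r | P i) F i) = \sum_(i <- r | P i) ReC (F i).
Proof. by apply: big_morph => // -[a b] [a' b']. Qed.

Lemma Im_sum (I : Type) (r : seq I) (P : pred I) (F : I -> C) :
  ImC (\sum_(i <- r | P i) F i) = \sum_(i <- r | P i) ImC (F i).
Proof. by apply: big_morph => // -[a b] [a' b']. Qed.

Lemma Re_mul (x y : C) : ReC (x * y) = ReC x * ReC y - ImC x * ImC y.
Proof. by case: x; case: y. Qed.

Lemma Im_mul (x y : C) : ImC (x * y) = ReC x * ImC y + ImC x * ReC y.
Proof. by case: x; case: y. Qed.

Lemma Re_real_mulmx m n p (x : 'M[R]_(m, n)) (F : 'M[C]_(n, p)) i j :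
  ReC ((map_mx rc x *m F) i j) = (x *m map_mx ReC F) i j.
Proof.
rewrite !mxE Re_sum; apply: eq_bigr => k _.
by rewrite !mxE Re_mul/= mul0r subr0.
Qed.

Lemma Im_real_mulmx m n p (x : 'M[R]_(m, n)) (F : 'M[C]_(n, p)) i j :
  ImC ((map_mx rc x *m F) i j) = (x *m map_mx ImC F) i j.
Proof.
rewrite !mxE Im_sum; apply: eq_bigr => k _.
by rewrite !mxE Im_mul/= mul0r addr0.
Qed.

(** Real form of the map x |-> x F into C^n, seen as R^(2n): by [dot_realify] the real scalar
    product is the real part of the Hermitian one. This is how a complex triangular form yields a
    real quadratic norm. *)
Definition realify n (F : 'M[C]_n) : 'M[R]_(n, n + n) :=
  row_mx (map_mx ReC F) (map_mx ImC F).

Lemma dot_realify n (F : 'M[C]_n) (x y : 'rV[R]_n) :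
  dot (x *m realify F) (y *m realify F) =
  \sum_j (ReC ((map_mx rc x *m F) 0 j) * ReC ((map_mx rc y *m F) 0 j)
    + ImC ((map_mx rc x *m F) 0 j) * ImC ((map_mx rc y *m F) 0 j)).
Proof.
rewrite /realify !mul_mx_row /dot big_split_ord/= -big_split/=; apply: eq_bigr => j _.
by rewrite !row_mxEl !row_mxEr !Re_real_mulmx !Im_real_mulmx.
Qed.

Lemma realify_inv n (F S : 'M[C]_n) : F *m S = 1%:M ->
  exists2 K : R, 0 < K & forall x : 'rV[R]_n, sq x <= K * sq (x *m realify F).
Proof.
move=> FS; pose E' := col_mx (map_mx ReC S) (- map_mx ImC S).
have [K K0 hK] := sq_mulmx E'; exists K => // x.
suff {1}-> : x = x *m realify F *m E' by exact: hK.
rewrite /realify /E' mul_mx_row mul_row_col; apply/rowP => j.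
have : ReC ((map_mx rc x *m F *m S) 0 j) = x 0 j.
  by rewrite -mulmxA FS mulmx1 mxE.
move=> <-; rewrite !mxE Re_sum -big_split/=; apply: eq_bigr => k _.
by rewrite Re_mul Re_real_mulmx Im_real_mulmx !mxE mulrN.
Qed.

Lemma diag_trig_eigenvalue n (A P : 'M[C]_n) : P \in unitmx ->
  is_trig_mx (P *m A *m invmx P) ->
  forall j, eigenvalue A ((P *m A *m invmx P) j j).
Proof.
move=> Pu trig j; rewrite eigenvalue_root_char; set B := P *m A *m invmx P.
have -> : char_poly A = char_poly B.
  have PP : map_mx polyC P *m map_mx polyC (invmx P) = 1%:M.
    by rewrite -map_mxM mulmxV// map_mx1.
  have : char_poly_mx B =
      map_mx polyC P *m char_poly_mx A *m map_mx polyC (invmx P).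
    rewrite /char_poly_mx mulmxBr mulmxBl -!map_mxM; congr (_ - _).
    by rewrite scalar_mxC -mulmxA PP mulmx1.
  rewrite /char_poly => ->; rewrite !det_mulmx mulrAC -det_mulmx PP det1 mul1r//.
rewrite char_poly_trig// rootE horner_prod (bigD1 j)//=.
by rewrite !hornerE subrr mul0r.
Qed.

Lemma mulmx_conj_intertwine n (A P P' D D' : 'M[C]_n) :
  P' *m P = 1%:M -> D' *m D = 1%:M ->
  A *m (P' *m D') = P' *m D' *m (D *m (P *m A *m P') *m D').
Proof.
move=> PP DD; rewrite !mulmxA -(mulmxA P' D' D) DD mulmx1 PP mul1mx.
by [].
Qed.

(** With v_j = |y_j|^2, an off-diagonal entry contributes at most b (v_i + v_j) by the inequality of
    means. Summed over all pairs, the diagonal ones being added for convenience, this is 2 n b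
    |y|^2. *)
Lemma near_diagonal_dissipative n (y : 'rV[C]_n) (B : 'M[C]_n) (a b : R) : 0 <= b ->
  (forall j, ReC (B j j) <= - a) ->
  (forall i j, i != j -> `|ReC (B i j)| + `|ImC (B i j)| <= b) ->
  \sum_j (ReC (y 0 j) * ReC ((y *m B) 0 j) + ImC (y 0 j) * ImC ((y *m B) 0 j)) <=
  (2 * n%:R * b - a) *
    \sum_j (ReC (y 0 j) * ReC (y 0 j) + ImC (y 0 j) * ImC (y 0 j)).
Proof.
move=> b0 hdiag hoff.
pose v j := ReC (y 0 j) * ReC (y 0 j) + ImC (y 0 j) * ImC (y 0 j).
have v0 j : 0 <= v j by rewrite addr_ge0 ?sqr_ge0.
pose ip (u w : C) := ReC u * ReC w + ImC u * ImC w.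
have ip_sum j : ip (y 0 j) ((y *m B) 0 j) = \sum_i ip (y 0 j) (y 0 i * B i j).
  by rewrite /ip mxE Re_sum Im_sum !mulr_sumr -big_split.
have amgm (p q r : R) : 2 * (p * q * r) <= (p * p + q * q) * `|r|.
  apply: (le_trans (ler_norm _)); rewrite mulrA normrM ler_wpM2r//.
  by rewrite ler_norml; have := sqr_ge0 (p - q); have := sqr_ge0 (p + q); lra.
have off i j : i != j -> ip (y 0 j) (y 0 i * B i j) <= b * (v i + v j).
  move=> ij; have Bb := hoff i j ij.
  set r := ReC (B i j) in Bb; set s := ImC (B i j) in Bb.
  have -> : ip (y 0 j) (y 0 i * B i j) =
     (ReC (y 0 j) * ReC (y 0 i) + ImC (y 0 j) * ImC (y 0 i)) * r +
     (ImC (y 0 j) * ReC (y 0 i) - ReC (y 0 j) * ImC (y 0 i)) * s.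
    by rewrite /ip Re_mul Im_mul -/r -/s; ring.
  have h1 := amgm (ReC (y 0 j)) (ReC (y 0 i)) r.
  have h2 := amgm (ImC (y 0 j)) (ImC (y 0 i)) r.
  have h3 := amgm (ImC (y 0 j)) (ReC (y 0 i)) s.
  have h4 := amgm (- ReC (y 0 j)) (ImC (y 0 i)) s.
  have : (v i + v j) * (`|r| + `|s|) <= (v i + v j) * b by rewrite ler_wpM2l// addr_ge0.
  have := mulr_ge0 (v0 i) (normr_ge0 r); have := mulr_ge0 (v0 j) (normr_ge0 r).
  have := mulr_ge0 (v0 i) (normr_ge0 s); have := mulr_ge0 (v0 j) (normr_ge0 s).
  by rewrite /v; lra.
apply: (@le_trans _ _ (\sum_j (- a * v j + \sum_i b * (v i + v j)))).
  apply: ler_sum => j _; rewrite -/(ip (y 0 j) ((y *m B) 0 j)) ip_sum.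
  rewrite (bigD1 j)//= [X in _ <= _ + X](bigD1 j)//= lerD//; last first.
    rewrite ler_wpDl//; first by apply: mulr_ge0 => //; exact: addr_ge0.
    by apply: ler_sum => i ij; exact: off.
  have -> : ip (y 0 j) (y 0 j * B j j) = ReC (B j j) * v j.
    by rewrite /ip /v Re_mul Im_mul; ring.
  by rewrite ler_wpM2r.
set V := (X in _ <= _ * X).
rewrite big_split/= -mulr_sumr.
have VE : \sum_j v j = V by [].
have -> : \sum_j \sum_i b * (v i + v j) = b * (2 * n%:R) * V.
  rewrite (eq_bigr (fun j => b * (V + v j * n%:R))) => [|j _]; last first.
    by rewrite -mulr_sumr big_split/= sumr_const card_ord VE -[_ *+ n]mulr_natr.
  rewrite -mulr_sumr big_split/= sumr_const card_ord -mulr_suml VE.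
  by rewrite -[_ *+ n]mulr_natr; ring.
by rewrite VE; lra.
Qed.

(** Schur's form makes the matrix lower triangular, and conjugation by diag(dl^i) multiplies the
    entry (i, j) by dl^(i - j). All entries below the diagonal become small, and the diagonal, whose
    real parts are negative, dominates. No Lyapunov equation has to be solved. *)
Theorem lyapunov_of_eigenvalues n (A : 'M[R]_n) : (0 < n)%N ->
  (forall l : C, eigenvalue (map_mx rc A) l -> ReC l < 0) ->
  exists (E : 'M[R]_(n, n + n)) (alpha K : R), [/\ 0 < alpha, 0 < K,
    forall x, sq x <= K * sq (x *m E) &
    forall x, dot (x *m E) (x *m A *m E) <= - alpha * sq (x *m E)].
Proof.
move=> n0 eigA; set Ac := map_mx rc A.
have [P Punit] := Schur Ac n0.
have Pu := unitarymx_unit Punit.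
rewrite /similar_to /= conjumx// => trig.
set B0 := P *m Ac *m invmx P in trig.
have lt0 j : ReC (B0 j j) < 0 by apply/eigA/diag_trig_eigenvalue.
have [a a0 ha] : exists2 a : R, 0 < a & forall j, ReC (B0 j j) <= - a.
  pose i0 := Ordinal n0.
  exists (- (\big[Num.max/ReC (B0 i0 i0)]_j ReC (B0 j j))) => [|j].
    by rewrite oppr_gt0; apply: bigmax_lt => // j _; exact: lt0.
  by rewrite opprK; exact: le_bigmax.
pose M := 1 + \sum_i \sum_j (`|ReC (B0 i j)| + `|ImC (B0 i j)|).
have Mij i j : `|ReC (B0 i j)| + `|ImC (B0 i j)| <= M.
  rewrite /M (bigD1 i)//= (bigD1 j)//=.
  have : 0 <= \sum_(i0 | i0 != j) (`|ReC (B0 i i0)| + `|ImC (B0 i i0)|).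
    by apply: sumr_ge0 => k _; rewrite addr_ge0.
  have : 0 <= \sum_(i0 | i0 != i) \sum_j (`|ReC (B0 i0 j)| + `|ImC (B0 i0 j)|).
    by apply: sumr_ge0 => k _; apply: sumr_ge0 => k' _; rewrite addr_ge0.
  lra.
have M0 : 0 < M.
  rewrite /M ltr_pwDl// sumr_ge0// => i _; apply: sumr_ge0 => k' _.
  by rewrite addr_ge0.
pose N : R := n%:R.
have N1 : 1 <= N by rewrite /N ler1n.
(* With this value the off-diagonal contribution 2 n dl M is at most a / 2, half of the decay given
   by the diagonal. *)
pose dl : R := Num.min 1 (a / (4 * N * M)).
have dl0 : 0 < dl.
  by rewrite lt_min ltr01 divr_gt0// !mulr_gt0// (lt_le_trans ltr01).
have dl1 : dl <= 1 by rewrite ge_min lexx.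
have dla : dl * M * (2 * N) <= a / 2.
  have NM0 : 0 < 4 * N * M by rewrite !mulr_gt0// (lt_le_trans ltr01).
  have : dl <= a / (4 * N * M) by rewrite ge_min lexx orbT.
  by rewrite ler_pdivlMr//; clearbody dl N M; lra.
pose D := diag_mx (\row_(i < n) rc (dl ^+ i)).
pose D' := diag_mx (\row_(i < n) rc (dl ^- i)).
have dlu (i : nat) : dl ^+ i != 0 by rewrite expf_neq0// gt_eqF.
have DD' : D' *m D = 1%:M.
  apply/matrixP => i j; rewrite mul_diag_mx !mxE.
  have [->|ij] := eqVneq i j; last by rewrite mulr0n mulr0.
  by rewrite !mulr1n -rmorphM mulVf// rmorph1.
pose F := invmx P *m D'; pose S := D *m P.
pose B := D *m B0 *m D'.
have FS : F *m S = 1%:M by rewrite /F /S mulmxA -(mulmxA _ D') DD' mulmx1 mulVmx.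
have AF : Ac *m F = F *m B.
  exact: mulmx_conj_intertwine (mulVmx Pu) DD'.
have BE i j : B i j = rc (dl ^+ i) * B0 i j * rc (dl ^- j).
  by rewrite /B mul_mx_diag mxE mul_diag_mx !mxE.
have Boff i j : i != j -> `|ReC (B i j)| + `|ImC (B i j)| <= dl * M.
  move=> ij; have [lt_ij|le_ji] := ltnP i j.
    have /is_trig_mxP/(_ i j lt_ij) Bij := trig.
    by rewrite BE Bij mulr0 mul0r /= normr0 addr0 mulr_ge0// ltW.
  have lt_ji : (j < i)%N by rewrite ltn_neqAle le_ji andbT eq_sym.
  have -> : B i j = rc (dl ^+ i * dl ^- j) * B0 i j by rewrite BE mulrAC -rmorphM.
  have e0 : 0 <= dl ^+ i * dl ^- j.
    by rewrite mulr_ge0 ?invr_ge0 ?exprn_ge0// ltW.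
  have edl : dl ^+ i * dl ^- j <= dl.
    rewrite -expfB// -[leRHS]expr1 ler_wiXn2l ?subn_gt0//.
    exact: ltW.
  move: (dl ^+ i / dl ^+ j) e0 edl => e e0 edl.
  rewrite Re_mul Im_mul/= !mul0r subr0 addr0 !normrM (ger0_norm e0) -mulrDr.
  by rewrite ler_pM// addr_ge0.
have [K K0 hK] := realify_inv FS.
exists (realify F), (a / 2), K; split => //; first by rewrite divr_gt0.
move=> x; rewrite /sq !dot_realify.
have -> : map_mx rc (x *m A) *m F = map_mx rc x *m F *m B.
  by rewrite map_mxM -mulmxA -/Ac AF mulmxA.
apply: (le_trans (@near_diagonal_dissipative n (map_mx rc x *m F) B a (dl * M) _ _ _)).
- by rewrite mulr_ge0// ltW.
- by move=> j; rewrite BE mulrAC -rmorphM mulfV// rmorph1 mul1r.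
- exact: Boff.
rewrite ler_wpM2r//.
  by apply: sumr_ge0 => j _; rewrite addr_ge0 ?sqr_ge0.
by rewrite -/N; clearbody dl N M; lra.
Qed.

End complex_matrices.

Section observer.
Variables (R : realType) (d : nat).
Implicit Types (c : 'I_d.+1 -> R) (x : 'rV[R]_d.+1).

Definition shift_row (K : nzRingType) (x : 'rV[K]_d.+1) : 'rV[K]_d.+1 :=
  \row_j (if insub j.+1 is Some j' then x 0 (j' : 'I_d.+1) else 0).

(** Acts on row vectors from the right: a left shift minus x_0 times the reversed coefficients,
    which is the linear part of the observer for kappa = 1. *)
Definition companion c : 'M[R]_d.+1 :=
  \matrix_(i, j) ((i == j.+1 :> nat)%:R - (i == 0%N :> nat)%:R * c (rev_ord j)).

(** The ring morphism serves two uses: the embedding into the complex numbers for eigenvectors, and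
    the identity for the observer. *)
Lemma mulmx_companion (K : comNzRingType) (f : {rmorphism R -> K}) c (x : 'rV[K]_d.+1) :
  x *m map_mx f (companion c) =
  shift_row x - x 0 0 *: \row_j f (c (rev_ord j)).
Proof.
apply/rowP => j; rewrite !mxE.
under eq_bigr => i _ do
  rewrite !mxE rmorphB rmorphM !rmorph_nat mulrBr mulrA.
rewrite sumrB; congr (_ - _); last first.
  rewrite (bigD1 0)//= big1 ?addr0 ?mulr1// => i /negPf i0.
  by rewrite (_ : (i == 0 :> nat) = false) ?mulr0 ?mul0r// -i0.
case: insubP => [j' _ j'E|].
  rewrite (bigD1 j')//= j'E eqxx mulr1 big1 ?addr0// => i.
  by rewrite -val_eqE/= j'E => /negPf ->; rewrite mulr0.
rewrite -leqNgt => jd; apply: big1 => i _.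
by rewrite ltn_eqF ?mulr0// (leq_trans (ltn_ord i)).
Qed.

(** The eigenvector equation is the recurrence w_(k+1) = l w_k + c_(d-k) w_0. Unrolled up to k = d +
    1, where w vanishes, it says that w_0 times the value of the polynomial at l is 0; and w_0 = 0
    would make the whole eigenvector vanish. *)
Lemma eigenvalue_companion c (l : R[i]) :
  eigenvalue (map_mx (real_complex R) (companion c)) l ->
  root (map_poly (real_complex R) (char_poly_of c)) l.
Proof.
move=> /eigenvalueP[v]; rewrite mulmx_companion => vl v0.
(* Extension by 0 past the last index: the last row of the equation becomes the recurrence with
   w_(d+1) = 0. *)
pose w (k : nat) := if insub k is Some i then v 0 (i : 'I_d.+1) else 0.
pose cc (k : nat) := real_complex R (if insub (d - k)%N is Some i then c i else 0).
have wv (i : 'I_d.+1) : w i = v 0 i by rewrite /w valK.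
have ccv (i : 'I_d.+1) : cc i = real_complex R (c (rev_ord i)).
  by rewrite /cc (_ : (d - i)%N = val (rev_ord i)) ?valK//= subSS.
have wS k : (k <= d)%N -> w k.+1 = l * w k + cc k * w 0%N.
  move=> kd; have /rowP/(_ (Ordinal (kd : (k < d.+1)%N))) := vl.
  rewrite !mxE/= => /eqP; rewrite subr_eq => /eqP; rewrite -/(w k.+1) => ->.
  pose i := Ordinal (kd : (k < d.+1)%N).
  by rewrite [v 0 0 * _]mulrC -(wv 0) -(ccv i) -(wv i).
have wE k : (k <= d.+1)%N ->
    w k = (l ^+ k + \sum_(j < k) cc j * l ^+ (k - j.+1)) * w 0%N.
  elim: k => [_|k IH kd]; first by rewrite expr0 big_ord0 addr0 mul1r.
  rewrite wS// (IH (ltnW kd)) big_ord_recr/= subnn expr0 mulr1 mulrA -mulrDl; congr (_ * _).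
  rewrite exprS mulrDr mulr_sumr -!addrA; congr (_ + (_ + _)).
  apply: eq_bigr => j _; rewrite mulrCA -exprS; congr (_ * _ ^+ _).
  by rewrite subSS -subSn.
have w00 : w 0%N != 0.
  apply: contraNneq v0 => w0; apply/eqP/rowP => j; rewrite mxE.
  by have := wE j (ltnW (ltn_ord j)); rewrite w0 mulr0 wv.
have /eqP := wE d.+1 (leqnn _).
rewrite {1}/w insubN ?ltnn// eq_sym mulf_eq0 (negPf w00) orbF => /eqP lE.
apply/rootP; rewrite /char_poly_of rmorphD/= map_polyXn hornerD hornerXn -[RHS]lE.
congr (_ + _); rewrite rmorph_sum horner_sum.
rewrite (reindex_inj rev_ord_inj)/=; apply: eq_bigr => j _.
rewrite -mul_polyC rmorphM/= map_polyC map_polyXn hornerM hornerC hornerXn subSS.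
by rewrite ccv.
Qed.

Variable (c : 'I_d.+1 -> R).
Hypothesis hurwitz_c : hurwitz (char_poly_of c).

Definition observer_field (phic : 'rV[R]_d.+1 -> R) (kappa : R) x : 'rV[R]_d.+1 :=
  Phi phic x - x 0 0 *: gainG c kappa.

(** In the coordinates z = x diag(kappa^-i) the linear part is kappa times the companion matrix. The
    nonlinearity enters the last component only, where it is divided by kappa^d; for kappa >= 1 it
    stays bounded by L |z|, so its Lipschitz constant does not grow with kappa and a large kappa
    dominates it. *)
Theorem observer_contraction (phic : 'rV[R]_d.+1 -> R) (L : R) : 0 < L ->
  (forall x y, `|phic x - phic y| <= L * `|x - y|) ->
  exists2 kappa_star : R, 0 < kappa_star & forall kappa, kappa_star <= kappa ->
  exists e (E : 'M[R]_(d.+1, e)) (K : R), [/\ 0 < K,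
    forall x, sq x <= K * sq (x *m E) &
    forall x y, dot ((x - y) *m E)
      ((observer_field phic kappa x - observer_field phic kappa y) *m E)
      <= - sq ((x - y) *m E)].
Proof.
move=> L0 phicL.
have [|E [a [K [a0 K0 hK hE]]]] := @lyapunov_of_eigenvalues R d.+1 (companion c) (ltn0Sn d).
  by move=> l /eigenvalue_companion; exact: hurwitz_c.
pose el : 'rV[R]_d.+1 := \row_j (j == d :> nat)%:R.
(* The cross term with the nonlinearity costs at most (1 + L^2 K |el E|^2) / 2 times V, and a
   further 1 is the decay rate to be reached; kappa times a has to exceed the sum. *)
pose ks := (1 + (1 + L ^+ 2 * K * sq (el *m E)) / 2) / a.
have ks0 : 0 < ks.
  by rewrite divr_gt0// ltr_wpDr// divr_ge0// addr_ge0// !mulr_ge0// ?sq_ge0 ?sqr_ge0// ltW.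
exists (Num.max 1 ks); first by rewrite lt_max ltr01.
move=> k; rewrite ge_max => /andP[k1 ksk].
have k0 : 0 < k by apply: lt_le_trans k1.
have ku (i : nat) : k ^+ i != 0 by rewrite expf_neq0// gt_eqF.
pose D := diag_mx (\row_(i < d.+1) k ^+ i).
pose D' := diag_mx (\row_(i < d.+1) k ^- i).
have DD' : D' *m D = 1%:M.
  apply/matrixP => i j; rewrite mul_diag_mx !mxE.
  have [->|ij] := eqVneq i j; last by rewrite mulr0n mulr0.
  by rewrite !mulr1n mulVf.
have DD : D *m D' = 1%:M by apply: mulmx1C.
exists (d.+1 + d.+1)%N, (D' *m E).
have [KD KD0 hKD] := sq_mulmx D.
exists (KD * K); split; first exact: mulr_gt0.
  move=> x; rewrite -{1}(mulmx1 x) -DD' mulmxA (le_trans (hKD _))//.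
  by rewrite -mulrA ler_wpM2l ?(ltW KD0)// (mulmxA x) hK.
move=> x y; set th := x - y; pose z := th *m D'.
have thz : th = z *m D by rewrite /z -mulmxA DD' mulmx1.
pose dl := phic x - phic y.
have -> : observer_field phic k x - observer_field phic k y =
    k *: (z *m companion c *m D) - dl *: el.
  have idm : companion c = map_mx idfun (companion c) by rewrite map_mx_id.
  rewrite idm (mulmx_companion (idfun : {rmorphism R -> R})).
  apply/rowP => j; rewrite mul_mx_diag /z mul_mx_diag /observer_field /Phi /th !mxE.
  case: insubP => [j' _ j'E|].
    have jd : j != d :> nat by have := ltn_ord j'; rewrite j'E ltnS => /ltn_eqF ->.
    rewrite !mxE (negPf jd) j'E/= expr0 exprS.
    have -> : (0%:R : R) = 0 by [].
    by field; rewrite ?ku ?(gt_eqF k0).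
  rewrite -leqNgt ltnS => dj.
  have -> : j = d :> nat by apply/eqP; rewrite eqn_leq dj -ltnS ltn_ord.
  rewrite eqxx/= expr0 /dl exprS.
  have -> : (1%:R : R) = 1 by [].
  by field; rewrite ?ku ?(gt_eqF k0).
have -> : th *m (D' *m E) = z *m E by rewrite mulmxA.
have -> : (k *: (z *m companion c *m D) - dl *: el) *m (D' *m E) =
    k *: (z *m companion c *m E) - dl *: (el *m (D' *m E)).
  rewrite mulmxBl -!scalemxAl; congr (_ *: _ - _).
  by rewrite mulmxA -(mulmxA (z *m companion c) D D') DD mulmx1.
set V := sq (z *m E).
have elD : el *m (D' *m E) = k ^- d *: (el *m E).
  rewrite mulmxA scalemxAl; congr (_ *m _); apply/rowP => j.
  rewrite mul_mx_diag !mxE; have [->|] := eqVneq (j : nat) d; first by rewrite mul1r mulr1.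
  by rewrite mul0r mulr0.
rewrite elD dotDr dotZr dotNr -dotNr -scaleNr scalerA.
set t := - dl * k ^- d.
have V0 : 0 <= V := sq_ge0 _.
have zth : k ^- d * `|th| <= `|z|.
  rewrite mulrC ler_pdivrMr ?exprn_gt0// thz.
  apply: norm_le_coord => [|i]; first by rewrite mulr_ge0// exprn_ge0// ltW.
  have -> (u : 'rV[R]_d.+1) : (u *m D) 0 i = u 0 i * k ^+ i.
    by rewrite mul_mx_diag !mxE.
  rewrite normrM ler_pM//; first exact: coord_norm_le.
  rewrite ger0_norm ?exprn_ge0 ?(ltW k0)// ler_weXn2l//.
  by rewrite -ltnS ltn_ord.
have t2 : t ^+ 2 <= L ^+ 2 * K * V.
  apply: (@le_trans _ _ ((L * `|z|) ^+ 2)); last first.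
    rewrite exprMn -mulrA ler_wpM2l ?sqr_ge0//.
    exact: le_trans (norm_sq_le _) (hK z).
  rewrite -real_normK ?num_real// lerXn2r ?nnegrE// ?mulr_ge0// ?(ltW L0)//.
  rewrite /t normrM normrN (ger0_norm (_ : 0 <= k ^- d)) ?invr_ge0 ?exprn_ge0 ?(ltW k0)//.
  apply: (@le_trans _ _ (L * (k ^- d * `|th|))); last by rewrite ler_wpM2l// ltW.
  rewrite mulrCA [leRHS]mulrC ler_wpM2r ?invr_ge0 ?exprn_ge0 ?(ltW k0)//.
  exact: phicL.
have h1 := dot_amgm1 (z *m E) (t *: (el *m E)); rewrite sqZ -/V in h1.
have h2 : t ^+ 2 * sq (el *m E) <= L ^+ 2 * K * V * sq (el *m E).
  by rewrite ler_wpM2r// sq_ge0.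
have h3 : k * dot (z *m E) (z *m companion c *m E) <= k * (- a * V).
  by rewrite ler_wpM2l ?(ltW k0)//; exact: hE.
have h4 : (1 + (1 + L ^+ 2 * K * sq (el *m E)) / 2) * V <= k * a * V.
  by rewrite ler_wpM2r// -ler_pdivrMr.
lra.
Qed.

End observer.

(** * Ordinary differential equations *)

Section picard.
Variable R : realType.

Lemma primitive (g : R -> R) (a : R) : continuous g ->
  exists G : R -> R, forall t, a < t -> is_derive t 1 G (g t).
Proof.
move=> cg; exists (fun x => \int[lebesgue_measure]_(t in `[a, x]) g t) => t at_.
have ti : t < t + 1 by rewrite ltrDl.
have [|||D E] := @continuous_FTC1_closed R g a t (t + 1) ti.
- apply: continuous_compact_integrable; first exact: segment_compact.
  exact: continuous_subspaceT.
- by [].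
- exact: cg.
by apply: DeriveDef; [exact: D|rewrite -derive1E E].
Qed.

Lemma near_lt (x z : R) : x < z -> \forall y \near x, y < z.
Proof.
move=> xz; apply/nbhs_ballP; exists (z - x); rewrite /= ?subr_gt0// => y.
by rewrite /ball/=/ball_/= distrC => /(le_lt_trans (ler_norm _)); rewrite ltrBlDr subrK.
Qed.

(** Frozen at x0 to the left of t0, so that the primitive is continuous on the whole line and can be
    fed back into the iteration. The scalar primitives start at t0 - 1 in order to be differentiable
    at t0 itself. *)
Lemma primitive_rV m (g : R -> 'rV[R]_m) (t0 : R) (x0 : 'rV[R]_m) : continuous g ->
  exists G : R -> 'rV[R]_m, [/\ continuous G, forall t, t <= t0 -> G t = x0 &
    forall t, t0 < t -> is_derive t 1 G (g t)].
Proof.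
move=> cg.
have [H hH] := choice (fun i : 'I_m => @primitive (fun t => g t 0 i) (t0 - 1)
  (fun t => continuous_comp (cg t) (@coord_continuous _ _ _ 0 i (g t)))).
pose G t := \row_i (x0 0 i + (H i (Num.max t0 t) - H i t0)).
exists G; split.
- move=> t.
  have cH i : {for Num.max t0 t, continuous (H i)}.
    apply: differentiable_continuous; apply/derivable1_diffP.
    have [|//] := hH i (Num.max t0 t).
    by rewrite (@lt_le_trans _ _ t0) ?le_max ?lexx// ltrBlDr ltrDl.
  have cmax : {for t, continuous (fun t => Num.max t0 t)}.
    by apply: continuous_max2 => // s; [exact: cvg_cst|exact: cvg_id].
  apply/cvgrPdist_le => e e0.
  have : \forall s \near t, forall i,
      `|H i (Num.max t0 t) - H i (Num.max t0 s)| <= e.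
    apply: (@filter_forall R 'I_m (fun i s =>
      `|H i (Num.max t0 t) - H i (Num.max t0 s)| <= e) (nbhs t) _) => i.
    by have /cvgrPdist_le := continuous_comp cmax (cH i); exact.
  apply: filterS => s hs; apply: norm_le_coord => [|i]; first exact: ltW.
  by rewrite !mxE opprD addrACA subrr add0r opprD opprK addrACA addNr addr0 hs.
- by move=> t tt0; apply/rowP => i; rewrite mxE max_l// subrr addr0.
- move=> t tt0; apply: is_derive_mx => i j; rewrite (ord1 i).
  have tt : t0 - 1 < t by rewrite (lt_trans _ tt0)// ltrBlDr ltrDl.
  have Dj := hH j t tt.
  have : is_derive t 1 (fun t => x0 0 j + (H j t - H j t0)) (g t 0 j).
    by apply: is_derive_eq; ring.
  apply: near_eq_is_derive; rewrite ?oner_neq0//.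
  near=> s; rewrite mxE max_r// ltW//.
  by near: s; exact: lt_nbhsr.
Unshelve. all: by end_near. Qed.

(** Monotonicity of h - s w for s = 1 and s = -1 replaces the integration of |w'|. *)
Lemma norm_increment_le (w h dw dh : R -> R) (a b : R) : a <= b ->
  {within `[a, b], continuous w} -> {within `[a, b], continuous h} ->
  (forall t, a < t -> t < b -> is_derive t 1 w (dw t)) ->
  (forall t, a < t -> t < b -> is_derive t 1 h (dh t)) ->
  (forall t, a < t -> t < b -> `|dw t| <= dh t) ->
  `|w b - w a| <= h b - h a.
Proof.
move=> ab cw ch Dw Dh le_d.
have mono (s : R) : `|s| <= 1 -> s * (w b - w a) <= h b - h a.
  move=> s1; pose g t := h t - s * w t.
  have Dg t : a < t -> t < b -> is_derive t 1 g (dh t - s * dw t).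
    move=> at_ tb; have D1 := Dw t at_ tb; have D2 := Dh t at_ tb.
    by apply: is_derive_eq; rewrite /GRing.scale/=; ring.
  suff : g a <= g b by rewrite /g; lra.
  apply: (@ger0_derive1_le_cc _ g a b); rewrite ?in_itv/= ?lexx ?ab//.
  - by move=> t; rewrite in_itv/= => /andP[a1 b1]; case: (Dg t a1 b1).
  - move=> t; rewrite in_itv/= => /andP[a1 b1]; have [_] := Dg t a1 b1.
    rewrite derive1E => ->; rewrite subr_ge0 (le_trans (ler_norm _))//.
    by rewrite normrM (le_trans _ (le_d t a1 b1))// ler_piMl.
  - move=> t; apply: cvgB; first exact: ch.
    by apply: cvgM; [exact: cvg_cst|exact: cw].
rewrite ler_norml; have := mono 1; have := mono (-1).
by rewrite normrN normr1 lexx => /(_ isT) h1 /(_ isT) h2; apply/andP; split; lra.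
Qed.

Lemma geometric_le0 (x A : R) : (forall n, x <= A / 2 ^+ n) -> x <= 0.
Proof.
move=> xA; rewrite leNgt; apply/negP => x0.
have A0 : 0 < A by have := xA 0%N; rewrite expr0 divr1; exact: lt_le_trans.
pose n := (Num.truncn (A / x)).+1.
have := xA n; rewrite ler_pdivlMr ?exprn_gt0// leNgt => /negP; apply.
rewrite mulrC -ltr_pdivrMr//; apply: (lt_le_trans (truncnS_gt _)).
by rewrite -natrX ler_nat ltnW// ltn_expl.
Qed.

(** The intervals centred at a_n of radius 2 C / 2^n are nested; the supremum of their left ends is
    the limit. *)
Lemma geometric_lim (a : nat -> R) (C : R) :
  (forall n, `|a n.+1 - a n| <= C / 2 ^+ n) ->
  forall n, `|a n - limn a| <= 2 * C / 2 ^+ n.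
Proof.
move=> da.
have C0 : 0 <= C by have := da 0%N; rewrite expr0 divr1; exact: le_trans.
have q0 n : 0 <= C / 2 ^+ n by rewrite divr_ge0// exprn_ge0.
have half n : C / 2 ^+ n.+1 = C / 2 ^+ n / 2.
  by rewrite exprSr invfM mulrA.
pose lo n := a n - 2 * (C / 2 ^+ n); pose hi n := a n + 2 * (C / 2 ^+ n).
have lo_step n : lo n <= lo n.+1.
  by rewrite /lo half; have := da n; rewrite ler_norml; lra.
have hi_step n : hi n.+1 <= hi n.
  by rewrite /hi half; have := da n; rewrite ler_norml; lra.
have lo_mono m n : (m <= n)%N -> lo m <= lo n.
  elim: n => [|n IH]; first by rewrite leqn0 => /eqP ->.
  by rewrite leq_eqVlt => /orP[/eqP -> //|/IH/le_trans]; apply.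
have hi_mono m n : (m <= n)%N -> hi n <= hi m.
  elim: n => [|n IH]; first by rewrite leqn0 => /eqP ->.
  by rewrite leq_eqVlt => /orP[/eqP -> //|/IH]; apply: le_trans.
have lohi m n : lo m <= hi n.
  apply: (le_trans (lo_mono m (maxn m n) (leq_maxl _ _))).
  apply: (le_trans _ (hi_mono n (maxn m n) (leq_maxr _ _))).
  by rewrite /lo /hi; have := q0 (maxn m n); lra.
pose x := sup (range lo).
have hs : has_sup (range lo).
  split; first by exists (lo 0%N), 0%N.
  by exists (hi 0%N) => _ [n _ <-].
have xa n : `|a n - x| <= 2 * C / 2 ^+ n.
  have h1 : lo n <= x by apply: ub_le_sup; [case: hs|exists n].
  have h2 : x <= hi n by apply: ge_sup; [case: hs|move=> _ [m _ <-]].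
  by move: h1 h2; rewrite /lo /hi -mulrA ler_norml => h1 h2; apply/andP; split; lra.
suff -> : limn a = x by [].
apply: cvg_lim => //; apply/cvgrPdist_le => e e0.
have : \forall n \near \oo, 2 * C / 2 ^+ n <= e.
  have cv : (fun n => 2 * C * 2^-1 ^+ n : R) @ \oo --> 0.
    rewrite -[X in _ --> X](mulr0 (2 * C)); apply: cvgM; first exact: cvg_cst.
    by apply: cvg_expr; rewrite ger0_norm ?invr_ge0//; lra.
  move/cvgrPdist_le : cv => /(_ _ e0); apply: filterS => n.
  by rewrite sub0r normrN exprVn => /(le_trans (ler_norm _)).
by apply: filterS => n; rewrite distrC; exact: le_trans.
Qed.

Section picard_lindelof.
Variables (m : nat) (F : R -> 'rV[R]_m -> 'rV[R]_m) (L t0 : R) (x0 : 'rV[R]_m).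
Hypothesis F_continuous :
  forall x : R -> 'rV[R]_m, continuous x -> continuous (fun t => F t (x t)).
Hypothesis L_gt0 : 0 < L.
Hypothesis F_lipschitz : forall t x y, `|F t x - F t y| <= L * `|x - y|.

Lemma picard_increment_le (u1 u2 v1 v2 : R -> 'rV[R]_m) (h dh : R -> R) (t : R) : t0 <= t ->
  continuous u1 -> continuous u2 -> u1 t0 = u2 t0 ->
  (forall s, t0 < s -> is_derive s 1 u1 (F s (v1 s))) ->
  (forall s, t0 < s -> is_derive s 1 u2 (F s (v2 s))) ->
  {within `[t0, t], continuous h} -> 0 <= h t0 ->
  (forall s, t0 < s -> s < t -> is_derive s 1 h (dh s)) ->
  (forall s, t0 < s -> s < t -> L * `|v1 s - v2 s| <= dh s) ->
  0 <= h t -> `|u1 t - u2 t| <= h t.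
Proof.
move=> t0t cu1 cu2 u12 D1 D2 ch h0 Dh le_h ht; apply: norm_le_coord => // i.
have := @norm_increment_le (fun s => (u1 s - u2 s) 0 i) h
  (fun s => (F s (v1 s) - F s (v2 s)) 0 i) dh t0 t t0t.
rewrite (_ : (u1 t0 - u2 t0) 0 i = 0) ?subr0; last by rewrite u12 subrr mxE.
move=> le1.
rewrite (le_trans (le1 _ _ _ _ _))//.
- apply: continuous_subspaceT => s.
  apply: (@continuous_comp _ _ _ (fun s => u1 s - u2 s) (fun x : 'rV[R]_m => x 0 i)).
    by apply: cvgB; [exact: cu1|exact: cu2].
  exact: coord_continuous.
- move=> s t0s _; apply: (is_derive_coord 0 i (dx := F s (v1 s) - F s (v2 s))).
  by apply: is_deriveB; [exact: D1|exact: D2].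
- move=> s t0s st; apply: (le_trans (coord_norm_le _ _)).
  exact: le_trans (F_lipschitz _ _ _) (le_h s t0s st).
- by rewrite gerBl.
Qed.

Theorem picard_lindelof : exists v : R -> 'rV[R]_m,
  [/\ continuous v, v t0 = x0 & forall t, t0 < t -> is_derive t 1 v (F t (v t))].
Proof.
(* A primitive is chosen for every u. The default value for a discontinuous u does no harm, since
   all iterates are continuous. *)
have exK (u : R -> 'rV[R]_m) : exists v : R -> 'rV[R]_m, continuous u ->
    [/\ continuous v, forall t, t <= t0 -> v t = x0 &
        forall t, t0 < t -> is_derive t 1 v (F t (u t))].
  have [cu|ncu] := pselect (continuous u); last by exists (fun=> x0).
  by have [G hG] := primitive_rV t0 x0 (F_continuous cu); exists G.
have [K hK] := choice exK.
pose u n := iter n K (fun=> x0).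
have cu n : continuous (u n).
  elim: n => [|n IH]; first by move=> t; exact: cvg_cst.
  by case: (hK (u n) IH).
have u_left n t : t <= t0 -> u n t = x0.
  by case: n => [//|n]; case: (hK (u n) (cu n)) => _ + _; apply.
have Du n t : t0 < t -> is_derive t 1 (u n.+1) (F t (u n t)).
  by case: (hK (u n) (cu n)) => _ _; apply.
have step_le b : t0 <= b -> exists2 B : R, 0 <= B & forall n t, t <= b ->
    `|u n.+1 t - u n t| <= B / 2 ^+ n.
  move=> t0b.
  have [B B0 hB] : exists2 B : R, 0 < B & forall t, t0 <= t -> t <= b ->
      `|u 1%N t - u 0%N t| <= B.
    have cpt : compact ((fun t => u 1%N t - u 0%N t) @` `[t0, b]).
      apply: continuous_compact; last exact: segment_compact.
      by apply: continuous_subspaceT => t; apply: cvgB; exact: cu.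
    have [B B0 hB] := compact_norm_le cpt; exists B => // t t1 t2; apply: hB.
    by exists t => //=; rewrite in_itv/= t1.
  (* The weight exp(2 L (t - t0)) makes each iteration halve the increment whatever the length of
     the interval; without a weight, L (b - t0) < 1 would be needed. *)
  have main n t : t0 <= t -> t <= b ->
      `|u n.+1 t - u n t| <= B / 2 ^+ n * expR (2 * L * (t - t0)).
    elim: n t => [|n IH] t t0t tb.
      rewrite expr0 divr1 (le_trans (hB t t0t tb))// ler_peMr ?(ltW B0)//.
      by rewrite -expR0 ler_expR mulr_ge0 ?subr_ge0// mulr_ge0// ltW.
    apply: (@picard_increment_le _ _ (u n.+1) (u n)
      (fun t => B / 2 ^+ n.+1 * expR (2 * L * (t - t0)))
      (fun t => B / 2 ^+ n.+1 * (2 * L * expR (2 * L * (t - t0))))) => //.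
    - by rewrite !u_left.
    - apply: continuous_subspaceT => s; apply: cvgM; first exact: cvg_cst.
      apply: (@continuous_comp _ _ _ (fun s => 2 * L * (s - t0)) expR).
        by apply: cvgM; [exact: cvg_cst|apply: cvgB; [exact: cvg_id|exact: cvg_cst]].
      exact: continuous_expR.
    - by rewrite mulr_ge0 ?expR_ge0// divr_ge0 ?exprn_ge0// ltW.
    - move=> s _ _; apply: is_derive_eq; rewrite /GRing.scale/=; ring.
    - move=> s t0s st; have := IH s (ltW t0s) (le_trans (ltW st) tb).
      rewrite -(ler_pM2l L_gt0) => /le_trans; apply.
      by rewrite exprS le_eqVlt; apply/orP; left; apply/eqP; field; rewrite expf_neq0.
    - by rewrite mulr_ge0 ?expR_ge0// divr_ge0 ?exprn_ge0// ltW.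
  exists (B * expR (2 * L * (b - t0))).
    by rewrite mulr_ge0 ?expR_ge0// ltW.
  move=> n t tb; have [tt0|t0t] := leP t t0.
    rewrite !u_left// subrr normr0 divr_ge0 ?exprn_ge0// mulr_ge0 ?expR_ge0//.
    exact: ltW.
  apply: (le_trans (main n t (ltW t0t) tb)); rewrite mulrAC.
  rewrite ler_wpM2r ?invr_ge0 ?exprn_ge0// ler_wpM2l ?(ltW B0)// ler_expR.
  by rewrite ler_wpM2l ?lerB// mulr_ge0// ltW.
pose w t := \row_i limn (fun n => u n t 0 i).
have uw b : t0 <= b -> exists2 B : R, 0 <= B & forall n t, t <= b ->
    `|u n t - w t| <= B / 2 ^+ n.
  move=> /step_le[B B0 hB]; exists (2 * B) => [|n t tb]; first by rewrite mulr_ge0.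
  apply: norm_le_coord => [|i]; first by rewrite divr_ge0 ?exprn_ge0// mulr_ge0.
  rewrite !mxE; apply: (@geometric_lim (fun n => u n t 0 i) B) => k.
  by have := hB k t tb; apply: le_trans; have := coord_norm_le (u k.+1 t - u k t) i; rewrite !mxE.
have small (B e : R) : 0 < e -> exists n, B / 2 ^+ n < e.
  move=> e0; apply: contrapT => h; suff : e <= 0 by rewrite leNgt e0.
  apply: (@geometric_le0 e B) => n; rewrite leNgt; apply/negP => he; apply: h.
  by exists n.
have cw : continuous w.
  move=> t; apply/cvgrPdist_le => e e0.
  have [|B B0 hB] := uw (Num.max t0 (t + 1)); first by rewrite le_max lexx.
  have [|n hn] := small B (e / 3); first by rewrite divr_gt0.
  have sle : \forall s \near t, s < t + 1 by apply: near_lt; rewrite ltrDl.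
  near=> s.
  have sb : s <= Num.max t0 (t + 1).
    rewrite le_max; apply/orP; right; near: s.
    by apply: filterS sle => ? /ltW.
  have tb : t <= Num.max t0 (t + 1) by rewrite le_max lerDl ler01 orbT.
  have h1 := hB n s sb; have h2 := hB n t tb.
  have h3 : `|u n t - u n s| <= e / 3.
    by near: s; move/cvgrPdist_le : (cu n t); apply; rewrite divr_gt0.
  have := ler_distD (u n t) (w t) (w s); have := ler_distD (u n s) (u n t) (w s).
  rewrite (distrC (w t) (u n t)); lra.
have [ck kleft Dk] := hK w cw; exists (K w); split => //; first exact: kleft.
suff kw t : t0 < t -> K w t = w t by move=> t t0t; rewrite kw//; exact: Dk.
move=> t0t; have [B B0 hB] := uw t (ltW t0t).
apply/eqP; rewrite -subr_eq0 -normr_le0; apply: (@geometric_le0 _ (L * B * (t - t0) + B)) => n.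
(* [K w] and [u n.+1] start at the same point and their derivatives differ by at most L B / 2^n, so
   w is a fixed point of K beyond t0 and inherits the derivative of [K w]. *)
have h1 : `|K w t - u n.+1 t| <= L * (B / 2 ^+ n) * (t - t0).
  apply: (@picard_increment_le _ _ w (u n)
    (fun t => L * (B / 2 ^+ n) * (t - t0)) (fun=> L * (B / 2 ^+ n))) => //.
  - exact: ltW.
  - by rewrite kleft// u_left.
  - apply: continuous_subspaceT => s; apply: cvgM; first exact: cvg_cst.
    by apply: cvgB; [exact: cvg_id|exact: cvg_cst].
  - by rewrite subrr mulr0.
  - by move=> s _ _; apply: is_derive_eq; rewrite /GRing.scale/=; ring.
  - move=> s t0s st; rewrite ler_wpM2l ?(ltW L_gt0)// distrC.
    by apply: hB; exact: ltW.
  - rewrite !mulr_ge0 ?subr_ge0 ?invr_ge0 ?exprn_ge0// ltW//.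
have h2 := hB n.+1 t (lexx _).
have h3 : B / 2 ^+ n.+1 <= B / 2 ^+ n.
  by rewrite ler_wpM2l// lef_pV2 ?posrE ?exprn_gt0// ler_weXn2l// ler1n.
have := ler_distD (u n.+1 t) (K w t) (w t).
have -> : (L * B * (t - t0) + B) / 2 ^+ n = L * (B / 2 ^+ n) * (t - t0) + B / 2 ^+ n.
  by rewrite mulrDl; ring.
lra.
Unshelve. all: by end_near. Qed.

End picard_lindelof.

End picard.

Section ode.
Variable R : realType.

Definition ode_on m (F : 'rV[R]_m -> 'rV[R]_m) (x : R -> 'rV[R]_m) (a b : R) :=
  {within `[a, b], continuous x} /\
  forall t, a < t -> t < b -> is_derive t 1 x (F (x t)).

Lemma within_itvS (T : topologicalType) (x : R -> T) (a b a' b' : R) :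
  a <= a' -> b' <= b ->
  {within `[a, b], continuous x} -> {within `[a', b'], continuous x}.
Proof.
move=> aa bb; apply: continuous_subspaceW => t /=; rewrite !in_itv/= => /andP[h1 h2].
by rewrite (le_trans aa h1) (le_trans h2 bb).
Qed.

Lemma solution_ode_on m (F : 'rV[R]_m -> 'rV[R]_m) (x : R -> 'rV[R]_m) (B : \bar R) (a b : R) :
  solution F B x -> 0 <= a -> (b%:E < B)%E -> ode_on F x a b.
Proof.
move=> [cx dx] a0 bB; split.
  apply: continuous_subspaceW cx => t /=; rewrite in_itv/= => /andP[h1 h2].
  split; first exact: le_trans h1.
  by apply: le_lt_trans bB; rewrite lee_fin.
move=> t h1 h2; apply: dx; first exact: le_lt_trans h1.
by apply: lt_trans bB; rewrite lte_fin.
Qed.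

Lemma ode_on_solution m (F : 'rV[R]_m -> 'rV[R]_m) (x : R -> 'rV[R]_m) :
  (forall t, 0 <= t -> ode_on F x 0 t) -> solution F +oo%E x.
Proof.
move=> hx; split.
  apply/subspace_continuousP => t [t0 _].
  have [cx _] := hx (t + 1) (addr_ge0 t0 ler01).
  move/subspace_continuousP : cx => /(_ t).
  rewrite /= in_itv/= t0 lerDl ler01 => /(_ isT) ct A /ct; rewrite /= /within/= /nbhs/=.
  move=> nA; near=> u => -[u0 _].
  have : (fun u => (0 <= u <= t + 1) -> A (x u)) u.
    by near: u; exact: nA.
  apply; rewrite u0/= ltW//; near: u.
  by apply: near_lt; rewrite ltrDl.
move=> t t0 _; have [_] := hx (t + 1) (addr_ge0 (ltW t0) ler01).
by apply=> //; rewrite ltrDl.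
Unshelve. all: by end_near. Qed.

Lemma continuous_sq_sub m (x y : R -> 'rV[R]_m) (a b : R) :
  {within `[a, b], continuous x} -> {within `[a, b], continuous y} ->
  {within `[a, b], continuous (fun t => sq (x t - y t))}.
Proof.
move=> cx cy t; rewrite /sq /dot.
have cv i : (fun t => (x t - y t) 0 i) @ nbhs (t : subspace `[a, b]) --> (x t - y t) 0 i.
  apply: (@cvg_comp _ _ _ (fun t => x t - y t) (fun u : 'rV[R]_m => u 0 i)); last first.
    exact: coord_continuous.
  by apply: cvgB; [exact: cx|exact: cy].
apply: cvg_big => [|i _]; first exact: add_continuous.
by apply: cvgM; exact: cv.
Qed.

(** Gronwall for the squared distance. The constant depends on the radius only and not on the
    solutions, as limits of families of solutions require. *)
Lemma flow_close m (F : 'rV[R]_m -> 'rV[R]_m) (rho : R) : lip_bdd F ->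
  exists2 C : R, 0 < C & forall x y a b, a <= b -> ode_on F x a b -> ode_on F y a b ->
    (forall t, a < t -> t < b -> `|x t| <= rho) ->
    (forall t, a < t -> t < b -> `|y t| <= rho) ->
    sq (x b - y b) <= expR (C * (b - a)) * sq (x a - y a).
Proof.
move=> lF; have [L L0 hL] := lF rho.
have C0 : 0 < 1 + m%:R * L ^+ 2 by rewrite ltr_pwDl// mulr_ge0// sqr_ge0.
exists (1 + m%:R * L ^+ 2) => // x y a b ab [cx dx] [cy dy] bx by_.
have := @gronwall_grow R (fun t => sq (x t - y t)) a b (1 + m%:R * L ^+ 2) 0 ab C0 (lexx _).
rewrite mul0r addr0; apply; first exact: continuous_sq_sub.
move=> t at_ tb; exists (2 * dot (x t - y t) (F (x t) - F (y t))).
  by apply: (is_derive_sq (x := fun t => x t - y t)); apply: is_deriveB; [exact: dx|exact: dy].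
rewrite addr0; apply: (le_trans (dot_amgm1 _ _)); rewrite mulrDl mul1r lerD2l.
apply: (le_trans (sq_le_norm _)); rewrite -mulrA ler_wpM2l//.
apply: (@le_trans _ _ ((L * `|x t - y t|) ^+ 2)).
  by rewrite lerXn2r ?nnegrE ?mulr_ge0// hL ?bx ?by_.
by rewrite exprMn ler_wpM2l ?sqr_ge0// norm_sq_le.
Qed.

Lemma within_bounded m (x : R -> 'rV[R]_m) (a b : R) : {within `[a, b], continuous x} ->
  exists2 B : R, 0 < B & forall t, a <= t -> t <= b -> `|x t| <= B.
Proof.
move=> cx; have cpt := continuous_compact cx (@segment_compact _ _ _).
have [B B0 hB] := compact_norm_le cpt; exists B => // t at_ tb; apply: hB.
by exists t => //=; rewrite in_itv/= at_.
Qed.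

Lemma ode_unique m (F : 'rV[R]_m -> 'rV[R]_m) x y (a b : R) : lip_bdd F -> a <= b ->
  ode_on F x a b -> ode_on F y a b -> x a = y a -> x b = y b.
Proof.
move=> lF ab ox oy xy.
have [Bx _ hx] := within_bounded ox.1; have [By _ hy] := within_bounded oy.1.
have [C _ hC] := flow_close (Num.max Bx By) lF.
apply/eqP; rewrite -subr_eq0; apply/eqP/sq_eq0/le_anti; rewrite sq_ge0 andbT.
have := hC x y a b ab ox oy; rewrite xy subrr sq0 mulr0; apply=> t at_ tb.
  by rewrite le_max hx// ltW.
by rewrite le_max hy ?orbT// ltW.
Qed.

Lemma within_shift (T : topologicalType) (x : R -> T) (a b t0 : R) :
  {within `[a + t0, b + t0], continuous x} ->
  {within `[a, b], continuous (fun t => x (t + t0))}.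
Proof.
move=> /subspace_continuousP cx; apply/subspace_continuousP => t tI.
have tI' : `[a + t0, b + t0]%classic (t + t0).
  by move: tI; rewrite /= !in_itv/= !lerD2r.
apply: (@cvg_comp _ _ _ (fun t => t + t0) x _ (within `[a + t0, b + t0] (nbhs (t + t0)))).
  move=> B nB.
  have {}nB : \forall v \near t + t0, `[a + t0, b + t0]%classic v -> B v := nB.
  change (\forall u \near t, `[a, b]%classic u -> B (u + t0)).
  have ct : (fun t => t + t0) @ t --> t + t0.
    by apply: cvgD; [exact: cvg_id|exact: cvg_cst].
  apply: (@filterS _ (nbhs (t : R)) _ _ _ _ (ct _ nB)) => u hu uI; apply: hu.
  by move: uI; rewrite /= !in_itv/= !lerD2r.
exact: cx.
Qed.

Lemma is_derive_translate (V : normedModType R) (x : R -> V) (t t0 : R) dx :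
  is_derive (t + t0) 1 x dx -> is_derive t 1 (fun t => x (t + t0)) dx.
Proof.
move=> D; have dfx : differentiable x (t + t0) by apply/derivable1_diffP; case: D.
have Dsh : is_derive t 1 (fun t => t + t0) 1 by apply: is_derive_eq; rewrite addr0.
have := is_derive_chain (g := x) Dsh dfx.
by have [_ ->] := D.
Qed.

Lemma ode_on_shift m (F : 'rV[R]_m -> 'rV[R]_m) (x : R -> 'rV[R]_m) (a b t0 : R) :
  ode_on F x (a + t0) (b + t0) -> ode_on F (fun t => x (t + t0)) a b.
Proof.
move=> [cx dx]; split; first exact: within_shift.
by move=> t at_ tb; apply: is_derive_translate; apply: dx; rewrite ltrD2r.
Qed.

Lemma solution_shift m (F : 'rV[R]_m -> 'rV[R]_m) (x : R -> 'rV[R]_m) (t0 : R) :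
  0 <= t0 -> solution F +oo%E x -> solution F +oo%E (fun t => x (t + t0)).
Proof.
move=> t00 sx; apply: ode_on_solution => t t1; apply: ode_on_shift.
by apply: solution_ode_on sx _ (ltry _); rewrite add0r.
Qed.

End ode.

(** * Zero dynamics and steady state *)

Section triple.
Variables (R : realType) (n p : nat).

(** Linear isomorphism that turns a function of a triple into a function of a row vector, for which
    bounds on partial derivatives give Lipschitz constants. *)
Definition triple_of_row (u : 'rV[R]_(n + (1 + p))) : 'rV[R]_n * R * 'rV[R]_p :=
  (lsubmx u, lsubmx (rsubmx u) 0 0, rsubmx (rsubmx u)).

Definition row_of_triple (x : 'rV[R]_n * R * 'rV[R]_p) : 'rV[R]_(n + (1 + p)) :=
  row_mx x.1.1 (row_mx (\row__ x.1.2) x.2).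

Lemma row_of_tripleK : cancel row_of_triple triple_of_row.
Proof. by move=> [[z y] mu]; rewrite /triple_of_row !row_mxKr !row_mxKl mxE. Qed.

Lemma lip_bdd_row_of_triple : lip_bdd row_of_triple.
Proof.
apply: lip_bdd_row_mx.
  exact: (lip_bdd_comp (@lip_bdd_fst _ _ _) (@lip_bdd_fst _ _ _)).
apply: lip_bdd_row_mx; last exact: lip_bdd_snd.
apply: lip_bdd_rV => i.
rewrite (_ : (fun _ => _) = (fun x => x.1.2)); last by apply/funext => x; rewrite mxE.
exact: (lip_bdd_comp (@lip_bdd_snd _ _ _) (@lip_bdd_fst _ _ _)).
Qed.

Lemma C1_on_triple_of_row (V : normedModType R) (g : 'rV[R]_n * R * 'rV[R]_p -> V) :
  C1_on setT g -> C1_on setT (g \o triple_of_row).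
Proof.
move=> g1 u _.
have dtr v : differentiable triple_of_row v.
  have dr : differentiable (@rsubmx R 1 n (1 + p)) v by exact: differentiable_rsubmx.
  apply: differentiable_pair; last first.
    by apply: differentiable_comp => //; exact: differentiable_rsubmx.
  apply: differentiable_pair; first exact: differentiable_lsubmx.
  apply: (@differentiable_comp _ _ _ _ (fun v => lsubmx (rsubmx v)) (fun w : 'rV[R]_1 => w 0 0)).
    by apply: differentiable_comp => //; exact: differentiable_lsubmx.
  exact: differentiable_coord.
split.
  by apply: differentiable_comp => //; case: (g1 (triple_of_row u) I).
move=> v.
rewrite (_ : (fun a => 'D_v _ a) = (fun a => 'D_(triple_of_row v) g a) \o triple_of_row).
  apply: continuous_comp; first exact: differentiable_continuous.
  by case: (g1 (triple_of_row u) I) => _; apply.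
apply/funext => a; rewrite /derive/=; apply: (f_equal (fun G : R -> V => lim (G @ 0^'))).
apply/funext => h /=.
congr (_ *: (g _ - _)); rewrite /triple_of_row /=.
by rewrite !linearD !linearZ/= !mxE.
Qed.

Lemma lip_bdd_C1_triple_rV m (g : 'rV[R]_n * R * 'rV[R]_p -> 'rV[R]_m) :
  C1_on setT g -> lip_bdd g.
Proof.
move=> g1; have -> : g = (g \o triple_of_row) \o row_of_triple.
  by apply/funext => x /=; rewrite row_of_tripleK.
apply: lip_bdd_comp lip_bdd_row_of_triple; apply: lip_bdd_C1_rV.
exact: C1_on_triple_of_row.
Qed.

Lemma lip_bdd_C1_triple (g : 'rV[R]_n * R * 'rV[R]_p -> R) :
  C1_on setT g -> lip_bdd g.
Proof.
move=> g1; have -> : g = (g \o triple_of_row) \o row_of_triple.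
  by apply/funext => x /=; rewrite row_of_tripleK.
apply: lip_bdd_comp lip_bdd_row_of_triple; apply: lip_bdd_C1.
exact: C1_on_triple_of_row.
Qed.

End triple.

Section data.
Variables (R : realType) (p r n d : nat).
Variables (s : 'rV[R]_r -> 'rV[R]_r) (yr : 'rV[R]_r -> R).
Variables (f : 'rV[R]_n -> R -> 'rV[R]_p -> 'rV[R]_n) (q : 'rV[R]_n -> R -> 'rV[R]_p -> R).
Hypothesis smooth : smooth_data s yr f q d.+1.
Local Notation N := (p + (r + n))%N.
Local Notation F0 := (f0 s yr f).
Local Notation Q0 := (q0 s yr q).

(* The second component of [xe] stands for y - yr(w_d). *)
Definition perturbed_field (xe : 'rV[R]_N * R) : 'rV[R]_N :=
  row_mx 0 (row_mx (s (w_of xe.1))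
    (f (z_of xe.1) (yr (w_of xe.1) + xe.2) (mu_of xe.1))).

Definition feedforward (xe : 'rV[R]_N * R) : R :=
  'D_(s (w_of xe.1)) yr (w_of xe.1)
  - q (z_of xe.1) (yr (w_of xe.1) + xe.2) (mu_of xe.1).

Lemma perturbed_field0 x : perturbed_field (x, 0) = F0 x.
Proof. by rewrite /perturbed_field /f0 addr0. Qed.

Lemma feedforward0 x : feedforward (x, 0) = Q0 x.
Proof. by rewrite /feedforward /q0 addr0. Qed.

Lemma lip_s : lip_bdd s.
Proof. by case: smooth => h *; exact: lip_bdd_C1_rV. Qed.

Lemma lip_yr : lip_bdd yr.
Proof. by case: smooth => _ h *; exact: lip_bdd_C1. Qed.

Lemma differentiable_yr w : differentiable yr w.
Proof. by case: smooth => _ h *; case: (h w I). Qed.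

Lemma lip_tau_fun i : (i <= d)%N -> lip_bdd (tau_fun s yr f q i).
Proof. by case: smooth => _ _ _ _ /(_ i) h id; apply/lip_bdd_C1/h. Qed.

Lemma lip_mu : lip_bdd (@mu_of R p r n).
Proof. exact: lip_bdd_lsubmx. Qed.

Lemma lip_w : lip_bdd (@w_of R p r n).
Proof. exact: (lip_bdd_comp (@lip_bdd_lsubmx R r n) (@lip_bdd_rsubmx R p (r + n))). Qed.

Lemma lip_z : lip_bdd (@z_of R p r n).
Proof. exact: (lip_bdd_comp (@lip_bdd_rsubmx R r n) (@lip_bdd_rsubmx R p (r + n))). Qed.

Local Notation plant_args :=
  (fun xe : 'rV[R]_N * R => (z_of xe.1, yr (w_of xe.1) + xe.2, mu_of xe.1)).

Lemma lip_plant_args : lip_bdd plant_args.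
Proof.
have l1 := @lip_bdd_fst R 'rV[R]_N R.
apply: lip_bdd_pair; last exact: lip_bdd_comp lip_mu l1.
apply: lip_bdd_pair; first exact: lip_bdd_comp lip_z l1.
apply: lip_bddD; last exact: lip_bdd_snd.
exact: (lip_bdd_comp lip_yr (lip_bdd_comp lip_w l1)).
Qed.

Lemma lip_perturbed_field : lip_bdd perturbed_field.
Proof.
have l1 := @lip_bdd_fst R 'rV[R]_N R.
apply: lip_bdd_row_mx; first exact: lip_bdd_cst.
apply: lip_bdd_row_mx; first exact: (lip_bdd_comp lip_s (lip_bdd_comp lip_w l1)).
case: smooth => _ _ hf _ _.
exact: (lip_bdd_comp (lip_bdd_C1_triple_rV hf) lip_plant_args).
Qed.

Lemma lip_F0 : lip_bdd F0.
Proof.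
rewrite (_ : F0 = perturbed_field \o (fun x => (x, 0))).
  apply: (lip_bdd_comp lip_perturbed_field).
  by apply: lip_bdd_pair; [exact: lip_bdd_id|exact: lip_bdd_cst].
by apply/funext => x /=; rewrite perturbed_field0.
Qed.

Lemma lip_Q0 : lip_bdd Q0.
Proof. exact: (@lip_tau_fun 0). Qed.

(** The derivative of yr along s need not be Lipschitz when yr is merely C1. The regularity of tau_1
    = q0 is used instead: the function is q0 plus an increment of q. *)
Lemma lip_feedforward : lip_bdd feedforward.
Proof.
case: smooth => _ _ _ hq _.
pose qq := fun x : 'rV[R]_n * R * 'rV[R]_p => q x.1.1 x.1.2 x.2.
have lq := lip_bdd_C1_triple hq.
have l1 := @lip_bdd_fst R 'rV[R]_N R.
rewrite (_ : feedforward = fun xe => Q0 xe.1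
   + (qq (z_of xe.1, yr (w_of xe.1) + 0, mu_of xe.1) - qq (plant_args xe))).
  apply: lip_bddD; first exact: lip_bdd_comp lip_Q0 l1.
  apply: lip_bddB; last exact: (lip_bdd_comp lq lip_plant_args).
  have -> : (fun xe : 'rV[R]_N * R => qq (z_of xe.1, yr (w_of xe.1) + 0, mu_of xe.1)) =
      (qq \o plant_args) \o (fun xe => (xe.1, 0)) by [].
  apply: (lip_bdd_comp (lip_bdd_comp lq lip_plant_args)).
  by apply: lip_bdd_pair => //; exact: lip_bdd_cst.
by apply/funext => -[x e]; rewrite /feedforward /q0 /qq/= addr0; ring.
Qed.

Lemma lip_tau : lip_bdd (tau s yr f q d.+1).
Proof.
apply: lip_bdd_rV => i; rewrite (_ : (fun _ => _) = tau_fun s yr f q i).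
  by apply: lip_tau_fun; rewrite -ltnS.
by apply/funext => x; rewrite mxE.
Qed.

Lemma is_derive_tau_fun (x : R -> 'rV[R]_N) (t : R) i : (i <= d)%N ->
  is_derive t 1 x (F0 (x t)) ->
  is_derive t 1 (fun t => tau_fun s yr f q i (x t)) (tau_fun s yr f q i.+1 (x t)).
Proof.
move=> id Dx; apply: (is_derive_chain (g := tau_fun s yr f q i) Dx).
by case: smooth => _ _ _ _ /(_ i id) h; case: (h (x t) I).
Qed.

Lemma derive1n_tau (x : R -> 'rV[R]_N) : solution F0 +oo%E x ->
  forall i, (i <= d.+1)%N -> forall t, 0 < t ->
  derive1n i (fun t => Q0 (x t)) t = tau_fun s yr f q i (x t).
Proof.
move=> [_ dx]; elim => [//|i IH] id t t0.
rewrite derive1nS derive1E.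
have Dt := is_derive_tau_fun id (dx t t0 (ltry _)).
have [_ <-] := Dt; apply: near_eq_derive; rewrite ?oner_neq0//.
near=> u; apply: IH; first exact: ltnW.
by near: u; exact: lt_nbhsr.
Unshelve. all: by end_near. Qed.

End data.

Section omega.
Variables (R : realType) (m : nat) (F : 'rV[R]_m -> 'rV[R]_m).
Variables (X K : set 'rV[R]_m).
Hypothesis lF : lip_bdd F.
Hypothesis cK : compact K.
Hypothesis flow_K : forall x0, X x0 -> exists x,
  [/\ solution F +oo%E x, x 0 = x0 & forall t, 0 <= t -> K (x t)].

Lemma solution_unique x y (t : R) : 0 <= t ->
  solution F +oo%E x -> solution F +oo%E y -> x 0 = y 0 -> x t = y t.
Proof.
move=> t0 sx sy xy; apply: (ode_unique lF t0) xy.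
  exact: solution_ode_on sx (lexx _) (ltry _).
exact: solution_ode_on sy (lexx _) (ltry _).
Qed.

Lemma solution_in_K x (t : R) : solution F +oo%E x -> X (x 0) -> 0 <= t -> K (x t).
Proof.
move=> sx X0 t0; have [y [sy y0 hy]] := flow_K X0.
by rewrite (solution_unique t0 sx sy)//; exact: hy.
Qed.

Lemma omega_sub_K : omega_limit F X `<=` K.
Proof.
move=> l [t_ [x_ [tinf hx xl]]].
have clK : closed K by apply: compact_closed => //; exact: norm_hausdorff.
suff near_K : \forall i \near \oo, K (x_ i (t_ i)) by exact: closed_cvg clK near_K _ xl.
have := tinf; move/cvgryPge => /(_ 0); apply: filterS => i ti.
by have [sx X0] := hx i; exact: solution_in_K.
Qed.

Lemma sq_cvg_norm (u : nat -> 'rV[R]_m) (l : 'rV[R]_m) (v : nat -> 'rV[R]_m) (a : 'rV[R]_m) (C : R) :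
  0 <= C -> v @ \oo --> a ->
  (\forall i \near \oo, sq (u i - l) <= C * sq (v i - a)) -> u @ \oo --> l.
Proof.
move=> C0 va ule; apply/cvgrPdist_le => e e0.
have D0 : 0 < 1 + C * m%:R by rewrite ltr_pwDl// mulr_ge0.
have d0 : 0 < e / (1 + C * m%:R) by rewrite divr_gt0.
move/cvgrPdist_le : va => /(_ _ d0) va; near=> i.
have h1 : `|a - v i| <= e / (1 + C * m%:R) by near: i.
have h2 : sq (u i - l) <= C * sq (v i - a) by near: i.
rewrite distrC -ler_sqr ?nnegrE// ?(ltW e0)//.
apply: (le_trans (norm_sq_le _)); apply: (le_trans h2).
apply: (@le_trans _ _ (C * (m%:R * (e / (1 + C * m%:R)) ^+ 2))).
  rewrite ler_wpM2l// (le_trans (sq_le_norm _))// ler_wpM2l//.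
  by rewrite lerXn2r ?nnegrE ?(ltW d0)// distrC.
rewrite mulrA exprMn mulrCA ler_piMr ?sqr_ge0//.
rewrite exprVn ler_pdivrMr ?exprn_gt0// mul1r.
have : 0 <= C * m%:R by rewrite mulr_ge0.
nra.
Unshelve. all: by end_near. Qed.

(** A limit of x_i(t_i) is carried in time t to the limit of x_i(t_i + t), by [flow_close]. The
    inclusion in X supplies a solution through the limit point. *)
Lemma omega_invariant : omega_limit F X `<=` X -> forall a, omega_limit F X a ->
  exists x, [/\ solution F +oo%E x, x 0 = a & forall t, 0 <= t -> omega_limit F X (x t)].
Proof.
move=> AX a Aa; have [x [sx x0 hx]] := flow_K (AX a Aa).
exists x; split => // t t0; have [t_ [x_ [tinf hx_ xa]]] := Aa.
exists (fun i => t_ i + t), x_; split => //.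
  apply/cvgryPge => A; have := tinf; move/cvgryPge => /(_ A); apply: filterS => i.
  by move=> h; apply: (le_trans h); rewrite lerDl.
have [B _ hB] := compact_norm_le cK.
have [C C0 hC] := flow_close B lF.
apply: (sq_cvg_norm (ltW (expR_gt0 (C * t))) xa).
have := tinf; move/cvgryPge => /(_ 0); apply: filterS => i ti.
have [si Xi] := hx_ i.
have := hC (fun u => x_ i (u + t_ i)) x 0 t t0.
rewrite subr0 add0r x0 (addrC t); apply.
- apply: solution_ode_on (lexx _) (ltry _); exact: solution_shift.
- exact: solution_ode_on sx (lexx _) (ltry _).
- by move=> u u0 _; apply: hB; apply: solution_in_K => //; rewrite addr_ge0// ltW.
- by move=> u u0 _; apply: hB; apply: hx; exact: ltW.
Qed.

(** By compactness: if no time served all of X, then for every i some solution x_i would be far from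
    the omega-limit set at time i, yet a cluster point of x_i(i) belongs to that set. *)
Lemma omega_attracts (c : R) : 0 < c -> exists2 t1 : R, 0 <= t1 &
  forall x, solution F +oo%E x -> X (x 0) ->
  exists2 l, omega_limit F X l & sq (x t1 - l) < c.
Proof.
move=> c0; apply: contrapT => hno.
have bad (i : nat) : exists x : R -> 'rV[R]_m, [/\ solution F +oo%E x, X (x 0) &
    forall l, omega_limit F X l -> c <= sq (x i%:R - l)].
  apply: contrapT => hi; apply: hno; exists i%:R => // x sx Xx.
  apply: contrapT => hl; apply: hi; exists x; split => // l Al.
  by rewrite leNgt; apply/negP => lt_c; apply: hl; exists l.
have [x hx] := choice bad.
pose y i := x i i%:R.
have yK i : K (y i) by have [sx Xx _] := hx i; apply: solution_in_K.
have [l [Kl cl]] : (K `&` cluster (y @ \oo)) !=set0.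
  by apply: cK; exists 0%N => // i _; exact: yK.
(* Indices i_k >= k, so that the times along the subsequence still tend to infinity. *)
have sub (k : nat) : exists i : nat, (k <= i)%N /\ `|l - y i| < k.+1%:R^-1.
  have [||z [[i ki <-] hz]] := cl (y @` [set i | (k <= i)%N]) (ball l k.+1%:R^-1).
  - exists k => // i /= ki; exists i => //.
  - by apply: nbhsx_ballx; rewrite invr_gt0.
  by exists i; split => //; move: hz; rewrite -ball_normE.
have [i_ hi] := choice sub.
have yl : (fun k => y (i_ k)) @ \oo --> l.
  apply/cvgrPdist_lt => e e0; near=> k.
  have [_ /lt_le_trans] := hi k; apply.
  by apply: ltW; near: k; exact: near_infty_natSinv_lt (PosNum e0).
have Al : omega_limit F X l.
  exists (fun k => (i_ k)%:R), (fun k => x (i_ k)); split => //.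
    apply/cvgryPge => A; near=> k.
    have [ki _] := hi k; apply: (@le_trans _ _ k%:R); last by rewrite ler_nat.
    by near: k; exact: nbhs_infty_ger.
  by move=> k; have [sx Xx _] := hx (i_ k).
have : \forall k \near \oo, sq (y (i_ k) - l) < c.
  have d0 : 0 < Num.min 1 (c / (1 + m%:R)) by rewrite lt_min ltr01 divr_gt0// ltr_pwDl.
  move/cvgrPdist_lt : yl => /(_ _ d0); apply: filterS => k.
  rewrite lt_min => /andP[h1 h2]; apply: (le_lt_trans (sq_le_norm _)); rewrite distrC.
  have m1 : 0 < 1 + (m%:R : R) by rewrite ltr_pwDl.
  move: h2; rewrite ltr_pdivlMr// => h2; apply: le_lt_trans h2.
  rewrite expr2 mulrC -mulrA ler_wpM2l//.
  apply: (@le_trans _ _ (1 * m%:R)); first by rewrite ler_wpM2r// ltW.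
  by rewrite mul1r lerDr.
case=> k _ /(_ k (leqnn k)) /=; rewrite ltNge => /negP; apply.
by have [_ _] := hx (i_ k); apply.
Unshelve. all: by end_near. Qed.

End omega.

Lemma edist_le (R : realType) m (A : set 'rV[R]_m) x a : A a -> edist A x <= enorm (x - a).
Proof.
move=> Aa; apply: ge_inf; last by exists a.
by exists 0 => _ [b _ <-]; exact: enorm_ge0.
Qed.

(** The point [a] witnesses that A is nonempty; the infimum over the empty set would be 0. *)
Lemma edist_lt (R : realType) m (A : set 'rV[R]_m) x a (c : R) :
  A a -> edist A x < c -> exists2 b, A b & enorm (x - b) < c.
Proof.
move=> Aa /inf_lt[|_ [b Ab <-] bc]; last by exists b.
by exists (enorm (x - a)); exists a.
Qed.

Section steady_state.
Variables (R : realType) (p r n d : nat).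
Variables (s : 'rV[R]_r -> 'rV[R]_r) (yr : 'rV[R]_r -> R).
Variables (f : 'rV[R]_n -> R -> 'rV[R]_p -> 'rV[R]_n) (q : 'rV[R]_n -> R -> 'rV[R]_p -> R).
Hypothesis smooth : smooth_data s yr f q d.+1.
Variables (P : set 'rV[R]_p) (W : set 'rV[R]_r) (Z : set 'rV[R]_n).
Hypothesis Hss : steady_state_assumption s yr f P W Z.
Local Notation N := (p + (r + n))%N.
Local Notation F0 := (f0 s yr f).
Local Notation A0 := (steady_state_set s yr f P W Z).
Local Notation tau := (tau s yr f q d.+1).
Local Notation space := (prod_set P W [set: 'rV[R]_n]).
Local Notation start := (prod_set P W Z).

Lemma steady_state_start : A0 `<=` start.
Proof.
case: Hss => _ [A0s _] [d1 d10 [hd1 _]] a Aa; apply: hd1; first exact: A0s.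
by apply: (le_trans (edist_le _ Aa)); rewrite subrr /enorm big1 ?sqrtr0 ?ltW// => i _;
  rewrite mxE expr0n.
Qed.

Lemma zero_dynamics_bounded : exists2 B : R, 0 < B &
  (forall x0, start x0 -> exists x, [/\ solution F0 +oo%E x, x 0 = x0 &
     forall t, 0 <= t -> `|x t| <= B]) /\
  forall a, A0 a -> `|a| <= B /\
    exists x, [/\ solution F0 +oo%E x, x 0 = a & forall t, 0 <= t -> A0 (x t)].
Proof.
case: Hss => -[K [cK _ hK]] _ _; have [B B0 hB] := compact_norm_le cK.
have lF := lip_F0 smooth; exists B => //; split.
  move=> x0 /hK[x [sx x00 hx]]; exists x; split => // t t0.
  by apply: hB; exact: hx.
move=> a Aa; split; first by apply/hB/(omega_sub_K lF cK hK).
exact: (omega_invariant lF cK hK steady_state_start).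
Qed.

Lemma zero_dynamics_attracts (c : R) : 0 < c -> exists2 t1 : R, 0 <= t1 &
  forall x, solution F0 +oo%E x -> start (x 0) -> exists2 l, A0 l & sq (x t1 - l) < c.
Proof.
case: Hss => -[K [cK _ hK]] _ _; exact: (omega_attracts (lip_F0 smooth) cK hK).
Qed.

Lemma zero_dynamics_exp : exists (C q1 rho : R), [/\ 1 <= C, 0 < q1, q1 < 1, 0 < rho &
  (forall x a, space x -> A0 a -> sq (x - a) <= rho -> start x) /\
  forall x a c, solution F0 +oo%E x -> space (x 0) -> A0 a ->
    0 < c -> c <= rho -> sq (x 0 - a) <= c ->
    forall i : nat, exists2 b, A0 b & sq (x i%:R - b) <= C * q1 ^+ i * c].
Proof.
case: Hss => _ _ [d1 d10 [hd1 [m [a [d2 [m1 a0 d20 d21 hexp]]]]]].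
have m0 : 0 < m by apply: lt_le_trans m1.
(* All data are squared: rate 2 a and radius d2^2. The constant is (2 m)^2 because the infimum
   defining the distance is not known to be attained; the factor 2 makes the bound strict, so that a
   point of A0 realizes it. *)
exists (4 * m ^+ 2), (expR (- (2 * a))), (d2 ^+ 2); split.
- by rewrite -[leLHS]mulr1 ler_pM ?ler1n// exprn_ege1.
- exact: expR_gt0.
- by rewrite expR_lt1 oppr_lt0 mulr_gt0.
- by rewrite exprn_gt0.
have en_le (x l : 'rV[R]_N) c : 0 <= c -> sq (x - l) <= c -> enorm (x - l) <= Num.sqrt c.
  move=> c0; rewrite -enorm_sq => h; rewrite -(ger0_norm (enorm_ge0 _)) -sqrtr_sqr.
  by rewrite ler_wsqrtr.
split.
  move=> x l sx Al h; apply: hd1 => //; apply: (le_trans (edist_le _ Al)).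
  apply: (le_trans (en_le _ _ _ _ h)); first by rewrite sqr_ge0.
  by rewrite sqrtr_sqr (ger0_norm (ltW d20)).
move=> x l c sx spx Al c0 crho h i.
have dc : edist A0 (x 0) <= Num.sqrt c.
  by apply: (le_trans (edist_le _ Al)); exact: en_le (ltW c0) h.
have c20 : 0 < Num.sqrt c by rewrite sqrtr_gt0.
have dd2 : edist A0 (x 0) <= d2.
  apply: (le_trans dc); rewrite -(ger0_norm (ltW d20)) -sqrtr_sqr.
  by rewrite ler_wsqrtr.
have := hexp x sx spx dd2 i%:R (ler0n _ _).
set e := expR _ => le1.
have e0 : 0 < e by exact: expR_gt0.
have [|b Ab hb] := @edist_lt R N A0 (x i%:R) l (2 * m * e * Num.sqrt c) Al.
  apply: (le_lt_trans le1); apply: (@le_lt_trans _ _ (m * e * Num.sqrt c)).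
    by rewrite ler_wpM2l// mulr_ge0// ltW.
  by rewrite -!mulrA ltr_pMl ?ltr1n// !mulr_gt0.
exists b => //; rewrite -enorm_sq.
have -> : 4 * m ^+ 2 * expR (- (2 * a)) ^+ i * c = (2 * m * e * Num.sqrt c) ^+ 2.
  rewrite !exprMn (sqr_sqrtr (ltW c0)) /e -!expRM_natl.
  have -> : i%:R * - (2 * a) = 2 * - (a * i%:R) by ring.
  by rewrite -natrX.
by rewrite lerXn2r ?nnegrE ?enorm_ge0// ?(ltW hb)// !mulr_ge0// ltW.
Qed.

Variables (phi phic : 'rV[R]_d.+1 -> R).
Hypothesis Himm : immersion_assumption s yr f q P W Z phi.
Hypothesis phic_phi : forall x, A0 x -> phic (tau x) = phi (tau x).

(** All rows but the last hold because tau_(i+1) is the derivative of tau_i along the flow. The last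
    row is the equation of (A3), in which phi and phic agree on the image of A0. *)
Lemma is_derive_tau (x : R -> 'rV[R]_N) (t : R) : solution F0 +oo%E x ->
  (forall t, 0 <= t -> A0 (x t)) -> 0 < t ->
  is_derive t 1 (fun t => tau (x t)) (Phi phic (tau (x t))).
Proof.
move=> sx hx t0; have [_ dx] := sx.
have [_ ode] := Himm sx (hx 0 (lexx _)) t0.
have Phi_tau (i : 'I_d.+1) : Phi phic (tau (x t)) 0 i = tau_fun s yr f q i.+1 (x t).
  rewrite mxE; case: insubP => [j _ jE|]; first by rewrite mxE jE.
  rewrite -leqNgt ltnS => di; have iE : i = d :> nat.
    by apply/eqP; rewrite eqn_leq di -ltnS ltn_ord.
  rewrite phic_phi; last exact/hx/ltW.
  move/eqP : ode; rewrite (derive1n_tau smooth sx (leqnn _) t0) addr_eq0 iE => /eqP ->.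
  congr (- phi _); apply/rowP => j; rewrite !mxE.
  by rewrite (derive1n_tau smooth sx _ t0)// ltnW// ltnS ltn_ord.
apply: is_derive_mx => k j; rewrite (ord1 k) Phi_tau.
rewrite (_ : (fun _ => _) = (fun t => tau_fun s yr f q j (x t))); last first.
  by apply/funext => u; rewrite mxE.
apply: (is_derive_tau_fun smooth); first by rewrite -ltnS.
by apply: dx => //; exact: ltry.
Qed.

End steady_state.

Section continuity.
Variable R : realType.

(** Freezing the solution for negative times gives the observer an input that is continuous on the
    whole line, as [picard_lindelof] requires. *)
Lemma solution_continuous_max m (F : 'rV[R]_m -> 'rV[R]_m) (x : R -> 'rV[R]_m) :
  solution F +oo%E x -> continuous (fun t : R => x (Num.max 0 t)).
Proof.
move=> [/subspace_continuousP cx _] t.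
have ht : horizon +oo%E (Num.max 0 t) by split; [rewrite le_max lexx|exact: ltry].
apply: (@cvg_comp _ _ _ (fun t => Num.max 0 t) x _ (within (horizon +oo%E) (nbhs (Num.max 0 t)))).
  move=> B nB.
  have {}nB : \forall v \near Num.max 0 t, horizon +oo%E v -> B v := nB.
  change (\forall u \near t, B (Num.max 0 u)).
  have ct : {for (t : R), continuous (fun t : R => Num.max 0 t)}.
    by apply: continuous_max2 => // u; [exact: cvg_cst|exact: cvg_id].
  apply: (@filterS _ (nbhs (t : R)) _ _ _ _ (ct _ nB)) => u; apply.
  by split; [rewrite le_max lexx|exact: ltry].
exact: cx.
Qed.

Lemma within_comp (T U : topologicalType) (g : T -> U) (x : R -> T) (a b : R) :
  {within `[a, b], continuous x} -> continuous g ->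
  {within `[a, b], continuous (fun t => g (x t))}.
Proof. by move=> cx cg t; apply: continuous_comp; [exact: cx|exact: cg]. Qed.

Lemma continuous_mulmxr m k (E : 'M[R]_(m, k)) :
  continuous (fun v : 'rV[R]_m => v *m E).
Proof.
apply: lip_bdd_continuous => rho; have [C C0 hC] := sq_mulmx E.
exists (C * m%:R + 1) => [|x y _ _]; first by rewrite addr_ge0// mulr_ge0// ltW.
rewrite -mulmxBl -ler_sqr ?nnegrE ?mulr_ge0 ?addr_ge0 ?mulr_ge0// ?(ltW C0)//.
apply: (le_trans (norm_sq_le _)); apply: (le_trans (hC _)).
apply: (@le_trans _ _ (C * (m%:R * `|x - y| ^+ 2))).
  by rewrite ler_wpM2l ?(ltW C0)// sq_le_norm.
rewrite mulrA exprMn ler_wpM2r ?sqr_ge0//.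
have : 0 <= C * m%:R by rewrite mulr_ge0// ltW.
nra.
Qed.

End continuity.

(** * Observer driven by an input *)

Section observer_dynamics.
Variables (R : realType) (d : nat) (c : 'I_d.+1 -> R) (phic : 'rV[R]_d.+1 -> R).
Variables (L kappa : R).
Hypothesis L_gt0 : 0 < L.
Hypothesis phicL : forall x y, `|phic x - phic y| <= L * `|x - y|.
Local Notation OF := (observer_field c phic kappa).
Local Notation G := (gainG c kappa).

Lemma observer_field_lipschitz : exists2 K : R, 0 < K &
  forall x y, `|OF x - OF y| <= K * `|x - y|.
Proof.
have K0 : 0 < 1 + L + `|G| by rewrite -addrA ltr_pwDl// addr_ge0// ltW.
exists (1 + L + `|G|) => // x y; apply: norm_le_coord => [|i].
  by rewrite mulr_ge0// ltW.
have Phi_le : `|(Phi phic x - Phi phic y) 0 i| <= (1 + L) * `|x - y|.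
  rewrite !mxE; case: insubP => [j _ _|_].
    apply: (@le_trans _ _ `|x - y|).
      by have := coord_norm_le (x - y) j; rewrite !mxE.
    by rewrite ler_peMl// lerDl ltW.
  rewrite -opprD normrN (le_trans (phicL _ _))// ler_wpM2r//.
  by rewrite lerDr.
have -> : (OF x - OF y) 0 i = (Phi phic x - Phi phic y) 0 i - (x - y) 0 0 * G 0 i.
  by rewrite /observer_field !mxE; ring.
rewrite [(1 + L + _) * _]mulrDl (le_trans (ler_normB _ _))// lerD//.
by rewrite normrM mulrC ler_pM//; exact: coord_norm_le.
Qed.

Lemma observer_exists (g : R -> R) (eta0 : 'rV[R]_d.+1) : continuous g ->
  exists eta : R -> 'rV[R]_d.+1, [/\ continuous eta, eta 0 = eta0 &
    forall t : R, 0 < t -> is_derive t 1 eta (OF (eta t) + g t *: G)].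
Proof.
move=> cg; have [K K0 hK] := observer_field_lipschitz.
have cOF : continuous OF by apply: lip_bdd_continuous; exact: lip_bdd_lin (ltW K0) hK.
apply: (@picard_lindelof R d.+1 (fun t eta => OF eta + g t *: G) K 0 eta0) => //.
- move=> x cx t; apply: cvgD; first exact: (continuous_comp (cx t) (cOF _)).
  by apply: cvgZ; [exact: cg|exact: cvg_cst].
- by move=> t x y; rewrite opprD addrACA subrr addr0.
Qed.

Variables (e : nat) (E : 'M[R]_(d.+1, e)).
Hypothesis contraction : forall x y,
  dot ((x - y) *m E) ((OF x - OF y) *m E) <= - sq ((x - y) *m E).

(** Contraction gives - 2 V for the squared gap V. Half of it absorbs the cross term with the
    forcing mismatch, so V decays at rate 1 up to the squared mismatch. *)
Lemma observer_compare (eta1 eta2 : R -> 'rV[R]_d.+1) (g1 g2 : R -> 'rV[R]_d.+1)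
    (a b delta : R) : a <= b -> 0 <= delta ->
  {within `[a, b], continuous eta1} -> {within `[a, b], continuous eta2} ->
  (forall t, a < t -> t < b -> is_derive t 1 eta1 (OF (eta1 t) + g1 t)) ->
  (forall t, a < t -> t < b -> is_derive t 1 eta2 (OF (eta2 t) + g2 t)) ->
  (forall t, a < t -> t < b -> sq ((g1 t - g2 t) *m E) <= delta) ->
  sq ((eta1 b - eta2 b) *m E) <= expR (- (b - a)) * sq ((eta1 a - eta2 a) *m E) + delta.
Proof.
move=> ab d0 c1 c2 D1 D2 hg.
have cE (u : R -> 'rV[R]_d.+1) : {within `[a, b], continuous u} ->
    {within `[a, b], continuous (fun t => u t *m E)}.
  move=> cu; apply: (@within_comp _ _ _ (fun v : 'rV[R]_d.+1 => v *m E)) => //.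
  exact: continuous_mulmxr.
have := @gronwall_decay R (fun t => sq (eta1 t *m E - eta2 t *m E)) a b 1 delta ab ltr01 d0.
rewrite divr1 mulN1r !mulmxBl; apply; first by apply: continuous_sq_sub; exact: cE.
move=> t at_ tb.
exists (2 * dot (eta1 t *m E - eta2 t *m E)
  ((OF (eta1 t) + g1 t) *m E - (OF (eta2 t) + g2 t) *m E)).
  apply: (is_derive_sq (x := fun t => eta1 t *m E - eta2 t *m E)).
  by apply: is_deriveB; apply: is_derive_mulmx; [exact: D1|exact: D2].
rewrite (_ : (OF (eta1 t) + g1 t) *m E - (OF (eta2 t) + g2 t) *m E =
  (OF (eta1 t) - OF (eta2 t)) *m E + (g1 t - g2 t) *m E); last first.
  by rewrite -mulmxBl -mulmxDl opprD addrACA.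
rewrite -mulmxBl dotDr.
have := contraction (eta1 t) (eta2 t); have := hg t at_ tb.
have := dot_amgm1 ((eta1 t - eta2 t) *m E) ((g1 t - g2 t) *m E).
lra.
Qed.

End observer_dynamics.

Section extended_zero_dynamics.
Variables (R : realType) (p r n d : nat).
Variables (s : 'rV[R]_r -> 'rV[R]_r) (yr : 'rV[R]_r -> R).
Variables (f : 'rV[R]_n -> R -> 'rV[R]_p -> 'rV[R]_n) (q : 'rV[R]_n -> R -> 'rV[R]_p -> R).
Hypothesis smooth : smooth_data s yr f q d.+1.
Variables (P : set 'rV[R]_p) (W : set 'rV[R]_r) (Z : set 'rV[R]_n).
Hypothesis Hss : steady_state_assumption s yr f P W Z.
Variables (phi phic : 'rV[R]_d.+1 -> R).
Hypothesis Himm : immersion_assumption s yr f q P W Z phi.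
Local Notation N := (p + (r + n))%N.
Local Notation F0 := (f0 s yr f).
Local Notation Q0 := (q0 s yr q).
Local Notation A0 := (steady_state_set s yr f P W Z).
Local Notation tau := (tau s yr f q d.+1).
Local Notation space := (prod_set P W [set: 'rV[R]_n]).
Local Notation start := (prod_set P W Z).
Hypothesis phic_phi : forall x, A0 x -> phic (tau x) = phi (tau x).
Variables (c : 'I_d.+1 -> R) (L kappa : R).
Hypothesis L_gt0 : 0 < L.
Hypothesis phicL : forall x y, `|phic x - phic y| <= L * `|x - y|.
Variables (e : nat) (E : 'M[R]_(d.+1, e)).
Local Notation OF := (observer_field c phic kappa).
Local Notation G := (gainG c kappa).
Hypothesis contraction : forall x y,
  dot ((x - y) *m E) ((OF x - OF y) *m E) <= - sq ((x - y) *m E).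

Definition zero_dynamics (x : R -> 'rV[R]_N) (eta : R -> 'rV[R]_d.+1) :=
  [/\ solution F0 +oo%E x, continuous eta &
      forall t : R, 0 < t -> is_derive t 1 eta (OF (eta t) + Q0 (x t) *: G)].

Lemma zero_dynamics_exists x0 eta0 : start x0 -> exists x eta,
  [/\ zero_dynamics x eta, x 0 = x0 & eta 0 = eta0].
Proof.
move=> sx0; have [B _ [hB _]] := zero_dynamics_bounded smooth Hss.
have [x [sx x00 _]] := hB x0 sx0.
have cQ : continuous (fun t : R => Q0 (x (Num.max 0 t))).
  move=> t; apply: (@continuous_comp _ _ _ (fun t : R => x (Num.max 0 t)) Q0).
    exact: (solution_continuous_max sx).
  exact: (lip_bdd_continuous (lip_Q0 smooth)).
have [eta [ceta eta00 Deta]] := observer_exists c kappa L_gt0 phicL eta0 cQ.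
exists x, eta; split => //; split => // t t0.
by have := Deta t t0; rewrite max_r ?ltW.
Qed.

Lemma tau_observer (x : R -> 'rV[R]_N) (t : R) : solution F0 +oo%E x ->
  (forall t, 0 <= t -> A0 (x t)) -> 0 < t ->
  is_derive t 1 (fun t => tau (x t)) (OF (tau (x t)) + Q0 (x t) *: G).
Proof.
move=> sx hx t0; have := is_derive_tau smooth Himm phic_phi sx hx t0.
by rewrite /observer_field [tau (x t) 0 0]mxE/= subrK.
Qed.

(* Compares with a motion a(t) on A0 over unit time intervals, restarting
   from a point of A0 near x at each integer time. *)
Lemma zero_dynamics_local : exists (C q1 rho : R),
  [/\ 0 < C, 0 < q1, q1 < 1, 0 < rho &
  forall x eta a c1 c2, zero_dynamics x eta -> space (x 0) -> A0 a ->
    0 < c1 -> c1 <= rho -> sq (x 0 - a) <= c1 -> sq ((eta 0 - tau a) *m E) <= c2 ->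
    forall (i : nat) t, i%:R <= t -> t <= i%:R + 1 ->
    exists b, [/\ A0 b, sq (x t - b) <= C * q1 ^+ i * c1 &
      sq ((eta t - tau b) *m E) <= C * q1 ^+ i * (c1 + c2)]].
Proof.
have [C0 [q0 [rho [C01 q00 q01 rho0 [near_start hexp]]]]] := zero_dynamics_exp Hss.
have [B B0 [hstart hA]] := zero_dynamics_bounded smooth Hss.
have C00 : 0 < C0 by exact: lt_le_trans C01.
have lF := lip_F0 smooth.
have [Cf Cf0 hCf] := flow_close B lF.
pose Ef := expR Cf.
have Ef0 : 0 < Ef by exact: expR_gt0.
have [LQ LQ0 hLQ] := lip_Q0 smooth B.
have [Lt Lt0 hLt] := lip_tau smooth B.
have [KE KE0 hKE] := sq_mulmx E.
pose M1 := LQ ^+ 2 * sq (G *m E) * Ef.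
have M10 : 0 <= M1.
  by apply: mulr_ge0; [apply: mulr_ge0; [exact: sqr_ge0|exact: sq_ge0]|exact: ltW].
pose M2 := KE * (d.+1%:R * Lt ^+ 2) * (2 * Ef + 2).
have M20 : 0 <= M2.
  by rewrite !mulr_ge0 ?addr_ge0 ?mulr_ge0 ?sqr_ge0// ltW.
(* A unit step turns the squared gap V of eta into at most 5/4 (V / 2 + M1 ri) + 5 M2 ri = 5/8 V +
   M3 ri. With M4 = 4 M3 C0 the last term is at most a quarter of the M4 c1 part of the bound, and
   5/8 + 1/4 is the 7/8 in [q1]. *)
pose M3 := 5 / 4 * M1 + 5 * M2.
have M30 : 0 <= M3 by rewrite addr_ge0// mulr_ge0.
pose M4 := 4 * (M3 * C0).
have M40 : 0 <= M4 by rewrite mulr_ge0// mulr_ge0// ltW.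
pose q1 := Num.max q0 (7 / 8).
have q0q1 : q0 <= q1 by rewrite le_max lexx.
have q78 : 7 / 8 <= q1 by rewrite le_max lexx orbT.
have q10 : 0 < q1 by apply: lt_le_trans q0q1.
exists (1 + M4 + M1 * C0 + Ef * C0), q1, rho; split => //.
- have : 0 < Ef * C0 by exact: mulr_gt0.
  have : 0 <= M1 * C0 by rewrite mulr_ge0// ltW.
  by move: M40; lra.
- by rewrite gt_max q01/=; lra.
move=> x eta a c1 c2 [sx ceta Deta] spx Aa c10 c1rho xa etaa.
have c20 : 0 <= c2 by apply: le_trans etaa; exact: sq_ge0.
have startx : start (x 0) by apply: near_start Aa _ => //; exact: le_trans c1rho.
have xB t : 0 <= t -> `|x t| <= B.
  move=> t0; have [y [sy y0 yB]] := hstart _ startx.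
  by rewrite (solution_unique lF t0 sx sy (esym y0)) yB.
pose ri i := C0 * q0 ^+ i * c1.
have ri0 i : 0 <= ri i by rewrite !mulr_ge0 ?exprn_ge0// ltW.
(* The motion y through b remains on A0, so tau along y solves the observer equation; the forcing
   mismatch between eta and it is controlled by the distance from x to y. *)
have window i b : A0 b -> sq (x i%:R - b) <= ri i -> exists y : R -> 'rV[R]_N,
    [/\ y 0 = b, forall u, 0 <= u -> A0 (y u),
      forall u, 0 <= u -> u <= 1 -> sq (x (u + i%:R) - y u) <= Ef * ri i &
      forall u, 0 <= u -> u <= 1 -> sq ((eta (u + i%:R) - tau (y u)) *m E)
         <= expR (- u) * sq ((eta i%:R - tau b) *m E) + M1 * ri i].
  move=> Ab xb; have [_ [y [sy y0 Ay]]] := hA b Ab; exists y.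
  have sxi := solution_shift (ler0n R i) sx.
  have xy u : 0 <= u -> u <= 1 -> sq (x (u + i%:R) - y u) <= Ef * ri i.
    move=> u0 u1; have := hCf (fun u => x (u + i%:R)) y 0 u u0.
    rewrite add0r y0 subr0 => le1; apply: (le_trans (le1 _ _ _ _)).
    - exact: solution_ode_on sxi (lexx _) (ltry _).
    - exact: solution_ode_on sy (lexx _) (ltry _).
    - by move=> v v0 _; apply: xB; rewrite addr_ge0// ltW.
    - by move=> v v0 _; case: (hA (y v) (Ay v (ltW v0))).
    by rewrite ler_pM ?expR_ge0 ?sq_ge0// ler_expR ler_piMr// ltW.
  split => // u u0 u1.
  have := @observer_compare R d c phic kappa e E contraction (fun u => eta (u + i%:R))
    (fun u => tau (y u)) (fun u => Q0 (x (u + i%:R)) *: G) (fun u => Q0 (y u) *: G)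
    0 u (M1 * ri i) u0.
  rewrite add0r y0 subr0; apply.
  - exact: mulr_ge0.
  - by apply: within_shift; exact: continuous_subspaceT.
  - apply: within_comp; last exact: lip_bdd_continuous (lip_tau smooth).
    by have [] := solution_ode_on sy (lexx 0) (ltry u).
  - move=> v v0 _; apply: (is_derive_translate (x := eta)).
    by apply: Deta; rewrite ltr_pwDl.
  - by move=> v v0 _; apply: tau_observer.
  - move=> v v0 vu; have v1 := le_trans (ltW vu) u1.
    rewrite -scalerBl -scalemxAl sqZ.
    have -> : M1 * ri i = LQ ^+ 2 * (Ef * ri i) * sq (G *m E) by rewrite /M1; ring.
    rewrite ler_wpM2r ?sq_ge0//.
    apply: (@le_trans _ _ ((LQ * `|x (v + i%:R) - y v|) ^+ 2)).
      rewrite -real_normK ?num_real// lerXn2r ?nnegrE ?mulr_ge0//.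
      apply: hLQ; first by apply: xB; rewrite addr_ge0// ltW.
      by case: (hA (y v) (Ay v (ltW v0))).
    rewrite exprMn ler_wpM2l ?sqr_ge0// (le_trans (norm_sq_le _))//.
    by apply: xy => //; exact: ltW.
have half : expR (- 1) <= 2^-1 :> R.
  rewrite expRN lef_pV2 ?posrE ?expR_gt0//.
  by have := @expR_ge1Dx R 1; lra.
have ri_le i : ri i <= C0 * q1 ^+ i * c1.
  rewrite /ri ler_wpM2r ?(ltW c10)// ler_wpM2l ?(ltW C00)//.
  by rewrite lerXn2r ?nnegrE// ltW.
have riS i : ri i.+1 <= ri i.
  rewrite /ri ler_wpM2r ?(ltW c10)// ler_wpM2l ?(ltW C00)//.
  by rewrite ler_wiXn2l// ltW.
have nodes (i : nat) : exists b, [/\ A0 b, sq (x i%:R - b) <= ri i &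
    sq ((eta i%:R - tau b) *m E) <= q1 ^+ i * (c2 + M4 * c1)].
  elim: i => [|i [b [Ab xb etab]]].
    exists a; split => //.
      by rewrite (le_trans xa)// /ri expr0 mulr1 ler_peMl// ltW.
    by rewrite expr0 mul1r (le_trans etaa)// lerDl mulr_ge0// ltW.
  have [y [y0 Ay xy etay]] := window i b Ab xb.
  (* The new base point comes from the exponential estimate counted from time 0. Keeping [y 1],
     whose distance to x may have grown by the factor [Ef], would let the losses accumulate. *)
  have [b' Ab' xb'] := hexp x a c1 sx spx Aa c10 c1rho xa i.+1.
  exists b'; split => //.
  have h1 := xy 1 ler01 (lexx _); have h2 := etay 1 ler01 (lexx _).
  have e1 : 1 + i%:R = i.+1%:R :> R by rewrite addrC natr1.
  rewrite e1 in h1 h2.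
  have h3 : sq (y 1 - b') <= (2 * Ef + 2) * ri i.
    apply: (le_trans (sq_sub_mid (x i.+1%:R) _ _)); rewrite (sq_subC (y 1)).
    have := riS i; rewrite /ri => h; move: h1; rewrite /ri; lra.
  have h4 : sq ((tau (y 1) - tau b') *m E) <= M2 * ri i.
    have -> : M2 * ri i = KE * (d.+1%:R * (Lt ^+ 2 * ((2 * Ef + 2) * ri i))).
      by rewrite /M2; ring.
    apply: (le_trans (hKE _)); rewrite ler_wpM2l ?(ltW KE0)//.
    apply: (le_trans (sq_le_norm _)); rewrite ler_wpM2l//.
    apply: (@le_trans _ _ ((Lt * `|y 1 - b'|) ^+ 2)).
      rewrite lerXn2r ?nnegrE ?mulr_ge0//; apply: hLt; last by case: (hA b' Ab').
      by case: (hA (y 1) (Ay 1 ler01)).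
    by rewrite exprMn ler_wpM2l ?sqr_ge0// (le_trans (norm_sq_le _)).
  have h5 : sq ((eta i.+1%:R - tau b') *m E) <=
      5 / 4 * sq ((eta i.+1%:R - tau (y 1)) *m E) + 5 * sq ((tau (y 1) - tau b') *m E).
    have quarter : 0 < 4^-1 :> R by rewrite invr_gt0.
    have := @sqD_amgm R _ 4^-1 ((eta i.+1%:R - tau (y 1)) *m E) ((tau (y 1) - tau b') *m E) quarter.
    rewrite -mulmxDl addrA subrK invrK; lra.
  have V0 := sq_ge0 ((eta i%:R - tau b) *m E).
  have h6 : expR (- 1) * sq ((eta i%:R - tau b) *m E) <= 2^-1 * sq ((eta i%:R - tau b) *m E).
    by rewrite ler_wpM2r.
  have h7 : M3 * ri i <= M3 * (C0 * q1 ^+ i * c1) by rewrite ler_wpM2l.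
  have Q0_ : 0 <= q1 ^+ i by rewrite exprn_ge0// ltW.
  have h8 : 7 / 8 * (q1 ^+ i * (c2 + M4 * c1)) <= q1 * (q1 ^+ i * (c2 + M4 * c1)).
    by rewrite ler_wpM2r// mulr_ge0// addr_ge0// mulr_ge0// ltW.
  have h9 : M3 * (C0 * q1 ^+ i * c1) = 4^-1 * (q1 ^+ i * (M4 * c1)) by rewrite /M4; field.
  have h10 : 0 <= q1 ^+ i * c2 by rewrite mulr_ge0.
  rewrite exprS -mulrA; move: h7; rewrite h9 /M3.
  move: h2 h4 h5 h6 h8 etab; rewrite !mulrDr; lra.
move=> i t it ti1; have [b [Ab xb etab]] := nodes i.
have [y [y0 Ay xy etay]] := window i b Ab xb.
have M1C0 : 0 <= M1 * C0 by apply: mulr_ge0 => //; exact: ltW.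
have EfC0 : 0 <= Ef * C0 by apply: mulr_ge0; exact: ltW.
have u0 : 0 <= t - i%:R by rewrite subr_ge0.
have u1 : t - i%:R <= 1 by rewrite lerBlDl.
exists (y (t - i%:R)); split; first exact: Ay.
  have := xy _ u0 u1; rewrite subrK => /le_trans; apply.
  have Q0_ : 0 <= q1 ^+ i * c1 by rewrite mulr_ge0 ?exprn_ge0// ltW.
  apply: (@le_trans _ _ (Ef * (C0 * q1 ^+ i * c1))); first by rewrite ler_wpM2l// ltW.
  have -> : Ef * (C0 * q1 ^+ i * c1) = Ef * C0 * (q1 ^+ i * c1) by ring.
  rewrite -[leRHS]mulrA ler_wpM2r// lerDr; apply: addr_ge0 => //.
  by rewrite addr_ge0.
have := etay _ u0 u1; rewrite subrK => /le_trans; apply.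
have V0 := sq_ge0 ((eta i%:R - tau b) *m E).
have h1 : expR (- (t - i%:R)) * sq ((eta i%:R - tau b) *m E) <= sq ((eta i%:R - tau b) *m E).
  by rewrite ler_piMl// expR_le1 oppr_le0.
have h2 : M1 * ri i <= M1 * (C0 * q1 ^+ i * c1) by rewrite ler_wpM2l.
have Q0_ : 0 <= q1 ^+ i by rewrite exprn_ge0// ltW.
have h3 : 0 <= q1 ^+ i * c2 by rewrite mulr_ge0.
have h4 : 0 <= q1 ^+ i * c1 by rewrite mulr_ge0// ltW.
have h5 : 0 <= M4 * (q1 ^+ i * c2) by rewrite mulr_ge0.
have h6 : 0 <= M1 * C0 * (q1 ^+ i * c2) by apply: mulr_ge0.
have h7 : 0 <= Ef * C0 * (q1 ^+ i * (c1 + c2)).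
  by apply: mulr_ge0 => //; rewrite mulrDr addr_ge0.
move: h1 h2 etab; lra.
Qed.

End extended_zero_dynamics.

(** * High gain between two samples *)

Section scalar.
Variable R : realType.

Lemma geometric_small (A q e : R) : 0 <= q -> q < 1 -> 0 < e ->
  exists i0 : nat, forall i, (i0 <= i)%N -> A * q ^+ i <= e.
Proof.
move=> q0 q1 e0.
have cv : (fun i => A * q ^+ i) @ \oo --> (0 : R).
  rewrite -[X in _ --> X](mulr0 A); apply: cvgM; first exact: cvg_cst.
  by apply: cvg_expr; rewrite ger0_norm.
move/cvgrPdist_le : cv => /(_ _ e0)[i0 _ hi]; exists i0 => i /hi.
by rewrite sub0r normrN => /(le_trans (ler_norm _)).
Qed.

Lemma within_max (f g : R -> R) (a b : R) :
  {within `[a, b], continuous f} -> {within `[a, b], continuous g} ->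
  {within `[a, b], continuous (fun t => Num.max (f t) (g t))}.
Proof. by move=> cf cg; apply: continuous_max2. Qed.

Lemma expRN_le (t : R) : 0 < t -> expR (- t) <= t^-1.
Proof.
move=> t0; rewrite expRN lef_pV2 ?posrE ?expR_gt0//.
by have := @expR_ge1Dx R t; lra.
Qed.

(* Singular perturbation estimate with Lyapunov function u + (2 L / k) v. *)
Lemma slow_fast (L T : R) : 0 < L -> 0 <= T -> exists2 M : R, 0 < M &
  forall (u v : R -> R) (k b l V : R), 0 <= l -> l <= T -> 0 <= b ->
    1 <= k -> L <= k -> M * (v 0 + b) < k -> v 0 + 1 <= V ->
    {within `[0, l], continuous u} -> {within `[0, l], continuous v} ->
    u 0 = 0 -> (forall t, 0 <= u t) -> (forall t, 0 <= v t) ->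
    (forall t, 0 < t -> t < l -> exists2 du : R, is_derive t 1 u du &
      (u t <= 1 -> v t <= V -> du <= L * u t + L * v t)) ->
    (forall t, 0 < t -> t < l -> exists2 dv : R, is_derive t 1 v dv &
      (u t <= 1 -> v t <= V -> dv <= - k * v t + L * u t + L * b / k)) ->
    u l <= M / k * (v 0 + b) /\ v l <= expR (- (k * l)) * v 0 + M / k * (v 0 + b).
Proof.
(* [M1] combines the growth rate 3 L of the Lyapunov function with the weight 2 L of v in it; [M]
   adds the response of v to u and to b. *)
move=> L0 T0; pose M1 := expR (3 * L * T) * (2 * L).
have M10 : 0 < M1 by rewrite mulr_gt0 ?expR_gt0// mulr_gt0.
pose M := M1 + (L * M1 + L).
have LM10 : 0 < L * M1 by rewrite mulr_gt0.
have M0 : 0 < M by rewrite /M; lra.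
exists M => // u v k b l V l0 lT b0 k1 Lk Mk vV cu cv u00 u0 v0 Du Dv.
have k0 : 0 < k by lra.
pose S := v 0 + b.
have S0 : 0 <= S by rewrite addr_ge0.
have iM (x : R) : 0 <= x -> x / k <= x.
  by move=> x0; rewrite ler_pdivrMr// ler_peMr.
have estimate t : 0 <= t -> t <= l ->
    (forall r, 0 <= r -> r < t -> u r <= 1 /\ v r <= V) ->
    u t <= M1 / k * S /\ v t <= expR (- (k * t)) * v 0 + M / k * S.
  move=> t0 tl reg.
  have u_le r : 0 <= r -> r <= t -> u r <= M1 / k * S.
    move=> r0 rt.
    have rl := le_trans rt tl.
    (* The weight 2 L / k turns - k v into - 2 L v, which pays for the term L v in the equation of
       u. What remains grows at rate at most 3 L. *)
    have := @gronwall_grow R (fun r => u r + 2 * L / k * v r) 0 r (3 * L)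
      (2 * L ^+ 2 * b / k ^+ 2) r0.
    rewrite subr0 u00 add0r => gr.
    apply: (@le_trans _ _ (u r + 2 * L / k * v r)).
      by rewrite lerDl mulr_ge0// divr_ge0// ltW// mulr_gt0.
    apply: (le_trans (gr _ _ _ _)).
    - by rewrite mulr_gt0.
    - by rewrite divr_ge0 ?exprn_ge0// ?(ltW k0)// mulr_ge0// mulr_ge0// sqr_ge0.
    - move=> w; apply: cvgD; first by apply: (within_itvS (lexx 0) rl cu).
      apply: cvgM; first exact: cvg_cst.
      exact: (within_itvS (lexx 0) rl cv).
    - move=> w w0 wr; have wt := lt_le_trans wr rt; have wl := lt_le_trans wt tl.
      have [du D1 h1] := Du w w0 wl; have [dv D2 h2] := Dv w w0 wl.
      have [r1 r2] := reg w (ltW w0) wt.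
      exists (du + 2 * L / k * dv).
        by apply: is_derive_eq; rewrite /GRing.scale/=; ring.
      have {}h1 := h1 r1 r2; have {}h2 := h2 r1 r2.
      have c0 : 0 <= 2 * L / k by rewrite divr_ge0 ?mulr_ge0// ltW.
      have := ler_wpM2l c0 h2.
      have -> : 2 * L / k * (- k * v w + L * u w + L * b / k) =
          - (2 * L * v w) + 2 * L ^+ 2 / k * u w + 2 * L ^+ 2 * b / k ^+ 2.
        by field; rewrite gt_eqF.
      have h3 : 2 * L ^+ 2 / k * u w <= 2 * L * u w.
        rewrite ler_wpM2r// ler_pdivrMr// expr2 mulrA ler_wpM2l//.
        by rewrite mulr_ge0// ltW.
      have h4 : 0 <= 3 * L * (2 * L / k * v w) by rewrite !mulr_ge0// ?invr_ge0 ltW.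
      have h5 : 0 <= L * v w by rewrite mulr_ge0// ltW.
      rewrite [3 * L * (u w + _)]mulrDr; lra.
    have -> : M1 / k * S = expR (3 * L * T) * (2 * L / k * v 0 + 2 * L / k * b).
      by rewrite /M1 /S; ring.
    have -> : 2 * L ^+ 2 * b / k ^+ 2 / (3 * L) = (2 / 3) * (L * b / k / k).
      by field; rewrite !gt_eqF.
    have h1 : 0 <= L * b / k by rewrite divr_ge0 ?mulr_ge0// ltW.
    have h2 : 0 <= 2 * L / k * v 0 by rewrite mulr_ge0// divr_ge0 ?mulr_ge0// ltW.
    have h3 : 0 <= L * b / k / k by rewrite divr_ge0// ltW.
    apply: ler_pM; rewrite ?expR_ge0//; first by lra.
      by rewrite ler_expR ler_wpM2l ?mulr_ge0 ?(ltW L0)// (le_trans rl).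
    rewrite lerD2l.
    have := iM _ h1.
    have -> : 2 * L / k * b = 2 * (L * b / k) by field; rewrite gt_eqF.
    lra.
  split; first exact: u_le.
  have := @gronwall_decay R v 0 t k (L * (M1 / k * S) + L * b / k) t0 k0.
  rewrite subr0 => gd; apply: (le_trans (gd _ _ _)).
  - rewrite addr_ge0 ?divr_ge0 ?mulr_ge0 ?invr_ge0// ltW//.
  - exact: (within_itvS (lexx 0) tl cv).
  - move=> w w0 wt; have wl := lt_le_trans wt tl.
    have [dv D2 h2] := Dv w w0 wl; have [r1 r2] := reg w (ltW w0) wt.
    exists dv => //; apply: (le_trans (h2 r1 r2)).
    have := u_le w (ltW w0) (ltW wt); rewrite -(ler_pM2l L0); lra.
  rewrite mulNr lerD2l.
  apply: (@le_trans _ _ (L * (M1 / k * S) + L * b / k)).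
    by apply: iM; rewrite addr_ge0 ?divr_ge0 ?mulr_ge0 ?invr_ge0// ltW.
  have -> : M / k * S = M1 / k * S + L * (M1 / k * S) + L * S / k.
    by rewrite /M; field; rewrite gt_eqF.
  have : L * b / k <= L * S / k.
    by rewrite ler_wpM2r ?invr_ge0 ?(ltW k0)// ler_wpM2l ?(ltW L0)// /S lerDr.
  have : 0 <= M1 / k * S by rewrite mulr_ge0// divr_ge0// ltW.
  lra.
have MS : M / k * S < 1 by rewrite mulrAC ltr_pdivrMr// mul1r.
have M1S : M1 / k * S <= M / k * S.
  by rewrite ler_wpM2r// ler_wpM2r ?invr_ge0 ?(ltW k0)// /M; lra.
(* The differential inequalities are available only while u <= 1 and v <= V. Both constraints are
   merged into one scalar function for [continuation]; [estimate] improves them strictly because M S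
   / k < 1. *)
have inside t : 0 <= t -> t <= l -> Num.max (u t) (v t - V + 1) < 1.
  apply: (@continuation R (fun t => Num.max (u t) (v t - V + 1)) 1 l).
    apply: within_max => // w; apply: cvgD; last exact: cvg_cst.
    by apply: cvgB; [exact: cv|exact: cvg_cst].
  move=> r r0 rl reg.
  have [|h1 h2] := estimate r r0 rl.
    move=> w w0 wr; have := reg w w0 wr; rewrite ge_max => /andP[h1 h2].
    by split => //; lra.
  have h3 : expR (- (k * r)) * v 0 <= v 0.
    by rewrite ler_piMl// expR_le1 oppr_le0 mulr_ge0// ltW.
  by rewrite gt_max; apply/andP; split; lra.
have [|h1 h2] := estimate l l0 (lexx _).
  move=> r r0 rl; have := inside r r0 (ltW rl); rewrite gt_max => /andP[h1 h2].
  by split; lra.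
by split; [exact: le_trans h1 M1S|].
Qed.

End scalar.

Section extended.
Variables (R : realType) (p r n d : nat).
Variables (s : 'rV[R]_r -> 'rV[R]_r) (yr : 'rV[R]_r -> R).
Variables (f : 'rV[R]_n -> R -> 'rV[R]_p -> 'rV[R]_n) (q : 'rV[R]_n -> R -> 'rV[R]_p -> R).
Hypothesis smooth : smooth_data s yr f q d.+1.
Variables (P : set 'rV[R]_p) (W : set 'rV[R]_r) (Z : set 'rV[R]_n).
Hypothesis Hss : steady_state_assumption s yr f P W Z.
Variables (phi phic : 'rV[R]_d.+1 -> R).
Hypothesis Himm : immersion_assumption s yr f q P W Z phi.
Local Notation N := (p + (r + n))%N.
Local Notation F0 := (f0 s yr f).
Local Notation Q0 := (q0 s yr q).
Local Notation A0 := (steady_state_set s yr f P W Z).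
Local Notation tau := (tau s yr f q d.+1).
Local Notation space := (prod_set P W [set: 'rV[R]_n]).
Local Notation start := (prod_set P W Z).
Hypothesis phic_phi : forall x, A0 x -> phic (tau x) = phi (tau x).
Variables (c : 'I_d.+1 -> R) (kappa : R).
Variables (e : nat) (E : 'M[R]_(d.+1, e)).
Local Notation OF := (observer_field c phic kappa).
Local Notation G := (gainG c kappa).
Hypothesis contraction : forall x y,
  dot ((x - y) *m E) ((OF x - OF y) *m E) <= - sq ((x - y) *m E).
Local Notation zdyn := (zero_dynamics s yr f q phic c kappa).

Lemma solution_space x (t : R) : solution F0 +oo%E x -> start (x 0) -> 0 <= t -> space (x t).
Proof.
case: Hss => -[K [cK Ksp hK]] _ _ sx xs t0.
by apply: Ksp; exact: (solution_in_K (lip_F0 smooth) hK sx).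
Qed.

Lemma zero_dynamics_shift x eta (t0 : R) : 0 <= t0 -> zdyn x eta ->
  zdyn (fun t => x (t + t0)) (fun t => eta (t + t0)).
Proof.
move=> t00 [sx ceta Deta]; split; first exact: solution_shift.
  move=> t; apply: (@continuous_comp _ _ _ (fun t : R => t + t0) eta); last exact: ceta.
  by apply: cvgD; [exact: cvg_id|exact: cvg_cst].
by move=> t t1; apply: is_derive_translate; apply: Deta; rewrite ltr_pwDl.
Qed.

(** The observer state is compared with the constant 0, which is a solution for the forcing -
    [OF 0]. *)
Lemma zero_dynamics_global : exists2 B : R, 0 < B & forall H : R, 0 <= H ->
  exists2 H' : R, 0 <= H' & forall x eta, zdyn x eta -> start (x 0) ->
    sq (eta 0 *m E) <= H ->
    forall t, 0 <= t -> `|x t| <= B /\ sq (eta t *m E) <= H'.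
Proof.
have [B B0 [hstart _]] := zero_dynamics_bounded smooth Hss.
exists B => // H H0.
have [BQ BQ0 hBQ] := lip_bdd_bounded B (lip_Q0 smooth).
pose D := 2 * (BQ ^+ 2 * sq (G *m E)) + 2 * sq (OF 0 *m E).
have D0 : 0 <= D.
  by apply: addr_ge0; apply: mulr_ge0 => //; rewrite ?sq_ge0// mulr_ge0 ?sqr_ge0 ?sq_ge0.
exists (H + D) => [|x eta [sx ceta Deta] startx etaH t t0]; first exact: addr_ge0.
have xB u : 0 <= u -> `|x u| <= B.
  move=> u0; have [y [sy y0 yB]] := hstart _ startx.
  by rewrite (solution_unique (lip_F0 smooth) u0 sx sy (esym y0)) yB.
split; first exact: xB.
have := @observer_compare R d c phic kappa e E contraction eta (fun=> 0)
  (fun t => Q0 (x t) *: G) (fun=> - OF 0) 0 t D t0 D0.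
rewrite !subr0 => le1; apply: (le_trans (le1 _ _ _ _ _)).
- exact: continuous_subspaceT.
- by apply: continuous_subspaceT => u; exact: cvg_cst.
- by move=> u u0 _; exact: Deta.
- by move=> u _ _; rewrite subrr; exact: is_derive_cst.
- move=> u u0 _; rewrite opprK mulmxDl (le_trans (sqD _ _))// /D lerD2r ler_wpM2l//.
  rewrite -scalemxAl sqZ ler_wpM2r ?sq_ge0// -real_normK ?num_real//.
  rewrite lerXn2r ?nnegrE ?(ltW BQ0)//; apply: hBQ; apply: xB; exact: ltW.
rewrite lerD2r (le_trans _ etaH)// ler_piMl ?sq_ge0//.
by rewrite expR_le1 oppr_le0.
Qed.

(** After a time [t1] common to all initial conditions, x is within reach of the local exponential
    estimate and eta is still bounded in terms of H; the remaining time therefore depends on H and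
    [dl] only. *)
Lemma zero_dynamics_uniform : forall H dl : R, 0 <= H -> 0 < dl ->
  exists2 th : R, 0 <= th & forall x eta, zdyn x eta -> start (x 0) ->
    sq (eta 0 *m E) <= H -> forall t, th <= t ->
    exists b, [/\ A0 b, sq (x t - b) <= dl & sq ((eta t - tau b) *m E) <= dl].
Proof.
move=> H dl H0 dl0.
have [C [q1 [rho [C0 q10 q11 rho0 hloc]]]] :=
  zero_dynamics_local smooth Hss Himm phic_phi contraction.
have [B B0 hglob] := zero_dynamics_global.
have [H' H'0 hH'] := hglob H H0.
have [B' _ [_ hA]] := zero_dynamics_bounded smooth Hss.
have [Bt Bt0 hBt] := lip_bdd_bounded B' (lip_tau smooth).
have [KE KE0 hKE] := sq_mulmx E.
have [t1 t10 hatt] := zero_dynamics_attracts smooth Hss rho0.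
pose c2 := 2 * H' + 2 * (KE * (d.+1%:R * Bt ^+ 2)).
have c20 : 0 <= c2 by rewrite addr_ge0 ?mulr_ge0 ?sqr_ge0// ltW.
have [i0 hi0] := geometric_small (C * (rho + c2)) (ltW q10) q11 dl0.
exists (t1 + i0%:R + 1) => [|x eta z startx etaH t tht].
  by rewrite !addr_ge0.
have [sx ceta Deta] := z.
have [a Aa xa] := hatt x sx startx.
have z' := zero_dynamics_shift t10 z.
have etaa : sq ((eta t1 - tau a) *m E) <= c2.
  rewrite mulmxBl (le_trans (sqD _ _))// sqN lerD//.
    by rewrite ler_wpM2l//; case: (hH' x eta z startx etaH t1 t10).
  rewrite ler_wpM2l// (le_trans (hKE _))// ler_wpM2l ?(ltW KE0)//.
  rewrite (le_trans (sq_le_norm _))// ler_wpM2l// lerXn2r ?nnegrE ?(ltW Bt0)//.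
  by apply: hBt; case: (hA a Aa).
pose i := Num.truncn (t - t1).
have tt1 : 0 <= t - t1 by have : 0 <= i0%:R :> R by []; lra.
have ile : i%:R <= t - t1 by rewrite /i truncn_le.
have ilt : t - t1 <= i%:R + 1 by rewrite natr1 ltW// truncnS_gt.
have ii0 : (i0 <= i)%N.
  by rewrite -(ler_nat R) -(lerD2r 1); lra.
have spx : space (x (0 + t1)) by rewrite add0r; exact: solution_space.
have xa' : sq (x (0 + t1) - a) <= rho by rewrite add0r ltW.
have etaa' : sq ((eta (0 + t1) - tau a) *m E) <= c2 by rewrite add0r.
have [b [Ab xb etab]] := hloc _ _ a rho c2 z' spx Aa rho0 (lexx _) xa' etaa' i _ ile ilt.
rewrite subrK in xb etab.
have h1 := hi0 i ii0; rewrite mulrAC in h1.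
exists b; split => //; last exact: le_trans h1.
apply: (le_trans xb); apply: le_trans h1; rewrite ler_wpM2l ?lerDl//.
by rewrite mulr_ge0 ?exprn_ge0// ltW.
Qed.

End extended.

(* [lra] on the goal alone; it fails if section hypotheses, such as [h1] and
   [h2], are cleared. *)
Ltac lra_goal h1 h2 := repeat match goal with H : is_true _ |- _ =>
  tryif first [constr_eq H h1 | constr_eq H h2] then fail else clear H end; lra.

Section comparison.
Variables (R : realType) (p r n d : nat).
Variables (s : 'rV[R]_r -> 'rV[R]_r) (yr : 'rV[R]_r -> R).
Variables (f : 'rV[R]_n -> R -> 'rV[R]_p -> 'rV[R]_n) (q : 'rV[R]_n -> R -> 'rV[R]_p -> R).
Hypothesis smooth : smooth_data s yr f q d.+1.
Variables (P : set 'rV[R]_p) (W : set 'rV[R]_r).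
Variable phic : 'rV[R]_d.+1 -> R.
Local Notation N := (p + (r + n))%N.
Local Notation F0 := (f0 s yr f).
Local Notation Q0 := (q0 s yr q).
Local Notation PF := (perturbed_field s yr f).
Local Notation FF := (feedforward s yr q).
Local Notation space := (prod_set P W [set: 'rV[R]_n]).
Variables (c : 'I_d.+1 -> R) (L kappa : R).
Hypothesis L_gt0 : 0 < L.
Hypothesis phicL : forall x y, `|phic x - phic y| <= L * `|x - y|.
Variables (e : nat) (E : 'M[R]_(d.+1, e)) (K1 : R).
Local Notation OF := (observer_field c phic kappa).
Local Notation G := (gainG c kappa).
Hypothesis K1_gt0 : 0 < K1.
Hypothesis coercive : forall x : 'rV[R]_d.+1, sq x <= K1 * sq (x *m E).
Hypothesis contraction : forall x y,
  dot ((x - y) *m E) ((OF x - OF y) *m E) <= - sq ((x - y) *m E).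
Local Notation zdyn := (zero_dynamics s yr f q phic c kappa).

Ltac arith := lra_goal L_gt0 K1_gt0.

(* The closed loop between two samples, in the coordinates x = (mu, w_d, z),
   ep = y - yr(w_d) and eta = xi - G ep, which remove k from all equations
   except that of ep. *)
Definition perturbed (k l : R) (x : R -> 'rV[R]_N) (eta : R -> 'rV[R]_d.+1) (ep : R -> R) :=
  [/\ [/\ {within `[0, l], continuous x}, {within `[0, l], continuous eta} &
        {within `[0, l], continuous ep}],
      forall t, 0 <= t -> t <= l -> space (x t) &
      forall t : R, 0 < t -> t < l ->
        [/\ is_derive t 1 x (PF (x t, ep t)),
            is_derive t 1 eta (OF (eta t + ep t *: G) + FF (x t, ep t) *: G) &
            is_derive t 1 ep ((eta t + ep t *: G) 0 0 - FF (x t, ep t) - k * ep t)]].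

Lemma perturbed_restrict k l l' x eta ep : l' <= l ->
  perturbed k l x eta ep -> perturbed k l' x eta ep.
Proof.
move=> ll [[c1 c2 c3] sp D]; split.
- by split; apply: within_itvS (lexx 0) ll _.
- by move=> t t0 tl; apply: sp => //; exact: le_trans ll.
- by move=> t t0 tl; apply: D => //; exact: lt_le_trans ll.
Qed.

Lemma perturbed_shift k l a x eta ep : 0 <= a -> perturbed k l x eta ep ->
  perturbed k (l - a) (fun t => x (t + a)) (fun t => eta (t + a)) (fun t => ep (t + a)).
Proof.
move=> a0 [[c1 c2 c3] sp D]; have la : l - a + a <= l by rewrite subrK.
have a0' : 0 <= 0 + a by rewrite add0r.
split.
- by split; apply: within_shift; apply: (within_itvS a0' la).
- by move=> t t0 tl; apply: sp; [exact: addr_ge0|rewrite -lerBrDr].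
- move=> t t0 tl; have [|| D1 D2 D3] := D (t + a).
  + by rewrite ltr_pwDl.
  + by rewrite -ltrBrDr.
  by split; apply: is_derive_translate.
Qed.

(** An instance of [slow_fast], with u the squared distance to the zero dynamics and v = ep^2. The
    number b bounds the squared drift of ep along the zero dynamics, the only forcing that does not
    vanish with u and v. *)
Lemma comparison (B V T : R) : 0 <= B -> 0 <= V -> 0 <= T ->
  exists2 M : R, 0 < M & forall k l b x eta ep x0 eta0,
    0 <= l -> l <= T -> 0 <= b -> perturbed k l x eta ep -> zdyn x0 eta0 ->
    x0 0 = x 0 -> eta0 0 = eta 0 ->
    (forall t, 0 < t -> t < l -> `|x0 t| <= B) ->
    (forall t, 0 < t -> t < l -> (eta0 t 0 0 - Q0 (x0 t)) ^+ 2 <= b) ->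
    ep 0 ^+ 2 <= V -> M * (1 + V + b) <= k ->
    sq (x l - x0 l) + sq ((eta l - eta0 l) *m E) <= M / k * (ep 0 ^+ 2 + b) /\
    ep l ^+ 2 <= expR (- (k * l)) * ep 0 ^+ 2 + M / k * (ep 0 ^+ 2 + b).
Proof.
(* Room for |x| <= B + 1 and |ep| <= V + 2, which hold as long as u <= 1 and v <= V + 1. The
   Lipschitz constants are valid on this ball only, whence the conditional inequalities of
   [slow_fast]. *)
move=> B0 V0 T0; pose rho := B + V + 4.
have [LF LF0 hLF] := lip_perturbed_field smooth rho.
have [LQ LQ0 hLQ] := lip_feedforward smooth rho.
have [KO KO0 hKO] := observer_field_lipschitz c kappa L_gt0 phicL.
have [KE KE0 hKE] := sq_mulmx E.
pose c1 : R := N%:R * LF ^+ 2.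
pose c2 : R := KE * (2 * (d.+1%:R * (KO * `|G|) ^+ 2)).
pose c3 : R := KE * (2 * (LQ ^+ 2 * sq G)).
pose c4 : R := 3 * (LQ ^+ 2 + K1 + G 0 0 ^+ 2).
have c10 : 0 <= c1 by rewrite mulr_ge0 ?sqr_ge0.
have c20 : 0 <= c2.
  apply: mulr_ge0; first exact: ltW.
  by apply: mulr_ge0 => //; apply: mulr_ge0 => //; exact: sqr_ge0.
have c30 : 0 <= c3.
  by apply: mulr_ge0; [exact: ltW|rewrite mulr_ge0// mulr_ge0 ?sqr_ge0 ?sq_ge0].
have c40 : 0 <= c4 by rewrite mulr_ge0// !addr_ge0 ?sqr_ge0// ltW.
pose Lc := 2 + c1 + c2 + c3 + c4.
have Lc0 : 0 < Lc by rewrite /Lc; lra.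
have [Ms Ms0 hMs] := slow_fast Lc0 T0.
exists (Ms + 2 * Lc + 2); first by lra.
move=> k l b x eta ep x0 eta0 l0 lT b0 [[cx ceta cep] sp D] [sx0 ceta0 Deta0] x00 eta00 xB hb epV kM.
have pVb : 0 <= (Ms + 2 * Lc + 2) * (V + b).
  by rewrite mulr_ge0 ?addr_ge0// ?mulr_ge0// ltW.
have k_ge : Ms + 2 * Lc + 2 <= k.
  by move: kM pVb; arith.
(* In the equation of v, the estimate [e1] below leaves k / 2 to spare beyond the rate k, and this
   must absorb (1 + c4) v. *)
have k_c4 : 2 + 2 * c4 <= k.
  have aux (a b1 b2 b3 b4 k' : R) : 0 < a -> 0 <= b1 -> 0 <= b2 -> 0 <= b3 ->
    a + 2 * (2 + b1 + b2 + b3 + b4) + 2 <= k' -> 2 + 2 * b4 <= k' by arith.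
  exact: (aux Ms c1 c2 c3 c4 k Ms0 c10 c20 c30 k_ge).
have k1 : 1 <= k by move: k_ge Ms0 Lc0; arith.
have k0 : 0 < k by exact: lt_le_trans k1.
have Lk : Lc <= k by move: k_ge Ms0 Lc0; arith.
have Msk : Ms * (ep 0 ^+ 2 + b) < k.
  have h : Ms * (ep 0 ^+ 2 + b) <= Ms * (V + b) by rewrite ler_wpM2l ?(ltW Ms0)// lerD2r.
  have h' : 0 <= 2 * Lc * (V + b) by rewrite mulr_ge0 ?addr_ge0// mulr_ge0// ltW.
  have h'' : 0 <= 2 * (V + b) by rewrite mulr_ge0 ?addr_ge0.
  by move: kM h h' h'' Ms0 Lc0; arith.
pose u t := sq (x t - x0 t) + sq (eta t *m E - eta0 t *m E).
pose v t := ep t ^+ 2.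
have MsM : Ms / k * (ep 0 ^+ 2 + b) <= (Ms + 2 * Lc + 2) / k * (ep 0 ^+ 2 + b).
  rewrite ler_wpM2r ?addr_ge0 ?sqr_ge0// ler_wpM2r ?invr_ge0 ?(ltW k0)//; move: Lc0; arith.
have [cx0 _] := solution_ode_on sx0 (lexx 0) (ltry l).
have cE (w : R -> 'rV[R]_d.+1) : {within `[0, l], continuous w} ->
    {within `[0, l], continuous (fun t => w t *m E)}.
  by move=> cw; apply: within_comp cw (@continuous_mulmxr _ _ _ E).
have cv : {within `[0, l], continuous v}.
  by move=> t; rewrite /v; apply: cvgM; exact: cep.
have cu : {within `[0, l], continuous u}.
  move=> t; apply: cvgD; first exact: continuous_sq_sub.
  apply: continuous_sq_sub; apply: cE => //; exact: continuous_subspaceT.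
have reg t : 0 < t -> t < l -> u t <= 1 -> v t <= V + 1 ->
   [/\ sq (PF (x t, ep t) - F0 (x0 t)) <= c1 * (sq (x t - x0 t) + v t),
       (FF (x t, ep t) - Q0 (x0 t)) ^+ 2 <= LQ ^+ 2 * (sq (x t - x0 t) + v t) &
       `|x t| <= rho].
  move=> t0 tl ut vt.
  have D0 := sq_ge0 (x t - x0 t).
  have xx0 : `|x t - x0 t| <= 1.
    rewrite -ler_sqr ?nnegrE// expr1n (le_trans (norm_sq_le _))//.
    by have := sq_ge0 (eta t *m E - eta0 t *m E); move: ut; rewrite /u; arith.
  have xB1 : `|x t| <= B + 1.
    have := ler_normD (x t - x0 t) (x0 t); rewrite subrK.
    by have := xB t t0 tl; move: xx0; arith.
  have ep_le : `|ep t| <= V + 2.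
    have := sqr_ge0 (`|ep t| - 1); move: vt; rewrite /v -[ep t ^+ 2]real_normK ?num_real//.
    by move: V0; arith.
  have nxe : `|(x t, ep t)| <= rho.
    by rewrite prod_normE/= ge_max /rho; apply/andP; split; move: xB1 ep_le B0 V0; arith.
  have nx0 : `|(x0 t, 0 : R)| <= rho.
    rewrite prod_normE/= ge_max normr0 /rho; have xBt := xB t t0 tl.
    by apply/andP; split; move: xBt B0 V0; arith.
  have ndiff : `|(x t, ep t) - (x0 t, 0)| ^+ 2 <= sq (x t - x0 t) + v t.
    have v0 : 0 <= v t := sqr_ge0 _.
    rewrite prod_normE/= subr0; have := norm_sq_le (x t - x0 t).
    have : `|ep t| ^+ 2 = v t by rewrite real_normK ?num_real.
    by have [_|_] := leP `|x t - x0 t| `|ep t|; move: v0 D0; arith.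
  split.
  - rewrite -(perturbed_field0 s yr f) (le_trans (sq_le_norm _))// /c1.
    apply: (@le_trans _ _ (N%:R * (LF * `|(x t, ep t) - (x0 t, 0)|) ^+ 2)).
      by rewrite ler_wpM2l// lerXn2r ?nnegrE ?mulr_ge0//; exact: hLF.
    by rewrite exprMn mulrA ler_wpM2l// mulr_ge0 ?sqr_ge0.
  - rewrite -(feedforward0 s yr q) -real_normK ?num_real//.
    apply: (@le_trans _ _ ((LQ * `|(x t, ep t) - (x0 t, 0)|) ^+ 2)).
      by rewrite lerXn2r ?nnegrE ?mulr_ge0//; exact: hLQ.
    by rewrite exprMn ler_wpM2l// sqr_ge0.
  - by rewrite /rho; move: xB1 V0; arith.
have := hMs u v k b l (V + 1) l0 lT b0 k1 Lk Msk _ cu cv.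
rewrite lerD2r => /(_ epV) [|||||h1 h2].
- by rewrite /u x00 eta00 !subrr !sq0 addr0.
- by move=> t; rewrite addr_ge0 ?sq_ge0.
- by move=> t; exact: sqr_ge0.
- move=> t t0 tl; have [D1 D2 D3] := D t t0 tl.
  have D1' : is_derive t 1 (fun t => x t - x0 t) (PF (x t, ep t) - F0 (x0 t)).
    by apply: is_deriveB; case: sx0 => _; apply => //; exact: ltry.
  have D2' := is_deriveB (is_derive_mulmx E D2) (is_derive_mulmx E (Deta0 t t0)).
  exists (2 * dot (x t - x0 t) (PF (x t, ep t) - F0 (x0 t)) +
    2 * dot (eta t *m E - eta0 t *m E)
     ((OF (eta t + ep t *: G) + FF (x t, ep t) *: G) *m E
       - (OF (eta0 t) + Q0 (x0 t) *: G) *m E)).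
    apply: is_deriveD; first exact: is_derive_sq D1'.
    exact: (is_derive_sq (x := fun t => eta t *m E - eta0 t *m E)).
  move=> ut vt; have [hF hQ _] := reg t t0 tl ut vt.
  set rr := OF (eta t + ep t *: G) - OF (eta t) + (FF (x t, ep t) - Q0 (x0 t)) *: G.
  have -> : (OF (eta t + ep t *: G) + FF (x t, ep t) *: G) *m E
      - (OF (eta0 t) + Q0 (x0 t) *: G) *m E =
      (OF (eta t) - OF (eta0 t)) *m E + rr *m E.
    have split_diff m (a1 a2 a3 g : 'rV[R]_m) (b1 b2 : R) :
        a1 + b1 *: g - (a3 + b2 *: g) = a2 - a3 + (a1 - a2 + (b1 - b2) *: g).
      by apply/rowP => j; rewrite !mxE; ring.
    by rewrite -mulmxBl -mulmxDl /rr -split_diff.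
  have hr : sq (rr *m E) <= c2 * v t + c3 * (sq (x t - x0 t) + v t).
    apply: (le_trans (hKE _)); rewrite /c2 /c3 -!mulrA -mulrDr ler_wpM2l ?(ltW KE0)//.
    apply: (le_trans (sqD _ _)); rewrite lerD// ler_wpM2l//.
      apply: (le_trans (sq_le_norm _)); rewrite ler_wpM2l//.
      apply: (@le_trans _ _ ((KO * `|ep t *: G|) ^+ 2)).
        rewrite lerXn2r ?nnegrE ?mulr_ge0// ?(ltW KO0)// (le_trans (hKO _ _))//.
        by rewrite addrAC subrr add0r.
      rewrite normrZ /v !exprMn real_normK ?num_real//.
      by rewrite le_eqVlt; apply/orP; left; apply/eqP; ring.
    rewrite sqZ -[leRHS](_ : LQ ^+ 2 * (sq (x t - x0 t) + v t) * sq G = _); last by ring.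
    by rewrite ler_wpM2r// sq_ge0.
  have g1 := dot_amgm1 (x t - x0 t) (PF (x t, ep t) - F0 (x0 t)).
  have g2 := contraction (eta t) (eta0 t).
  have g3 := dot_amgm1 ((eta t - eta0 t) *m E) (rr *m E).
  rewrite [dot _ (_ + rr *m E)]dotDr -mulmxBl /u -mulmxBl.
  have v0 : 0 <= v t := sqr_ge0 _.
  have D0 := sq_ge0 (x t - x0 t); have V0' := sq_ge0 ((eta t - eta0 t) *m E).
  move: g1 g2 g3 hF hr.
  set D' := sq (x t - x0 t) in D0 *; set V' := sq ((eta t - eta0 t) *m E) in V0' *.
  have := mulr_ge0 c10 D0; have := mulr_ge0 c10 V0'; have := mulr_ge0 c10 v0.
  have := mulr_ge0 c20 D0; have := mulr_ge0 c20 V0'; have := mulr_ge0 c20 v0.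
  have := mulr_ge0 c30 D0; have := mulr_ge0 c30 V0'; have := mulr_ge0 c30 v0.
  have := mulr_ge0 c40 D0; have := mulr_ge0 c40 V0'; have := mulr_ge0 c40 v0.
  by move: D0 V0' v0; rewrite /Lc; arith.
- move=> t t0 tl; have [D1 D2 D3] := D t t0 tl.
  exists (2 * ep t * ((eta t + ep t *: G) 0 0 - FF (x t, ep t) - k * ep t)).
    rewrite /v; apply: is_derive_eq; rewrite /GRing.scale/=; ring.
  move=> ut vt; have [hF hQ _] := reg t t0 tl ut vt.
  have D0 := sq_ge0 (x t - x0 t); have v0 : 0 <= v t := sqr_ge0 _.
  have V0' := sq_ge0 ((eta t - eta0 t) *m E).
  have -> : (eta t + ep t *: G) 0 0 = eta t 0 0 + ep t * G 0 0 by rewrite !mxE.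
  (* The drift of ep splits into [h0], taken along the zero dynamics and bounded by b, and [h1],
     which is Lipschitz in the deviations. *)
  set h0 := eta0 t 0 0 - Q0 (x0 t).
  set h1 := - (FF (x t, ep t) - Q0 (x0 t)) + (eta t 0 0 - eta0 t 0 0) + ep t * G 0 0.
  have h0b : h0 ^+ 2 <= b by exact: hb.
  have hh1 : h1 ^+ 2 <= c4 * (u t + v t).
    have qm (a1 a2 a3 : R) : (- a1 + a2 + a3) ^+ 2 <= 3 * (a1 ^+ 2 + a2 ^+ 2 + a3 ^+ 2).
      have := sqr_ge0 (a1 + a2); have := sqr_ge0 (a1 + a3); have := sqr_ge0 (a2 - a3); arith.
    apply: (le_trans (qm _ _ _)); rewrite /c4 -mulrA ler_wpM2l//.
    have g1 : (eta t 0 0 - eta0 t 0 0) ^+ 2 <= K1 * sq ((eta t - eta0 t) *m E).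
      apply: le_trans (coercive _).
      by have := coord_sq_le (eta t - eta0 t) 0; rewrite !mxE.
    have g2 : (ep t * G 0 0) ^+ 2 = G 0 0 ^+ 2 * v t by rewrite /v; ring.
    rewrite g2 /u -mulmxBl.
    have := mulr_ge0 (sqr_ge0 LQ) V0'; have := mulr_ge0 (ltW K1_gt0) D0.
    have := mulr_ge0 (ltW K1_gt0) v0; have := mulr_ge0 (sqr_ge0 (G 0 0)) D0.
    have := mulr_ge0 (sqr_ge0 (G 0 0)) V0'.
    by move: hQ g1; arith.
  (* Young's inequality with weight k / 2, so that b enters divided by k. *)
  have e1 : 2 * ep t * h0 <= k / 2 * v t + 2 / k * h0 ^+ 2.
    have := mulr_ge0 (ltW k0) (sqr_ge0 (ep t - 2 / k * h0)).
    have -> : k * (ep t - 2 / k * h0) ^+ 2 = k * v t - 4 * ep t * h0 + 4 / k * h0 ^+ 2.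
      by rewrite /v; field; rewrite gt_eqF.
    have -> : 4 / k * h0 ^+ 2 = 2 * (2 / k * h0 ^+ 2) by ring.
    arith.
  have e2 : 2 * ep t * h1 <= v t + h1 ^+ 2.
    by have := sqr_ge0 (ep t - h1); rewrite /v; arith.
  have e3 : 2 / k * h0 ^+ 2 <= Lc * b / k.
    rewrite mulrAC ler_wpM2r ?invr_ge0 ?(ltW k0)//.
    apply: (@le_trans _ _ (2 * b)); first by rewrite ler_wpM2l.
    by rewrite ler_wpM2r// /Lc; move: c10 c20 c30 c40; arith.
  have -> : eta t 0 0 + ep t * G 0 0 - FF (x t, ep t) = h0 + h1 by rewrite /h0 /h1; ring.
  have u0' : 0 <= u t by rewrite addr_ge0 ?sq_ge0.
  have := mulr_ge0 c10 u0'; have := mulr_ge0 c20 u0'; have := mulr_ge0 c30 u0'.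
  have : (2 + 2 * c4) * v t <= k * v t by rewrite ler_wpM2r.
  have -> : 2 * ep t * (h0 + h1 - k * ep t) = 2 * ep t * h0 + 2 * ep t * h1 - 2 * (k * v t).
    by rewrite /v; ring.
  by move: e1 e2 e3 hh1 u0' v0 b0; rewrite /Lc; arith.
split; last by apply: (le_trans h2); rewrite lerD2l.
by rewrite mulmxBl; apply: le_trans h1 MsM.
Qed.

End comparison.

(** * Contraction towards the graph over windows *)

Section windows.
Variables (R : realType) (p r n d : nat).
Variables (s : 'rV[R]_r -> 'rV[R]_r) (yr : 'rV[R]_r -> R).
Variables (f : 'rV[R]_n -> R -> 'rV[R]_p -> 'rV[R]_n) (q : 'rV[R]_n -> R -> 'rV[R]_p -> R).
Hypothesis smooth : smooth_data s yr f q d.+1.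
Variables (P : set 'rV[R]_p) (W : set 'rV[R]_r) (Z : set 'rV[R]_n).
Hypothesis Hss : steady_state_assumption s yr f P W Z.
Variables (phi phic : 'rV[R]_d.+1 -> R).
Hypothesis Himm : immersion_assumption s yr f q P W Z phi.
Local Notation N := (p + (r + n))%N.
Local Notation Q0 := (q0 s yr q).
Local Notation A0 := (steady_state_set s yr f P W Z).
Local Notation tau := (tau s yr f q d.+1).
Local Notation space := (prod_set P W [set: 'rV[R]_n]).
Local Notation start := (prod_set P W Z).
Hypothesis phic_phi : forall x, A0 x -> phic (tau x) = phi (tau x).
Variables (c : 'I_d.+1 -> R) (L kappa : R).
Hypothesis L_gt0 : 0 < L.
Hypothesis phicL : forall x y, `|phic x - phic y| <= L * `|x - y|.
Variables (e : nat) (E : 'M[R]_(d.+1, e)) (K1 : R).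
Local Notation OF := (observer_field c phic kappa).
Hypothesis K1_gt0 : 0 < K1.
Hypothesis coercive : forall x : 'rV[R]_d.+1, sq x <= K1 * sq (x *m E).
Hypothesis contraction : forall x y,
  dot ((x - y) *m E) ((OF x - OF y) *m E) <= - sq ((x - y) *m E).

Local Notation pert := (perturbed s yr f q P W phic c kappa).

Ltac arith := lra_goal L_gt0 K1_gt0.

(** Componentwise squared distance to the set of points (a, tau a, 0) with a in A0, with one base
    point a for the slow components. *)
Definition near_steady (c' : R) (x : 'rV[R]_N) (eta : 'rV[R]_d.+1) (ep : R) :=
  exists a, [/\ A0 a, sq (x - a) <= c', sq ((eta - tau a) *m E) <= c' & ep ^+ 2 <= c'].

Lemma near_steady_le c1 c2 x eta ep : c1 <= c2 ->
  near_steady c1 x eta ep -> near_steady c2 x eta ep.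
Proof.
by move=> c12 [a [Aa h1 h2 h3]]; exists a; split => //; exact: le_trans c12.
Qed.

(** On the graph the first component of tau a is [Q0 a], so the drift of ep vanishes there and its
    square is of the order of the squared distance. This makes the forcing b of [comparison]
    proportional to the distance and yields convergence to zero instead of a small residual
    error. *)
Lemma feedforward_gap (B : R) : exists2 D : R, 0 < D &
  forall x a (eta : 'rV[R]_d.+1), `|x| <= B -> A0 a ->
  (eta 0 0 - Q0 x) ^+ 2 <= D * (sq (x - a) + sq ((eta - tau a) *m E)).
Proof.
have [B' B'0 [_ hA]] := zero_dynamics_bounded smooth Hss.
have [LQ LQ0 hLQ] := lip_Q0 smooth (Num.max B B').
exists (2 * K1 + 2 * LQ ^+ 2) => [|x a eta xB Aa].
  by rewrite ltr_pwDl ?mulr_gt0// mulr_ge0 ?sqr_ge0.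
have -> : eta 0 0 - Q0 x = (eta - tau a) 0 0 - (Q0 x - Q0 a).
  by rewrite /tau !mxE /=; ring.
have h1 := le_trans (coord_sq_le (eta - tau a) 0) (coercive _).
have h2 : (Q0 x - Q0 a) ^+ 2 <= LQ ^+ 2 * sq (x - a).
  apply: (@le_trans _ _ ((LQ * `|x - a|) ^+ 2)).
    rewrite -real_normK ?num_real// lerXn2r ?nnegrE ?mulr_ge0//; apply: hLQ.
      by rewrite le_max xB.
    by rewrite le_max (hA a Aa).1 orbT.
  by rewrite exprMn ler_wpM2l ?sqr_ge0// norm_sq_le.
have := sq_ge0 (x - a); have := sq_ge0 ((eta - tau a) *m E); move: h1 h2.
set X := (eta - tau a) 0 0; set Y := Q0 x - Q0 a; set U := sq (x - a).
set V := sq _; move=> h1 h2 V0 U0.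
have := sqr_ge0 (X + Y); have := mulr_ge0 (ltW K1_gt0) U0; have := mulr_ge0 (sqr_ge0 LQ) V0.
move: h1 h2; arith.
Qed.

(** By [feedforward_gap] the comparison error is of order c' / k, so one gain serves all scales c'.
    Lengths up to [2 * th] are allowed so that a remainder shorter than a window can be merged with
    the window before it. *)
Lemma window_local : exists (th0 C rho : R), [/\ 1 <= th0, 1 <= C, 0 < rho,
    (forall x a, space x -> A0 a -> sq (x - a) <= rho -> start x) &
  forall th, th0 <= th -> exists2 kst : R, 0 < kst & forall k l x eta ep c',
    kst <= k -> 0 <= l -> l <= 2 * th -> pert k l x eta ep ->
    0 < c' -> c' <= rho -> near_steady c' (x 0) (eta 0) (ep 0) ->
    near_steady (C * c') (x l) (eta l) (ep l) /\
    (th0 <= l -> near_steady (c' / 2) (x l) (eta l) (ep l))].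
Proof.
have [C0 [q0 [rho0 [_ _ _ rho00 [near_start _]]]]] := zero_dynamics_exp Hss.
have [C [q1 [rho1 [C_gt0 q10 q11 rho10 hloc]]]] :=
  zero_dynamics_local smooth Hss Himm phic_phi contraction.
have [B B0 hglob] := zero_dynamics_global smooth Hss contraction.
have [D D0 hD] := feedforward_gap B.
pose rho := Num.min rho0 rho1.
have rho_gt0 : 0 < rho by rewrite lt_min rho00.
have eighth : 0 < 8^-1 :> R by rewrite invr_gt0.
(* After time [i0] the zero dynamics has reached squared distance c' / 8. With a comparison error of
   c' / 8, the triangle inequality for squares gives 2/8 + 2/8 = 1/2. *)
have [i0 hi0] := geometric_small (2 * C) (ltW q10) q11 eighth.
pose C6 : R := D * (4 * C).
have C60 : 0 < C6 by rewrite mulr_gt0// mulr_gt0.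
exists (i0%:R + 1), (4 * C + 2), rho; split => //.
- by rewrite lerDr.
- by have := ltW C_gt0; arith.
- by move=> x a spx Aa xa; apply: near_start spx Aa (le_trans xa _); rewrite ge_min lexx.
move=> th thge.
have th0 : 0 <= 2 * th by rewrite mulr_ge0// (le_trans _ thge)// addr_ge0.
have [M M0 hM] := comparison smooth P W L_gt0 phicL K1_gt0 coercive contraction
  (ltW B0) (ltW rho_gt0) th0.
(* The three terms serve the hypothesis of [comparison], its error c' / 8, and exp(- k l) <= 1 / (k
   l) <= 1/4 when l >= 1. *)
exists (M * (1 + rho + C6 * rho) + 8 * (M * (1 + C6)) + 4).
  by rewrite !addr_gt0// !mulr_gt0// !addr_gt0// mulr_gt0.
move=> k l x eta ep c' hk l0 lth hp c'0 c'rho [a [Aa xa etaa epa]].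
have c'rho0 : c' <= rho0 by apply: (le_trans c'rho); rewrite ge_min lexx.
have c'rho1 : c' <= rho1 by apply: (le_trans c'rho); rewrite ge_min lexx orbT.
have [_ sp _] := hp.
have spx := sp 0 (lexx _) l0.
have startx : start (x 0) by apply: near_start spx Aa (le_trans xa c'rho0).
have [x0 [eta0 [z x00 eta00]]] :=
  zero_dynamics_exists smooth Hss c kappa L_gt0 phicL (eta 0) startx.
have x0B t : 0 <= t -> `|x0 t| <= B.
  move=> t0; have [H' _ h] := hglob _ (sq_ge0 (eta0 0 *m E)).
  by case: (h x0 eta0 z _ (lexx _) t t0); rewrite ?x00.
have hz t : 0 <= t -> exists b, [/\ A0 b, sq (x0 t - b) <= 2 * C * q1 ^+ Num.truncn t * c' &
    sq ((eta0 t - tau b) *m E) <= 2 * C * q1 ^+ Num.truncn t * c'].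
  move=> t0; have := hloc x0 eta0 a c' c' z; rewrite x00 eta00.
  move=> /(_ spx Aa c'0 c'rho1 xa etaa (Num.truncn t) t) []; first by rewrite truncn_le.
    by rewrite natr1 ltW// truncnS_gt.
  move=> b [Ab h1 h2]; exists b; split => //.
    have : 0 <= C * q1 ^+ Num.truncn t * c' by rewrite !mulr_ge0 ?exprn_ge0// ltW.
    by move: h1; arith.
  by move: h2; arith.
have q1le i : q1 ^+ i <= 1 by rewrite exprn_ile1// ltW.
have hb t : 0 < t -> t < l -> (eta0 t 0 0 - Q0 (x0 t)) ^+ 2 <= C6 * c'.
  move=> t0 tl; have [b [Ab h1 h2]] := hz t (ltW t0).
  apply: (le_trans (hD _ _ _ (x0B t (ltW t0)) Ab)).
  rewrite /C6 -mulrA ler_wpM2l ?(ltW D0)//.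
  have : 2 * C * q1 ^+ Num.truncn t * c' <= 2 * C * c'.
    by rewrite ler_wpM2r ?(ltW c'0)// ler_piMr// mulr_ge0// ltW.
  by move: h1 h2; arith.
have Mrho : 0 <= M * (1 + rho + C6 * rho).
  by rewrite !(mulr_ge0, addr_ge0)// ltW.
have MC6 : 0 <= M * (1 + C6) by rewrite !(mulr_ge0, addr_ge0)// ltW.
have k4 : 4 <= k by move: hk Mrho MC6; arith.
have k0 : 0 < k by apply: lt_le_trans k4.
have Mk : M * (1 + rho + C6 * c') <= k.
  apply: (@le_trans _ _ (M * (1 + rho + C6 * rho))).
    by rewrite ler_wpM2l ?(ltW M0)// lerD2l ler_wpM2l// ltW.
  by move: hk MC6; arith.
have C6c' : 0 <= C6 * c' by rewrite mulr_ge0// ltW.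
have [h1 h2] := hM k l (C6 * c') x eta ep x0 eta0 l0 lth C6c' hp z x00 eta00
  (fun t t0 _ => x0B t (ltW t0)) hb (le_trans epa c'rho) Mk.
have small : M / k * (ep 0 ^+ 2 + C6 * c') <= c' / 8.
  rewrite mulrAC ler_pdivrMr//.
  apply: (@le_trans _ _ (M * (1 + C6) * c')).
    by rewrite -mulrA ler_wpM2l ?(ltW M0)// mulrDl mul1r lerD2r.
  have : 8 * (M * (1 + C6)) <= k by move: hk Mrho; arith.
  by move=> /(ler_wpM2r (ltW c'0)); arith.
have [b [Ab xb etab]] := hz l l0.
have {}xb := le_trans (sq_sub_mid (x0 l) (x l) b) (lerD (lexx _) (ler_wpM2l (ler0n _ 2) xb)).
have {}etab : sq ((eta l - tau b) *m E) <=
    2 * sq ((eta l - eta0 l) *m E) + 2 * (2 * C * q1 ^+ Num.truncn l * c').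
  apply: (@le_trans _ _ (2 * sq ((eta l - eta0 l) *m E) + 2 * sq ((eta0 l - tau b) *m E))).
    by rewrite !mulmxBl; exact: sq_sub_mid.
  by rewrite lerD2l ler_wpM2l.
have s1 := sq_ge0 (x l - x0 l); have s2 := sq_ge0 ((eta l - eta0 l) *m E).
split.
  exists b; have hq : 2 * C * q1 ^+ Num.truncn l * c' <= 2 * C * c'.
    by rewrite ler_wpM2r ?(ltW c'0)// ler_piMr// mulr_ge0// ltW.
  have Cc : 0 <= C * c' by rewrite mulr_ge0// ltW.
  have he : expR (- (k * l)) * ep 0 ^+ 2 <= c'.
    apply: le_trans epa; rewrite ler_piMl ?sqr_ge0// expR_le1 oppr_le0 mulr_ge0// ltW//.
  split => //.
  - by move: xb hq s2 h1 small c'0; arith.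
  - by move: etab hq s1 h1 small c'0; arith.
  - by move: he h2 small Cc c'0; arith.
move=> lge; exists b.
have l1 : 1 <= l by apply: le_trans lge; rewrite lerDr.
have hq : 2 * C * q1 ^+ Num.truncn l * c' <= 8^-1 * c'.
  rewrite ler_wpM2r ?(ltW c'0)// hi0// truncn_ge_nat//.
  by apply: le_trans lge; rewrite lerDl.
have he : expR (- (k * l)) * ep 0 ^+ 2 <= 4^-1 * c'.
  apply: ler_pM; rewrite ?expR_ge0 ?sqr_ge0//.
  have kl0 : 0 < k * l by rewrite mulr_gt0// (lt_le_trans _ l1).
  apply: (le_trans (expRN_le kl0)); rewrite lef_pV2 ?posrE//.
  by apply: (le_trans k4); rewrite ler_peMr// ltW.
split => //.
- by move: xb hq s2 h1 small c'0; arith.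
- by move: etab hq s1 h1 small c'0; arith.
- by move: he h2 small c'0; arith.
Qed.

Lemma near_steady_bounded : exists2 Bn : R, 0 < Bn & forall c' x eta ep, c' <= 1 ->
  near_steady c' x eta ep -> [/\ `|x| <= Bn, sq (eta *m E) <= Bn & ep ^+ 2 <= Bn].
Proof.
have [B B0 [_ hA]] := zero_dynamics_bounded smooth Hss.
have [Bt Bt0 hBt] := lip_bdd_bounded B (lip_tau smooth).
have [KE KE0 hKE] := sq_mulmx E.
pose C := KE * (d.+1%:R * Bt ^+ 2).
have C0 : 0 <= C by rewrite !mulr_ge0 ?sqr_ge0// ltW.
exists (B + 2 + 2 * C) => [|c' x eta ep c'1 [a [Aa xa etaa epa]]]; first by move: B0 C0; arith.
have [aB _] := hA a Aa.
have tauC : sq (tau a *m E) <= C.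
  apply: (le_trans (hKE _)); rewrite ler_wpM2l ?(ltW KE0)//.
  rewrite (le_trans (sq_le_norm _))// ler_wpM2l// lerXn2r ?nnegrE ?(ltW Bt0)//.
  exact: hBt.
split; last by move: B0 C0 c'1 epa; arith.
  have : `|x - a| <= 1.
    rewrite -ler_sqr ?nnegrE// expr1n (le_trans (norm_sq_le _))//.
    exact: le_trans c'1.
  have := ler_normD (x - a) a; rewrite subrK; move: aB C0; arith.
have := sqD (eta *m E - tau a *m E) (tau a *m E); rewrite subrK.
by move: etaa tauC c'1 B0; rewrite mulmxBl; arith.
Qed.

(** Far from the graph the drift of ep is merely bounded. The error of order 1 / k is nevertheless
    below [dl / 8] for large k, which is enough to reach the region where [window_local] takes
    over. *)
Lemma window_global (H Eb dl : R) : 0 <= H -> 0 <= Eb -> 0 < dl ->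
  exists th0 Cb : R, [/\ 1 <= th0, 0 < Cb & forall th, th0 <= th ->
    exists2 kst : R, 0 < kst & forall k l x eta ep, kst <= k -> 0 <= l -> l <= 2 * th ->
      pert k l x eta ep -> start (x 0) -> sq (eta 0 *m E) <= H -> ep 0 ^+ 2 <= Eb ->
      [/\ `|x l| <= Cb, sq (eta l *m E) <= Cb & ep l ^+ 2 <= Cb] /\
      (th0 <= l -> near_steady dl (x l) (eta l) (ep l))].
Proof.
move=> H0 Eb0 dl0.
have [B B0 hglob] := zero_dynamics_global smooth Hss contraction.
have [H' H'0 hH'] := hglob H H0.
have [BQ BQ0 hBQ] := lip_bdd_bounded B (lip_Q0 smooth).
have dl8 : 0 < dl / 8 by rewrite divr_gt0.
have [thu thu0 hthu] := zero_dynamics_uniform smooth Hss Himm phic_phi contraction H0 dl8.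
pose b := 2 * (K1 * H') + 2 * BQ ^+ 2.
have b0 : 0 <= b by rewrite addr_ge0 ?mulr_ge0 ?sqr_ge0// ltW.
pose sm := Num.min 1 (dl / 8).
have sm0 : 0 < sm by rewrite lt_min ltr01.
exists (thu + 1), (B + 2 * H' + Eb + 3); split.
- by rewrite lerDr.
- by move: B0 H'0 Eb0; arith.
move=> th thge; have th0 : 0 <= 2 * th.
  by rewrite mulr_ge0// (le_trans _ thge)// addr_ge0.
have [M M0 hM] := comparison smooth P W L_gt0 phicL K1_gt0 coercive contraction (ltW B0) Eb0 th0.
have M1 : 0 <= M * (1 + Eb + b) by rewrite !(mulr_ge0, addr_ge0)// ltW.
have M2 : 0 <= M * (Eb + b) / sm by rewrite !(mulr_ge0, addr_ge0)// ?invr_ge0 ltW.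
have M3 : 0 <= 2 * Eb / dl by rewrite divr_ge0 ?mulr_ge0// ltW.
(* The third term gives exp(- k l) Eb <= Eb / k <= dl / 2 for l >= 1; the second one makes the
   comparison error at most [sm]. *)
exists (M * (1 + Eb + b) + M * (Eb + b) / sm + 2 * Eb / dl + 1).
  by rewrite ltr_pwDr// !addr_ge0.
move=> k l x eta ep hk l0 lth hp startx etaH epE.
have k0 : 0 < k by move: hk M1 M2 M3; arith.
have [x0 [eta0 [z x00 eta00]]] :=
  zero_dynamics_exists smooth Hss c kappa L_gt0 phicL (eta 0) startx.
have startx0 : start (x0 0) by rewrite x00.
have etaH0 : sq (eta0 0 *m E) <= H by rewrite eta00.
have hb t : 0 <= t -> (eta0 t 0 0 - Q0 (x0 t)) ^+ 2 <= b.
  move=> t0; have [xB etaB] := hH' x0 eta0 z startx0 etaH0 t t0.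
  have h1 : (eta0 t 0 0) ^+ 2 <= K1 * H'.
    apply: (le_trans (coord_sq_le (eta0 t) 0)); apply: (le_trans (coercive _)).
    by rewrite ler_wpM2l// ltW.
  have h2 : (Q0 (x0 t)) ^+ 2 <= BQ ^+ 2.
    rewrite -real_normK ?num_real// lerXn2r ?nnegrE ?(ltW BQ0)//.
    exact: hBQ.
  have := sqr_ge0 (eta0 t 0 0 + Q0 (x0 t)); move: h1 h2; rewrite /b; arith.
have Mk : M * (1 + Eb + b) <= k by move: hk M2 M3; arith.
have [h1 h2] := hM k l b x eta ep x0 eta0 l0 lth b0 hp z x00 eta00
  (fun t t0 _ => (hH' x0 eta0 z startx0 etaH0 t (ltW t0)).1)
  (fun t t0 _ => hb t (ltW t0)) epE Mk.
have small : M / k * (ep 0 ^+ 2 + b) <= sm.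
  rewrite mulrAC ler_pdivrMr//.
  apply: (@le_trans _ _ (M * (Eb + b))); first by rewrite ler_wpM2l ?(ltW M0)// lerD2r.
  by rewrite [sm * k]mulrC -ler_pdivrMr//; move: hk M1 M3; arith.
have small1 : M / k * (ep 0 ^+ 2 + b) <= 1 by apply: (le_trans small); rewrite ge_min lexx.
have small2 : M / k * (ep 0 ^+ 2 + b) <= dl / 8.
  by apply: (le_trans small); rewrite ge_min lexx orbT.
have s1 := sq_ge0 (x l - x0 l); have s2 := sq_ge0 ((eta l - eta0 l) *m E).
have [xB etaB] := hH' x0 eta0 z startx0 etaH0 l l0.
split.
  split.
  - have : `|x l - x0 l| <= 1.
      rewrite -ler_sqr ?nnegrE// expr1n (le_trans (norm_sq_le _))//.
      by move: h1 small1 s2; arith.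
    by have := ler_normD (x l - x0 l) (x0 l); rewrite subrK; move: xB H'0 Eb0; arith.
  - have := sqD (eta l *m E - eta0 l *m E) (eta0 l *m E); rewrite subrK -mulmxBl.
    by move: h1 small1 s1 etaB B0 Eb0; arith.
  - have : expR (- (k * l)) * ep 0 ^+ 2 <= Eb.
      apply: le_trans epE; rewrite ler_piMl ?sqr_ge0// expR_le1 oppr_le0 mulr_ge0// ltW//.
    by move: h2 small1 B0 H'0; arith.
move=> lge.
have [|a [Aa xa etaa]] := hthu x0 eta0 z startx0 etaH0 l.
  by apply: le_trans lge; rewrite lerDl.
exists a; split => //.
- by apply: (le_trans (sq_sub_mid (x0 l) _ _)); move: h1 small2 s2 xa dl0; arith.
- rewrite mulmxBl (le_trans (sq_sub_mid (eta0 l *m E) _ _))// -!mulmxBl.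
  by move: h1 small2 s1 etaa dl0; arith.
- have : expR (- (k * l)) * ep 0 ^+ 2 <= dl / 2.
    have l1 : 1 <= l by apply: le_trans lge; rewrite lerDr.
    have kl0 : 0 < k * l by rewrite mulr_gt0// (lt_le_trans _ l1).
    apply: (@le_trans _ _ (k^-1 * Eb)).
      apply: ler_pM; rewrite ?expR_ge0 ?sqr_ge0//.
      by apply: (le_trans (expRN_le kl0)); rewrite lef_pV2 ?posrE// ler_peMr// ltW.
    rewrite mulrC ler_pdivrMr// mulrC mulrA ler_pdivlMr// [Eb * 2]mulrC -ler_pdivrMr//.
    by move: hk M1 M2; arith.
  by move: h2 small2 dl0; arith.
Qed.

Lemma sample_interval (H Eb : R) : 0 <= H -> 0 <= Eb ->
  exists (th dl C Cb kst : R), [/\ 0 < th, 0 < dl, dl <= 1, 0 < C & 0 < kst] /\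
  (forall x eta ep, space x -> near_steady (2 * dl) x eta ep -> start x) /\
  forall k l x eta ep, kst <= k -> 0 <= l -> pert k l x eta ep ->
   (start (x 0) -> sq (eta 0 *m E) <= H -> ep 0 ^+ 2 <= Eb ->
      [/\ `|x l| <= Cb, sq (eta l *m E) <= Cb, ep l ^+ 2 <= Cb &
          th <= l -> near_steady dl (x l) (eta l) (ep l)]) /\
   (forall c', 0 < c' -> c' <= 2 * dl -> near_steady c' (x 0) (eta 0) (ep 0) ->
      near_steady (C * c') (x l) (eta l) (ep l) /\
      (th <= l -> near_steady (c' / 2) (x l) (eta l) (ep l))).
Proof.
move=> H0 Eb0.
have [th1 [C [rho [th11 C1 rho0 near_start hloc]]]] := window_local.
have [Bn Bn0 hBn] := near_steady_bounded.
(* A reset may enlarge the squared distance to [2 * dl], which must remain within [rho]. The bound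
   by 1 is the one that [initial_bounds] will ask for. *)
pose dl := Num.min (rho / 2) 1.
have dl0 : 0 < dl by rewrite lt_min ltr01 andbT divr_gt0.
have dl1 : dl <= 1 by rewrite ge_min lexx orbT.
have dlrho : 2 * dl <= rho by rewrite mulrC -ler_pdivlMr// ge_min lexx.
have [th2 [Cb [th21 Cb0 hglob]]] := window_global H0 Eb0 dl0.
pose th := Num.max th1 th2.
have th1th : th1 <= th by rewrite le_max lexx.
have th2th : th2 <= th by rewrite le_max lexx orbT.
have th0 : 0 < th by apply: lt_le_trans th1th; apply: lt_le_trans th11.
have thth : th <= 2 * th by move: th0; arith.
have [k1 k10 hk1] := hloc th th1th; have [k2 k20 hk2] := hglob th th2th.
exists th, dl, C, (Num.max Cb Bn), (Num.max k1 k2); split; last split.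
- by split => //; [exact: lt_le_trans C1|rewrite lt_max k10].
- move=> x eta ep spx [a [Aa xa _ _]]; apply: near_start spx Aa _.
  exact: le_trans dlrho.
(* Induction on the number of windows of length [th]. The last piece is left with a length between
   [th] and [2 * th], since a shorter one would give no halving. *)
have local m : forall k l x eta ep c', k1 <= k -> 0 <= l -> l <= (m%:R + 2) * th ->
    pert k l x eta ep -> 0 < c' -> c' <= 2 * dl -> near_steady c' (x 0) (eta 0) (ep 0) ->
    near_steady (C * c') (x l) (eta l) (ep l) /\
    (th <= l -> near_steady (c' / 2) (x l) (eta l) (ep l)).
  elim: m => [|m IH] k l x eta ep c' k1k l0 lm hp c'0 c'dl nr.
    rewrite add0r in lm.
    have [h1 h2] := hk1 k l x eta ep c' k1k l0 lm hp c'0 (le_trans c'dl dlrho) nr.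
    by split => // thl; apply: h2; exact: le_trans thl.
  have [l2|/ltW l2] := leP l (2 * th).
    have [h1 h2] := hk1 k l x eta ep c' k1k l0 l2 hp c'0 (le_trans c'dl dlrho) nr.
    by split => // thl; apply: h2; exact: le_trans thl.
  have thl : th <= l by move: l2 th0; arith.
  have [_ h1] := hk1 k th x eta ep c' k1k (ltW th0) thth
    (perturbed_restrict thl hp) c'0 (le_trans c'dl dlrho) nr.
  have {}h1 := h1 th1th.
  have hp' := perturbed_shift (ltW th0) hp.
  have [|||||_] := IH k (l - th) _ _ _ (c' / 2) k1k _ _ hp'.
  - by rewrite subr_ge0.
  - by move: lm; rewrite -natr1; arith.
  - by rewrite divr_gt0.
  - by move: c'0 c'dl; arith.
  - by rewrite add0r.
  have thl' : th <= l - th by move: l2; arith.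
  rewrite subrK => /(_ thl') h2.
  split=> [|_]; apply: near_steady_le h2; last by move: c'0; arith.
  have := ler_peMl (ltW c'0) C1; move: c'0; arith.
have many l : exists m : nat, l <= (m%:R + 2) * th.
  exists (Num.truncn `|l / th|).
  rewrite -ler_pdivrMr// (le_trans (ler_norm _))// ltW//.
  by apply: (lt_trans (truncnS_gt _)); rewrite -natr1 ltrD2l ltr1n.
move=> k l x eta ep; rewrite ge_max => /andP[k1k k2k] l0 hp.
split=> [sx etaH epE|c' c'0 c'dl nr]; last first.
  by have [m hm] := many l; exact: local hm hp c'0 c'dl nr.
have [l2|/ltW l2] := leP l (2 * th).
  have [[h1 h2 h3] h4] := hk2 k l x eta ep k2k l0 l2 hp sx etaH epE.
  split; rewrite ?le_max ?h1 ?h2 ?h3// => thl; apply: h4; exact: le_trans thl.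
have thl : th <= l by move: l2 th0; arith.
have [_ h1] := hk2 k th x eta ep k2k (ltW th0) thth
  (perturbed_restrict thl hp) sx etaH epE.
have {}h1 := h1 th2th.
have hp' := perturbed_shift (ltW th0) hp.
have [m hm] := many (l - th).
have [|||_] := local m k (l - th) _ _ _ dl k1k _ hm hp' dl0.
- by rewrite subr_ge0.
- by move: dl0; arith.
- by rewrite add0r.
have thl' : th <= l - th by move: l2; arith.
rewrite subrK => /(_ thl') h2.
have dl21 : dl / 2 <= 1 by move: dl1 dl0; arith.
have [b1 b2 b3] := hBn _ _ _ _ dl21 h2.
split; rewrite ?le_max ?b1 ?b2 ?b3 ?orbT// => _.
by apply: near_steady_le h2; move: dl0; arith.
Qed.

End windows.

(** * Quantizer and decoder *)

Section quantizer.
Variable R : realType.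

Lemma enorm_le m (x : 'rV[R]_m) (b : R) : 0 <= b -> (forall i, `|x 0 i| <= b) ->
  enorm x <= Num.sqrt m%:R * b.
Proof.
move=> b0 xb; rewrite -ler_sqr ?nnegrE ?enorm_ge0 ?mulr_ge0 ?sqrtr_ge0//.
rewrite enorm_sq exprMn sqr_sqrtr// /sq /dot.
apply: (@le_trans _ _ (\sum_(i < m) b ^+ 2)).
  by apply: ler_sum => i _; rewrite -expr2 -real_normK ?num_real// lerXn2r ?nnegrE.
by rewrite sumr_const card_ord mulr_natl.
Qed.

Lemma coord_enorm_le m (x : 'rV[R]_m) i : `|x 0 i| <= enorm x.
Proof.
rewrite -ler_sqr ?nnegrE ?enorm_ge0// enorm_sq real_normK ?num_real//.
exact: coord_sq_le.
Qed.

Lemma round_even_error (a : R) : `|(Num.ceil a)%:~R - 2^-1 - a| <= 2^-1.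
Proof.
by rewrite ler_norml; have := ceil_ge a; have := ceilB1_lt a; rewrite intrB; lra.
Qed.

Lemma round_odd_error (a : R) : `|(Num.ceil (a - 2^-1))%:~R - a| <= 2^-1.
Proof.
rewrite ler_norml; have := ceil_ge (a - 2^-1); have := ceilB1_lt (a - 2^-1).
by rewrite intrB; lra.
Qed.

Lemma quantize_error r N (l : R) (w wd : 'rV[R]_r) i : (0 < N)%N -> 0 <= l ->
  (forall j, `|w 0 j - wd 0 j| <= l) ->
  `|(wd + (l / N%:R) *: quantize N l w wd - w) 0 i| <= l / (2 * N%:R).
Proof.
move=> N0 l0 wl; have NR : 0 < N%:R :> R by rewrite ltr0n.
have b0 : 0 <= l / (2 * N%:R) by rewrite divr_ge0// mulr_ge0.
set dl := w 0 i - wd 0 i.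
rewrite !mxE/= -/dl; set a := N%:R * `|dl| / l.
set ca := (if odd N then _ else _).
have -> : wd 0 i + l / N%:R * (Num.sg dl * ca) - w 0 i = l / N%:R * (Num.sg dl * ca) - dl.
  by rewrite /dl; ring.
have [dl0|dl_neq0] := eqVneq dl 0; first by rewrite dl0 sgr0 mul0r mulr0 subrr normr0.
(* A nonzero difference within the range forces l > 0, so the quotient defining [a] is a true
   one. *)
have l_gt0 : 0 < l by apply: lt_le_trans (wl i); rewrite normr_gt0.
have err : `|ca - a| <= 2^-1.
  by rewrite /ca; case: odd; [exact: round_odd_error|exact: round_even_error].
have -> : l / N%:R * (Num.sg dl * ca) - dl = Num.sg dl * (l / N%:R * (ca - a)).
  rewrite {2}[dl]numEsg /a; field.
  by rewrite !gt_eqF.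
rewrite normrM normr_sg dl_neq0 mul1r normrM ger0_norm ?divr_ge0//.
have -> : l / (2 * N%:R) = l / N%:R * 2^-1 by field; rewrite gt_eqF.
by rewrite ler_wpM2l// divr_ge0.
Qed.

Lemma initial_range_ge r (W0 : set 'rV[R]_r) x y i : compact W0 -> W0 x -> W0 y ->
  `|x 0 i - y 0 i| <= initial_range W0.
Proof.
move=> cW Wx Wy; have [B B0 hB] := compact_norm_le cW.
apply: ub_le_sup; last by exists x, y, i.
exists (2 * B) => _ [u [v [j [Wu Wv ->]]]].
have := le_trans (coord_norm_le u j) (hB u Wu); have := le_trans (coord_norm_le v j) (hB v Wv).
by have := ler_normB (u 0 j) (v 0 j); lra.
Qed.

Lemma quantization_rangeE r (W0 : set 'rV[R]_r) N (M : R -> R) (T : R) j :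
  quantization_range W0 N M T j =
  (Num.sqrt r%:R * (M T / N%:R)) ^+ j * initial_range W0.
Proof. by elim: j => [|j IH] /=; rewrite ?expr0 ?mul1r// IH exprS mulrA. Qed.

(** When W0 is empty or r = 0 the supremum is over the empty set and equals 0. *)
Lemma initial_range_ge0 r (W0 : set 'rV[R]_r) : compact W0 -> 0 <= initial_range W0.
Proof.
move=> cW; have [[z [x [y [i [Wx Wy zE]]]]]|no] := pselect (exists z, [set l |
   exists x y (i : 'I_r), [/\ W0 x, W0 y & l = `|x 0 i - y 0 i|]] z).
  by apply: le_trans (initial_range_ge i cW Wx Wy); exact: normr_ge0.
rewrite /initial_range [X in sup X](_ : _ = set0) ?sup0//.
by apply/seteqP; split => // z hz; apply: no; exists z.
Qed.

Lemma is_derive_continuous (V : normedModType R) (x : R -> V) (t : R) dx :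
  is_derive t 1 x dx -> {for t, continuous x}.
Proof.
by move=> [D _]; apply: differentiable_continuous; apply/derivable1_diffP.
Qed.

Lemma invariant_solution m (F : 'rV[R]_m -> 'rV[R]_m) (S : set 'rV[R]_m) x0 :
  invariant_set F S -> S x0 -> exists x : R -> 'rV[R]_m,
    [/\ x 0 = x0, forall t, S (x t), forall t : R, is_derive t 1 x (F (x t)) &
        solution F +oo%E x].
Proof.
move=> inv /inv[x [x0E hx]]; exists x; split => // [t|t|]; try by case: (hx t).
split=> [|t _ _]; last by case: (hx t).
by apply: continuous_subspaceT => t; case: (hx t) => /is_derive_continuous.
Qed.

End quantizer.

Section sampling.
Variables (R : realType) (p r n d N : nat).
Variables (s : 'rV[R]_r -> 'rV[R]_r) (yr : 'rV[R]_r -> R).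
Variables (f : 'rV[R]_n -> R -> 'rV[R]_p -> 'rV[R]_n) (q : 'rV[R]_n -> R -> 'rV[R]_p -> R).
Variables (W0 W : set 'rV[R]_r) (M : R -> R) (T : R).
Variables (phic : 'rV[R]_d -> R) (c : 'I_d -> R) (kappa k : R).
Variables (mu : 'rV[R]_p) (b : \bar R) (X : trajectory R r n d).
Hypothesis lip_s : lip_bdd s.
Hypothesis HW0 : compact W0 /\ invariant_set s W0.
Hypothesis HN : (0 < N)%N.
Hypothesis HW : [/\ compact W, W0 `<=` W, invariant_set s W &
  forall w, ~ W w -> Num.sqrt r%:R * (initial_range W0 / (2 * N%:R)) < edist W0 w].
Hypothesis HM : [/\ M 0 = 1, forall t, 0 <= t -> 0 < M t &
  forall t t', 0 <= t -> t <= t' -> M t <= M t'].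
Hypothesis HMW : forall w1 w2 : R -> 'rV[R]_r,
  solution s +oo%E w1 -> solution s +oo%E w2 -> W (w1 0) -> W (w2 0) ->
  forall t, 0 <= t -> enorm (w1 t - w2 t) <= M t * enorm (w1 0 - w2 0).
Hypothesis T_gt0 : 0 < T.
Hypothesis rate : Num.sqrt r%:R * M T < N%:R.
Hypothesis cl : closed_loop s yr f q W0 N M T phic c kappa k mu b X.
Hypothesis W0w : W0 (tr_w X 0).
Hypothesis W0wd : W0 (tr_wdm X 0%N).
Local Notation range := (quantization_range W0 N M T).

Lemma range_ratio : 0 <= Num.sqrt r%:R * (M T / N%:R) < 1.
Proof.
have NR : 0 < N%:R :> R by rewrite ltr0n.
have [_ hM _] := HM; have MT := hM T (ltW T_gt0).
by rewrite mulr_ge0 ?sqrtr_ge0 ?divr_ge0 ?(ltW MT)//= mulrA ltr_pdivrMr ?mul1r.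
Qed.

Lemma range_ge0 j : 0 <= range j.
Proof.
have /andP[r0 _] := range_ratio.
by rewrite quantization_rangeE mulr_ge0 ?exprn_ge0// initial_range_ge0//; case: HW0.
Qed.

Lemma range_le j : range j <= initial_range W0.
Proof.
have /andP[r0 r1] := range_ratio.
rewrite quantization_rangeE ler_piMl ?exprn_ile1 ?(ltW r1)//.
by rewrite initial_range_ge0//; case: HW0.
Qed.

Lemma exosystem_in_W0 t : 0 <= t -> (t%:E < b)%E -> W0 (tr_w X t).
Proof.
move=> t0 tb; have [_ inv] := HW0.
have [w [w0 Ww _ sw]] := invariant_solution inv W0w.
rewrite (ode_unique lip_s t0 (solution_ode_on (cl_w cl) (lexx 0) tb)
  (solution_ode_on sw (lexx 0) (ltry t)) (esym w0)).
exact: Ww.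
Qed.

Lemma decoder_ode_on j t : j%:R * T < t -> t < j.+1%:R * T -> (t%:E < b)%E ->
  ode_on s (tr_wd X) (j%:R * T) t.
Proof.
move=> jt tj tb.
have D u : j%:R * T < u -> u < j.+1%:R * T -> (u%:E < b)%E ->
  is_derive u 1 (tr_wd X) (s (tr_wd X u)) by exact: (cl_wd cl).
have ub u : u <= t -> (u%:E < b)%E.
  by move=> ut; apply: le_lt_trans tb; rewrite lee_fin.
split=> [|u ju ut]; last by apply: D => //; [exact: lt_trans tj|exact: ub (ltW ut)].
apply/continuous_within_itvP => //; split.
- move=> u; rewrite in_itv/= => /andP[ju ut].
  by apply: is_derive_continuous (D u ju (lt_trans ut tj) (ub u (ltW ut))).
- by apply: (cl_wd_right cl); exact: ub (ltW jt).
- by apply: cvg_at_left_filter; apply: is_derive_continuous (D t jt tj tb).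
Qed.

Lemma decoder_interval j (g : R -> 'rV[R]_r) :
  (forall t : R, is_derive t 1 g (s (g t))) -> g 0 = tr_wd X (j%:R * T) ->
  forall t, j%:R * T <= t -> t < j.+1%:R * T -> (t%:E < b)%E ->
  tr_wd X t = g (t - j%:R * T).
Proof.
move=> Dg g0 t; rewrite le_eqVlt => /predU1P[<- _ _|jt tj tb]; first by rewrite subrr g0.
apply: (@ode_unique R r s (tr_wd X) (fun t => g (t - j%:R * T)) (j%:R * T) t lip_s (ltW jt)).
- exact: decoder_ode_on.
- split=> [|u _ _]; last exact: is_derive_translate.
  by apply: continuous_subspaceT => u; apply: is_derive_continuous; exact: is_derive_translate.
- by rewrite subrr g0.
Qed.

Lemma sampling_step j : j.+1%:R * T - j%:R * T = T.
Proof. by rewrite -natr1; ring. Qed.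

Lemma decoder_left_limit j (g : R -> 'rV[R]_r) : ((j.+1%:R * T)%:E < b)%E ->
  (forall t : R, is_derive t 1 g (s (g t))) -> g 0 = tr_wd X (j%:R * T) ->
  tr_wdm X j.+1 = g T.
Proof.
move=> jb Dg g0.
have jT : j%:R * T < j.+1%:R * T by rewrite ltr_pM2r// ltr_nat.
have l1 := cl_wd_left cl (ltn0Sn j) jb.
have l2 : tr_wd X t @[t --> (j.+1%:R * T)^'-] --> g T.
  have cg : {for (j.+1%:R * T), continuous (fun t => g (t - j%:R * T))}.
    by apply: is_derive_continuous; exact: is_derive_translate.
  have := cvg_at_left_filter cg.
  rewrite sampling_step; apply: cvg_trans; apply: near_eq_cvg.
  near=> t.
  have jt : j%:R * T < t by near: t; exact: nbhs_left_gt.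
  have tj : t < j.+1%:R * T by near: t; exact: nbhs_left_lt.
  rewrite (decoder_interval Dg g0) ?ltW//.
  by apply: lt_trans jb; rewrite lte_fin.
exact: (cvg_unique (@norm_hausdorff _ _) l1 l2).
Unshelve. all: by end_near. Qed.

(** After the reset, w_d is within sqrt r L(j) / (2 N) of w, a point of W0. Since L(j) <= L_0, the
    contrapositive of (A1) puts w_d in W. *)
Lemma decoder_reset j : ((j%:R * T)%:E < b)%E ->
  (forall i, `|tr_w X (j%:R * T) 0 i - tr_wdm X j 0 i| <= range j) ->
  [/\ enorm (tr_wd X (j%:R * T) - tr_w X (j%:R * T)) <= Num.sqrt r%:R * (range j / (2 * N%:R)),
      W (tr_wd X (j%:R * T)) &
      `|tr_wd X (j%:R * T) - tr_wdm X j| <= 2 * range j].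
Proof.
move=> jb hw; have r0 := range_ge0 j; have NR : 1 <= N%:R :> R by rewrite ler1n.
have b0 : 0 <= range j / (2 * N%:R) by rewrite divr_ge0// mulr_ge0.
have err i : `|(tr_wd X (j%:R * T) - tr_w X (j%:R * T)) 0 i| <= range j / (2 * N%:R).
  by rewrite (cl_wd_reset cl jb)/=; exact: quantize_error.
have en := enorm_le b0 err.
have j0 : 0 <= j%:R * T by rewrite mulr_ge0// ltW.
split => //.
- have [_ _ _ hW] := HW; apply: contrapT => /hW.
  rewrite ltNge => /negP; apply.
  apply: (le_trans (edist_le _ (exosystem_in_W0 j0 jb))); apply: (le_trans en).
  rewrite ler_wpM2l ?sqrtr_ge0// ler_wpM2r ?range_le// invr_ge0 mulr_ge0//.
- apply: norm_le_coord => [|i]; first by rewrite mulr_ge0.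
  have h1 : range j / (2 * N%:R) <= range j.
    by rewrite ler_pdivrMr ?mulr_gt0 ?(lt_le_trans _ NR)// ler_peMr//; lra.
  have := hw i; have := err i; rewrite !mxE.
  set x1 := tr_wd X _ 0 i; set x2 := tr_w X _ 0 i; set x3 := tr_wdm X j 0 i => e1 e2.
  have -> : x1 - x3 = (x1 - x2) + (x2 - x3) by ring.
  by apply: (le_trans (ler_normD _ _)); lra.
Qed.

(** The error after a reset is amplified by at most M(T), and M(T) sqrt r L(j) / (2 N) is exactly
    L(j + 1) / 2. The flow [g] stands for w_d because w_d has already jumped at the right end of the
    interval. *)
Lemma decoder_close j (g : R -> 'rV[R]_r) : ((j%:R * T)%:E < b)%E ->
  solution s +oo%E g -> g 0 = tr_wd X (j%:R * T) ->
  (forall i, `|tr_w X (j%:R * T) 0 i - tr_wdm X j 0 i| <= range j) ->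
  forall t, j%:R * T <= t -> t <= j.+1%:R * T -> (t%:E < b)%E ->
  enorm (tr_w X t - g (t - j%:R * T)) <= range j.+1 / 2.
Proof.
move=> jb sg g0 hw t jt tj tb.
have [en Wwd _] := decoder_reset jb hw.
have j0 : 0 <= j%:R * T by rewrite mulr_ge0// ltW.
have W0j := exosystem_in_W0 j0 jb.
have [w [w0 Ww Dw sw]] := invariant_solution HW0.2 W0j.
have [_ W0W _ _] := HW; have [_ hM0 hM] := HM.
have u0 : 0 <= t - j%:R * T by rewrite subr_ge0.
have uT : t - j%:R * T <= T.
  by move: tj; rewrite -natr1 mulrDl mul1r lerBlDl.
have wE : tr_w X t = w (t - j%:R * T).
  apply: (@ode_unique R r s (tr_w X) (fun t => w (t - j%:R * T)) (j%:R * T) t lip_s jt).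
  - exact: solution_ode_on (cl_w cl) j0 tb.
  - split=> [|u _ _]; last exact: is_derive_translate.
    by apply: continuous_subspaceT => u; apply: is_derive_continuous; exact: is_derive_translate.
  - by rewrite subrr w0.
rewrite wE.
have W1 : W (w 0) by rewrite w0; exact: W0W.
have W2 : W (g 0) by rewrite g0.
apply: (le_trans (HMW sw sg W1 W2 u0)); rewrite w0 g0.
have -> : enorm (tr_w X (j%:R * T) - tr_wd X (j%:R * T)) =
    enorm (tr_wd X (j%:R * T) - tr_w X (j%:R * T)).
  by rewrite /enorm; congr Num.sqrt; apply: eq_bigr => i _; rewrite !mxE; ring.
apply: (@le_trans _ _ (M T * (Num.sqrt r%:R * (range j / (2 * N%:R))))).
  apply: ler_pM => //; rewrite ?enorm_ge0 ?(ltW (hM0 _ u0))//.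
  exact: hM.
rewrite [range j.+1]/= le_eqVlt; apply/orP; left; apply/eqP; field.
by rewrite gt_eqF// ltr0n.
Qed.

Lemma decoder_invariant j : ((j%:R * T)%:E < b)%E ->
  W (tr_wdm X j) /\
  forall i, `|tr_w X (j%:R * T) 0 i - tr_wdm X j 0 i| <= range j.
Proof.
have [_ W0W Winv _] := HW.
elim: j => [_|j IH jb].
  split; first exact: W0W.
  by move=> i; rewrite mul0r; apply: initial_range_ge => //; case: HW0.
have jT : j%:R * T < j.+1%:R * T by rewrite ltr_pM2r// ltr_nat.
have jb' : ((j%:R * T)%:E < b)%E by apply: lt_trans jb; rewrite lte_fin.
have [_ hw] := IH jb'; have [_ Wwd _] := decoder_reset jb' hw.
have [g [g0 Wg Dg sg]] := invariant_solution Winv Wwd.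
have gT := decoder_left_limit jb Dg g0; split; first by rewrite gT.
move=> i; have := decoder_close jb' sg g0 hw (ltW jT) (lexx _) jb.
rewrite sampling_step -gT.
move=> /(le_trans (coord_enorm_le _ i)); rewrite !mxE => /le_trans; apply.
by rewrite ler_pdivrMr// ler_peMr ?range_ge0// ler1n.
Qed.

End sampling.

(** * Closed loop and resets *)

Section loop.
Variables (R : realType) (p r n d : nat).
Variables (s : 'rV[R]_r -> 'rV[R]_r) (yr : 'rV[R]_r -> R).
Variables (f : 'rV[R]_n -> R -> 'rV[R]_p -> 'rV[R]_n) (q : 'rV[R]_n -> R -> 'rV[R]_p -> R).
Hypothesis smooth : smooth_data s yr f q d.+1.
Variables (P : set 'rV[R]_p) (W : set 'rV[R]_r) (Z : set 'rV[R]_n).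
Hypothesis Hss : steady_state_assumption s yr f P W Z.
Variable phic : 'rV[R]_d.+1 -> R.
Local Notation N := (p + (r + n))%N.
Local Notation PF := (perturbed_field s yr f).
Local Notation FF := (feedforward s yr q).
Local Notation tau := (tau s yr f q d.+1).
Variables (c : 'I_d.+1 -> R) (kappa : R).
Variables (e : nat) (E : 'M[R]_(d.+1, e)).
Local Notation G := (gainG c kappa).

Local Notation pert := (perturbed s yr f q P W phic c kappa).
Local Notation near_steady := (near_steady s yr f q P W Z E).

Hypothesis compactW : compact W.

Definition loop_state (mu : 'rV[R]_p) (w : 'rV[R]_r) (z : 'rV[R]_n) : 'rV[R]_N :=
  row_mx mu (row_mx w z).

Definition observer_state (w : 'rV[R]_r) (y : R) (xi : 'rV[R]_d.+1) : 'rV[R]_d.+1 :=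
  xi - (y - yr w) *: G.

Lemma observer_stateK w y xi : observer_state w y xi + (y - yr w) *: G = xi.
Proof. by rewrite /observer_state subrK. Qed.

Lemma mu_of_loop mu w z : mu_of (loop_state mu w z) = mu.
Proof. by rewrite /mu_of row_mxKl. Qed.

Lemma w_of_loop mu w z : w_of (loop_state mu w z) = w.
Proof. by rewrite /w_of row_mxKr row_mxKl. Qed.

Lemma z_of_loop mu w z : z_of (loop_state mu w z) = z.
Proof. by rewrite /z_of !row_mxKr. Qed.

Definition loop_ofE := (mu_of_loop, w_of_loop, z_of_loop).

Lemma feedforward_loop mu w z y :
  FF (loop_state mu w z, y - yr w) = 'D_(s w) yr w - q z y mu.
Proof. by rewrite /feedforward !loop_ofE/= [yr w + _]addrC subrK. Qed.

Lemma perturbed_field_loop mu w z y :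
  PF (loop_state mu w z, y - yr w) = row_mx 0 (row_mx (s w) (f z y mu)).
Proof. by rewrite /perturbed_field !loop_ofE/= [yr w + _]addrC subrK. Qed.

Lemma within_row_mx m1 m2 (x : R -> 'rV[R]_m1) (y : R -> 'rV[R]_m2) (A : set R) :
  {within A, continuous x} -> {within A, continuous y} ->
  {within A, continuous (fun t => row_mx (x t) (y t))}.
Proof.
move=> cx cy.
have cr : continuous (fun u : 'rV[R]_m1 * 'rV[R]_m2 => row_mx u.1 u.2).
  apply: lip_bdd_continuous; apply: lip_bdd_row_mx; [exact: lip_bdd_fst|exact: lip_bdd_snd].
move=> t; apply: (continuous_comp (f := fun t : subspace A => (x t, y t)) _ (cr _)).
exact: (cvg_pair (cx t) (cy t)).
Qed.

Lemma within_horizon (V : topologicalType) (x : R -> V) (B : \bar R) (a b : R) :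
  {within horizon B, continuous x} -> 0 <= a -> (b%:E < B)%E ->
  {within `[a, b], continuous x}.
Proof.
move=> cx a0 bB; apply: continuous_subspaceW cx => t /=; rewrite in_itv/= => /andP[h1 h2].
by split; [exact: le_trans h1|apply: le_lt_trans bB; rewrite lee_fin].
Qed.

Lemma is_derive_conv (V : normedModType R) (x : R -> V) (t : R) dx dx' :
  is_derive t 1 x dx -> dx = dx' -> is_derive t 1 x dx'.
Proof. by move=> D <-. Qed.

Lemma is_derive_scale m (u : R -> R) (v : 'rV[R]_m) (t : R) du :
  is_derive t 1 u du -> is_derive t 1 (fun t => u t *: v) (du *: v).
Proof.
move=> D; apply: is_derive_mx => i j.
rewrite (_ : (fun _ => _) = (fun t => u t * v i j)); last first.
  by apply/funext => w; rewrite mxE.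
by apply: is_derive_eq; rewrite scaler0 add0r mxE /GRing.scale/= mulrC.
Qed.

Lemma outGammaE (xi : 'rV[R]_d.+1) : \sum_(i < d.+1) outGamma R d.+1 0 i * xi 0 i = xi 0 0.
Proof.
rewrite (bigD1 ord0)//= mxE eqxx mul1r big1 ?addr0// => i i0.
by rewrite mxE (negPf (_ : i != 0%N :> nat)) ?mul0r.
Qed.

Lemma no_sampling_between (T : R) j (t : R) : 0 < T ->
  j%:R * T < t -> t < j.+1%:R * T -> forall i : nat, t != i%:R * T.
Proof.
move=> T0 jt tj i; apply/eqP => tE; move: jt tj.
by rewrite tE !ltr_pM2r// !ltr_nat ltnS => ji; rewrite leqNgt ji.
Qed.

Section trajectories.
Variables (Nq : nat) (W0 : set 'rV[R]_r) (M : R -> R) (T k : R).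
Variables (mu : 'rV[R]_p) (b : \bar R) (X : trajectory R r n d.+1).
Hypothesis T_gt0 : 0 < T.
Hypothesis Pmu : P mu.
Hypothesis cl : closed_loop s yr f q W0 Nq M T phic c kappa k mu b X.

(** The exosystem solution [g] prolongs w_d smoothly up to and including the next sampling time,
    where [tr_wd] already has its reset value; the estimates can then be read at the left limit. *)
Lemma closed_loop_perturbed j (g : R -> 'rV[R]_r) l : 0 <= l -> l <= T ->
  ((j%:R * T + l)%:E < b)%E ->
  (forall t, W (g t)) -> (forall t : R, is_derive t 1 g (s (g t))) ->
  (forall t, j%:R * T <= t -> t < j.+1%:R * T -> (t%:E < b)%E ->
     tr_wd X t = g (t - j%:R * T)) ->
  pert k l (fun t => loop_state mu (g t) (tr_z X (t + j%:R * T)))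
    (fun t => observer_state (g t) (tr_y X (t + j%:R * T)) (tr_xi X (t + j%:R * T)))
    (fun t => tr_y X (t + j%:R * T) - yr (g t)).
Proof.
move=> l0 lT jlb Wg Dg wdg; set a := j%:R * T.
have a0 : 0 <= a by rewrite mulr_ge0// ltW.
have [cz cy cxi] := cl_cont cl.
have shift (V : topologicalType) (x : R -> V) : {within horizon b, continuous x} ->
    {within `[0, l], continuous (fun t => x (t + a))}.
  move=> cx; apply: within_shift; apply: within_horizon cx _ _; first by rewrite add0r.
  by rewrite addrC.
have cg : continuous g by move=> t; apply: is_derive_continuous (Dg t).
have cyg : {within `[0, l], continuous (fun t => yr (g t))}.
  apply: continuous_subspaceT => t; apply: continuous_comp; first exact: cg.
  exact: (lip_bdd_continuous (lip_yr smooth)).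
have cep : {within `[0, l], continuous (fun t => tr_y X (t + a) - yr (g t))}.
  by move=> t; apply: cvgB; [exact: shift|exact: cyg].
split.
- split => //.
  + apply: within_row_mx; first by apply: continuous_subspaceT => t; exact: cvg_cst.
    by apply: within_row_mx; [exact: continuous_subspaceT|exact: shift].
  + move=> t; apply: cvgB; first exact: shift.
    by apply: cvgZ; [exact: cep|exact: cvg_cst].
- by move=> t _ _; split; rewrite loop_ofE.
move=> t t0 tl.
have tb : ((t + a)%:E < b)%E by apply: lt_trans jlb; rewrite lte_fin addrC ltrD2l.
have at_ : a < t + a by rewrite ltrDr.
have ta : t + a < j.+1%:R * T.
  by rewrite -natr1 mulrDl mul1r addrC ltrD2l; exact: lt_le_trans lT.
have ta0 : 0 < t + a by rewrite ltr_pwDl.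
have := cl_plant cl ta0 tb (no_sampling_between T_gt0 at_ ta).
rewrite wdg ?ltW// addrK; move=> [Dz Dy Dxi].
have Dz' := is_derive_translate Dz; have Dy' := is_derive_translate Dy.
have Dxi' := is_derive_translate Dxi.
have Dyr := is_derive_chain (Dg t) (differentiable_yr smooth (g t)).
have Dep : is_derive t 1 (fun t => tr_y X (t + a) - yr (g t))
    ((observer_state (g t) (tr_y X (t + a)) (tr_xi X (t + a))
        + (tr_y X (t + a) - yr (g t)) *: G) 0 0
     - FF (loop_state mu (g t) (tr_z X (t + a)), tr_y X (t + a) - yr (g t))
     - k * (tr_y X (t + a) - yr (g t))).
  apply: is_derive_conv (is_deriveB Dy' Dyr) _.
  by rewrite observer_stateK feedforward_loop outGammaE; ring.
split => //.
- apply: is_derive_conv (is_derive_row_mx (is_derive_cst _ _ _) (is_derive_row_mx (Dg t) Dz')) _.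
  by rewrite perturbed_field_loop.
- apply: is_derive_conv (is_deriveB Dxi' (is_derive_scale G Dep)) _.
  rewrite observer_stateK /observer_field.
  (* Here k disappears: the term - v G of the derivative of xi is cancelled by the same term in G
     times the derivative of ep. *)
  have vec m (A v1 : 'rV[R]_m) (v x0 F1 : R) :
      A - v *: v1 - (x0 - F1 - v) *: v1 = A - x0 *: v1 + F1 *: v1.
    by apply/rowP => i; rewrite !mxE; ring.
  exact: vec.
Qed.

End trajectories.

(** z, y and xi do not jump, so the same base point a can be kept and the changes of x, eta and ep
    are Lipschitz in the jump of w_d. The weight 1/4 in Young's inequality keeps the factor on c'
    below 2, as the halving that follows requires. *)
Lemma near_steady_jump : exists2 C : R, 0 < C & forall c' J mu w w' z y xi, W w -> W w' ->
  `|w' - w| <= J -> near_steady c' (loop_state mu w z) (observer_state w y xi) (y - yr w) ->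
  near_steady (5 / 4 * c' + C * J ^+ 2) (loop_state mu w' z) (observer_state w' y xi) (y - yr w').
Proof.
have [B B0 hB] := compact_norm_le compactW.
have [Ly Ly0 hLy] := lip_yr smooth B.
have quarter : 0 < 4^-1 :> R by rewrite invr_gt0.
exists (5 * (r%:R + Ly ^+ 2 + Ly ^+ 2 * sq (G *m E)) + 1)
  => [|c' J mu w w' z y xi Ww Ww' ww' [a [Aa xa etaa epa]]].
  by rewrite ltr_pwDr// mulr_ge0// !addr_ge0 ?mulr_ge0 ?sqr_ge0 ?sq_ge0.
have dJ : `|w' - w| ^+ 2 <= J ^+ 2.
  by rewrite lerXn2r ?nnegrE// (le_trans _ ww').
have J0 : 0 <= J ^+ 2 := sqr_ge0 J.
have dy : (yr w - yr w') ^+ 2 <= Ly ^+ 2 * J ^+ 2.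
  rewrite -exprMn -real_normK ?num_real// lerXn2r ?nnegrE ?mulr_ge0 ?(le_trans _ ww')//.
  apply: (le_trans (hLy _ _ (hB _ Ww) (hB _ Ww'))); rewrite ler_wpM2l//.
  by rewrite distrC.
have J1 : 0 <= r%:R * J ^+ 2 by rewrite mulr_ge0.
have J2 : 0 <= Ly ^+ 2 * J ^+ 2 by rewrite mulr_ge0 ?sqr_ge0.
have J3 : 0 <= Ly ^+ 2 * J ^+ 2 * sq (G *m E) by rewrite mulr_ge0 ?sq_ge0.
exists a; split => //.
- have -> : loop_state mu w' z - a = (loop_state mu w z - a) + row_mx 0 (row_mx (w' - w) 0).
    rewrite [RHS]addrAC; congr (_ - _).
    by rewrite /loop_state !add_row_mx !addr0 [w + _]addrC subrK.
  apply: (le_trans (sqD_amgm _ _ quarter)); rewrite invrK !sq_row_mx !sq0 add0r addr0.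
  have : sq (w' - w) <= r%:R * J ^+ 2.
    by apply: (le_trans (sq_le_norm _)); rewrite ler_wpM2l.
  by move: xa J0 J2 J3; lra.
- have -> : (observer_state w' y xi - tau a) *m E =
      (observer_state w y xi - tau a) *m E + (- (yr w - yr w') *: (G *m E)).
    rewrite scalemxAl -mulmxDl; congr (_ *m _); rewrite /observer_state.
    have vec m (x g t : 'rV[R]_m) (u v : R) :
        x - (y - v) *: g - t = x - (y - u) *: g - t + - (u - v) *: g.
      by apply/rowP => i; rewrite !mxE; ring.
    exact: vec.
  apply: (le_trans (sqD_amgm _ _ quarter)); rewrite invrK sqZ sqrrN.
  have := ler_wpM2r (sq_ge0 (G *m E)) dy.
  by move: etaa J0 J1 J2; lra.
- have := sqr_ge0 ((y - yr w) / 2 - 2 * (yr w - yr w')).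
  by move: epa dy J0 J1 J3; lra.
Qed.

(** One pair of bounds for the state after the first reset and after every later one. It has to
    precede the choice of [dl], which depends on it; hence the condition c' <= 1 in place of c' <=
    dl. *)
Lemma initial_bounds (Y : set R) (Xi : set 'rV[R]_d.+1) : compact Y -> compact Xi ->
  exists H Eb : R, [/\ 0 <= H, 0 <= Eb,
  forall w y xi, W w -> Y y -> Xi xi ->
    sq (observer_state w y xi *m E) <= H /\ (y - yr w) ^+ 2 <= Eb &
  forall c' mu w w' z y xi, W w -> W w' -> c' <= 1 ->
    near_steady c' (loop_state mu w z) (observer_state w y xi) (y - yr w) ->
    sq (observer_state w' y xi *m E) <= H /\ (y - yr w') ^+ 2 <= Eb].
Proof.
move=> cY cXi; have [B B0 hB] := compact_norm_le compactW.
have [BY BY0 hBY] := compact_norm_le cY; have [BX BX0 hBX] := compact_norm_le cXi.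
have [By By0 hBy] := lip_bdd_bounded B (lip_yr smooth).
have [Bn Bn0 hBn] := near_steady_bounded smooth Hss E.
have [KE KE0 hKE] := sq_mulmx E.
pose e1 := (BY + By) ^+ 2; pose e2 := 2 * Bn + 2 * (2 * By) ^+ 2.
pose h1 := 2 * (KE * (d.+1%:R * BX ^+ 2)) + 2 * (e1 * sq (G *m E)).
pose h2 := 2 * Bn + 2 * ((2 * By) ^+ 2 * sq (G *m E)).
have e10 : 0 <= e1 by exact: sqr_ge0.
have e20 : 0 <= e2 by rewrite addr_ge0// mulr_ge0 ?sqr_ge0// ltW.
have h10 : 0 <= h1.
  apply: addr_ge0; apply: mulr_ge0 => //; apply: mulr_ge0; rewrite ?sq_ge0 ?(ltW KE0)//.
  by rewrite mulr_ge0 ?sqr_ge0.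
have h20 : 0 <= h2 by rewrite addr_ge0// !mulr_ge0 ?sqr_ge0 ?sq_ge0// ltW.
have sqE w y xi : sq (observer_state w y xi *m E) <=
    2 * sq (xi *m E) + 2 * ((y - yr w) ^+ 2 * sq (G *m E)).
  rewrite /observer_state mulmxBl -scalemxAl; apply: (le_trans (sqD _ _)).
  by rewrite sqN sqZ.
have hh0 := addr_ge0 h10 h20; have ee0 := addr_ge0 e10 e20.
exists (h1 + h2), (e1 + e2); split => //.
- move=> w y xi Ww Yy Xxi.
  have ep1 : (y - yr w) ^+ 2 <= e1.
    rewrite -real_normK ?num_real// lerXn2r ?nnegrE ?addr_ge0 ?(ltW BY0) ?(ltW By0)//.
    by rewrite (le_trans (ler_normB _ _))// lerD ?hBY ?hBy ?hB.
  split; last by rewrite (le_trans ep1)// lerDl.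
  apply: (le_trans (sqE _ _ _)); apply: (@le_trans _ _ h1); last by rewrite lerDl.
  rewrite lerD// ler_wpM2l//.
    apply: (le_trans (hKE _)); rewrite ler_wpM2l ?(ltW KE0)//.
    rewrite (le_trans (sq_le_norm _))// ler_wpM2l// lerXn2r ?nnegrE ?(ltW BX0)//.
    exact: hBX.
  by rewrite ler_wpM2r ?sq_ge0.
move=> c' mu w w' z y xi Ww Ww' c'1 nr.
have [_ etaB epB] := hBn _ _ _ _ c'1 nr.
have dy : (yr w - yr w') ^+ 2 <= (2 * By) ^+ 2.
  rewrite -real_normK ?num_real// lerXn2r ?nnegrE ?mulr_ge0 ?(ltW By0)//.
  have := hBy _ (hB _ Ww); have := hBy _ (hB _ Ww').
  have := ler_normB (yr w) (yr w'); lra.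
split.
  have -> : observer_state w' y xi *m E =
      observer_state w y xi *m E + (- (yr w - yr w') *: (G *m E)).
    rewrite scalemxAl -mulmxDl; congr (_ *m _); rewrite /observer_state.
    have vec m (x g : 'rV[R]_m) (u v : R) :
        x - (y - v) *: g = x - (y - u) *: g + - (u - v) *: g.
      by apply/rowP => i; rewrite !mxE; ring.
    exact: vec.
  apply: (le_trans (sqD _ _)); rewrite sqZ sqrrN.
  apply: (@le_trans _ _ h2); last by rewrite lerDr.
  by rewrite lerD// ler_wpM2l// ler_wpM2r ?sq_ge0.
apply: (@le_trans _ _ e2); last by rewrite lerDr.
have := sqr_ge0 ((y - yr w) - (yr w - yr w')); move: epB dy; rewrite /e2; lra.
Qed.

End loop.

(** * Continuation of bounded trajectories *)

Section clamp.
Variables (R : realType) (m : nat).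

(** Projection onto a cube. Composition with it makes a field globally Lipschitz, as
    [picard_lindelof] requires, without changing it on the ball. *)
Definition clamp (rho : R) (v : 'rV[R]_m) : 'rV[R]_m :=
  \row_i Num.max (- rho) (Num.min rho (v 0 i)).

Lemma clamp_id rho v : `|v| <= rho -> clamp rho v = v.
Proof.
move=> vr; apply/rowP => i; rewrite mxE.
have := le_trans (coord_norm_le v i) vr; rewrite ler_norml => /andP[h1 h2].
by rewrite min_r// max_r.
Qed.

Lemma clamp_norm_le rho v : 0 <= rho -> `|clamp rho v| <= rho.
Proof.
move=> r0; apply: norm_le_coord => // i; rewrite mxE ler_norml le_max lexx/=.
by rewrite ge_max ge_min lexx/= andbT; lra.
Qed.

Lemma clamp_lipschitz rho v w : `|clamp rho v - clamp rho w| <= `|v - w|.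
Proof.
apply: norm_le_coord => // i; rewrite !mxE.
have := coord_norm_le (v - w) i; rewrite !mxE; set x := v 0 i; set y := w 0 i.
move=> h; apply: le_trans h; have := ler_norm (x - y); have := ler_norm (y - x).
rewrite distrC; move: `|_| => c h1 h2; rewrite ler_norml.
case: (leP rho x) => hx; case: (leP rho y) => hy.
all: case: (leP (- rho) rho) => ?; case: (leP (- rho) x) => ?; case: (leP (- rho) y) => ?.
all: by apply/andP; split; lra.
Qed.

Lemma clamp_solution (F : 'rV[R]_m -> 'rV[R]_m) (rho : R) a x0 : lip_bdd F -> 0 <= rho ->
  exists V : R -> 'rV[R]_m, [/\ continuous V, V a = x0,
    forall t, a < t -> is_derive t 1 V (F (clamp rho (V t))) & lip_bdd (F \o clamp rho)].
Proof.
move=> lF r0; have [L L0 hL] := lF rho.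
have hL' x y : `|F (clamp rho x) - F (clamp rho y)| <= (L + 1) * `|x - y|.
  apply: (le_trans (hL _ _ (clamp_norm_le _ r0) (clamp_norm_le _ r0))).
  by apply: ler_pM => //; [rewrite lerDl|exact: clamp_lipschitz].
have L1 : 0 < L + 1 by rewrite ltr_wpDl.
have lF' : lip_bdd (F \o clamp rho) by exact: lip_bdd_lin (ltW L1) hL'.
have [x cx t|t x y|V [cV Va DV]] :=
  @picard_lindelof R m (fun _ => F \o clamp rho) (L + 1) a x0 _ L1 _.
- apply: (@continuous_comp _ _ _ x (F \o clamp rho)); first exact: cx.
  exact: (lip_bdd_continuous lF').
- exact: hL'.
- by exists V.
Qed.

Lemma norm_lt_near (V : R -> 'rV[R]_m) (b rho : R) : continuous V -> `|V b| < rho ->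
  exists2 dl : R, 0 < dl & forall t, b - dl < t -> t < b + dl -> `|V t| < rho.
Proof.
move=> cV Vb; have d0 : 0 < rho - `|V b| by rewrite subr_gt0.
have := cV b; move/cvgrPdist_lt => /(_ _ d0)[dl /= dl0 hdl]; exists dl => // t t1 t2.
have tb : `|b - t| < dl by rewrite distrC ltr_norml; apply/andP; split; lra.
have h : `|V b - V t| < rho - `|V b| := hdl t tb.
by have := ler_normB (V b) (V b - V t); rewrite subKr; lra.
Qed.

Lemma local_solution (F : 'rV[R]_m -> 'rV[R]_m) a x0 : lip_bdd F ->
  exists2 dl : R, 0 < dl & exists V : R -> 'rV[R]_m, [/\ continuous V, V a = x0 &
    forall t, a < t -> t < a + dl -> is_derive t 1 V (F (V t))].
Proof.
move=> lF; have r0 : 0 <= `|x0| + 1 by exact: addr_ge0.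
have [V [cV Va DV _]] := clamp_solution a x0 lF r0.
have [|dl dl0 hdl] := norm_lt_near (b := a) (rho := `|x0| + 1) cV.
  by rewrite Va ltrDl.
exists dl => //; exists V; split => // t at_ tdl.
have := DV t at_; rewrite clamp_id// ltW// hdl//.
by apply: lt_trans at_; rewrite ltrBlDr ltrDl.
Qed.

(** The field clamped at level rho + 1 has a solution V for all later times, equal to x before b by
    uniqueness. By continuity |V b| <= rho < rho + 1, so for a short while after b the clamp is
    still inactive and V solves the original equation. *)
Lemma extend_solution (F : 'rV[R]_m -> 'rV[R]_m) x (a b rho : R) : lip_bdd F -> a < b ->
  (forall t, a < t -> t < b -> ode_on F x a t) ->
  (forall t, a <= t -> t < b -> `|x t| <= rho) ->
  exists2 dl : R, 0 < dl & exists V : R -> 'rV[R]_m, [/\ continuous V,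
    forall t, a <= t -> t < b -> V t = x t &
    forall t, a < t -> t < b + dl -> is_derive t 1 V (F (V t))].
Proof.
move=> lF ab ox xb.
have r0 : 0 <= rho by apply: le_trans (xb a (lexx _) ab).
have r1 : 0 <= rho + 1 by exact: addr_ge0.
have [V [cV Va DV lF']] := clamp_solution a (x a) lF r1.
have Vx t : a <= t -> t < b -> V t = x t.
  rewrite le_eqVlt => /predU1P[<- //|at_ tb].
  apply: (ode_unique lF' (ltW at_)) => //.
    by split=> [|u au _]; [exact: continuous_subspaceT|exact: DV].
  have [cx dx] := ox t at_ tb; split=> // u au ut.
  rewrite /= clamp_id; first exact: dx.
  by apply: (le_trans (xb u (ltW au) (lt_trans ut tb))); rewrite lerDl.
have Vb : `|V b| <= rho.
  have cl_ : closed [set t : R | t <= rho] by exact: closed_le.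
  have cn : `|V t| @[t --> b^'-] --> `|V b|.
    by apply: cvg_norm; apply: cvg_at_left_filter; exact: cV.
  suff nr : \forall t \near b^'-, [set t : R | t <= rho] `|V t| by exact: closed_cvg cl_ nr _ cn.
  near=> t; have at_ : a < t by near: t; exact: nbhs_left_gt.
  have tb : t < b by near: t; exact: nbhs_left_lt.
  by rewrite /= Vx ?(ltW at_)// xb ?(ltW at_).
have [|dl dl0 hdl] := norm_lt_near (b := b) (rho := rho + 1) cV.
  by apply: (le_lt_trans Vb); rewrite ltrDl.
exists dl => //; exists V; split => // t at_ tdl.
have [tb|bt] := ltP t b.
  have := DV t at_; rewrite clamp_id// Vx ?(ltW at_)//.
  by apply: (le_trans (xb t (ltW at_) tb)); rewrite lerDl.
have := DV t at_; rewrite clamp_id// ltW// hdl//.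
by apply: lt_le_trans bt; rewrite ltrBlDr ltrDl.
Unshelve. all: by end_near. Qed.

End clamp.

Section gluing.
Variable R : realType.

Definition glue (V : Type) (b : R) (u v : R -> V) (t : R) : V := if t < b then u t else v t.

Lemma glue_lt (V : Type) (b : R) (u v : R -> V) t : t < b -> glue b u v t = u t.
Proof. by rewrite /glue => ->. Qed.

Lemma glue_ge (V : Type) (b : R) (u v : R -> V) t : b <= t -> glue b u v t = v t.
Proof. by rewrite /glue ltNge => ->. Qed.

Lemma glue_near_lt (V : Type) (b t : R) (u v : R -> V) : t < b ->
  \forall x \near t, glue b u v x = u x.
Proof.
move=> tb; have : \forall x \near t, x < b by exact: near_lt.
by apply: filterS => x; exact: glue_lt.
Qed.

Lemma glue_near_gt (V : Type) (b t : R) (u v : R -> V) : b < t ->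
  \forall x \near t, glue b u v x = v x.
Proof.
move=> bt; have : \forall x \near t, b < x by exact: lt_nbhsr.
by apply: filterS => x /ltW; exact: glue_ge.
Qed.

Lemma is_derive_near (V : normedModType R) (u v : R -> V) (t : R) dv :
  (\forall x \near t, u x = v x) -> is_derive t 1 v dv -> is_derive t 1 u dv.
Proof.
move=> uv [D <-].
have vu : \forall x \near t, v x = u x by apply: filterS uv => x ->.
apply: DeriveDef; last by apply: near_eq_derive => //; rewrite oner_neq0.
by apply: near_eq_derivable D => //; rewrite oner_neq0.
Qed.

Lemma glue_within (V : topologicalType) (b : R) (B : \bar R) (u v : R -> V) :
  {within horizon b%:E, continuous u} -> continuous v -> u t @[t --> b^'-] --> v b ->
  {within horizon B, continuous (glue b u v)}.
Proof.
move=> /subspace_continuousP cu cv uvb; apply/subspace_continuousP => t [t0 tB] A nA.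
change (\forall x \near t, horizon B x -> A (glue b u v x)).
have {}nA : nbhs (glue b u v t) A := nA.
have [tb|] := ltP t b.
  rewrite glue_lt// in nA.
  have ht : horizon b%:E t by split; rewrite ?lte_fin.
  have h : \forall x \near t, horizon b%:E x -> A (u x) := cu t ht A nA.
  near=> x => -[x0 _].
  have xb : x < b by near: x; exact: near_lt.
  rewrite glue_lt//; have : horizon b%:E x -> A (u x) by near: x.
  by apply; split; rewrite ?lte_fin.
rewrite le_eqVlt => /predU1P[bt|bt].
  rewrite -bt glue_ge// in nA *.
  have h1 : \forall x \near b, x < b -> A (u x) := uvb A nA.
  have h2 : \forall x \near b, A (v x) := cv b A nA.
  near=> x => _; have [xb|bx] := ltP x b.
    by rewrite glue_lt//; move: xb; near: x.
  by rewrite glue_ge//; near: x.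
rewrite glue_ge ?ltW// in nA.
have h2 : \forall x \near t, A (v x) := cv t A nA.
near=> x => _; have bx : b < x by near: x; exact: lt_nbhsr.
by rewrite glue_ge ?ltW//; near: x.
Unshelve. all: by end_near. Qed.

End gluing.

Section extension.
Variables (R : realType) (p r n d : nat).
Variables (s : 'rV[R]_r -> 'rV[R]_r) (yr : 'rV[R]_r -> R).
Variables (f : 'rV[R]_n -> R -> 'rV[R]_p -> 'rV[R]_n) (q : 'rV[R]_n -> R -> 'rV[R]_p -> R).
Hypothesis smooth : smooth_data s yr f q d.+1.
Variables (Nq : nat) (W0 : set 'rV[R]_r) (M : R -> R) (T : R).
Variables (phic : 'rV[R]_d.+1 -> R) (c : 'I_d.+1 -> R) (kappa k : R) (mu : 'rV[R]_p).
Hypothesis lip_phic : lip_bdd phic.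
Hypothesis T_gt0 : 0 < T.
Local Notation range := (quantization_range W0 Nq M T).
Local Notation loop := (closed_loop s yr f q W0 Nq M T phic c kappa k mu).
Local Notation state := (r + (n + (1 + d.+1)))%N.

Definition wd_part (v : 'rV[R]_state) : 'rV[R]_r := lsubmx v.
Definition z_part (v : 'rV[R]_state) : 'rV[R]_n := lsubmx (rsubmx v).
Definition y_part (v : 'rV[R]_state) : R := lsubmx (rsubmx (rsubmx v)) 0 0.
Definition xi_part (v : 'rV[R]_state) : 'rV[R]_d.+1 := rsubmx (rsubmx (rsubmx v)).
(** Decoder, plant and regulator as one autonomous system between samples. The exosystem is left out
    because its solution is already known for all times. *)
Definition pack (w : 'rV[R]_r) (z : 'rV[R]_n) (y : R) (xi : 'rV[R]_d.+1) : 'rV[R]_state :=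
  row_mx w (row_mx z (row_mx (const_mx y) xi)).

Lemma wd_part_pack w z y xi : wd_part (pack w z y xi) = w.
Proof. by rewrite /wd_part row_mxKl. Qed.

Lemma z_part_pack w z y xi : z_part (pack w z y xi) = z.
Proof. by rewrite /z_part row_mxKr row_mxKl. Qed.

Lemma y_part_pack w z y xi : y_part (pack w z y xi) = y.
Proof. by rewrite /y_part !row_mxKr row_mxKl mxE. Qed.

Lemma xi_part_pack w z y xi : xi_part (pack w z y xi) = xi.
Proof. by rewrite /xi_part !row_mxKr. Qed.

Definition partE := (wd_part_pack, z_part_pack, y_part_pack, xi_part_pack).

Definition loop_field (v : 'rV[R]_state) : 'rV[R]_state :=
  let u := k * (y_part v - yr (wd_part v)) in
  pack (s (wd_part v)) (f (z_part v) (y_part v) mu)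
    (q (z_part v) (y_part v) mu + xi_part v 0 0 - u) (Phi phic (xi_part v) - u *: gainG c kappa).

Lemma lip_wd_part : lip_bdd wd_part.
Proof. exact: lip_bdd_lsubmx. Qed.

Lemma lip_z_part : lip_bdd z_part.
Proof.
exact: (lip_bdd_comp (@lip_bdd_lsubmx R n (1 + d.+1)) (@lip_bdd_rsubmx R r (n + (1 + d.+1)))).
Qed.

Lemma lip_input_part : lip_bdd (fun v : 'rV[R]_state => rsubmx (rsubmx v)).
Proof.
exact: (lip_bdd_comp (@lip_bdd_rsubmx R n (1 + d.+1)) (@lip_bdd_rsubmx R r (n + (1 + d.+1)))).
Qed.

Lemma lip_y_part : lip_bdd y_part.
Proof.
exact: (lip_bdd_comp (@lip_bdd_coord R 1 0)
  (lip_bdd_comp (@lip_bdd_lsubmx R 1 d.+1) lip_input_part)).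
Qed.

Lemma lip_xi_part : lip_bdd xi_part.
Proof. exact: (lip_bdd_comp (@lip_bdd_rsubmx R 1 d.+1) lip_input_part). Qed.

Lemma lip_loop_field : lip_bdd loop_field.
Proof.
have lyr := lip_bdd_comp (lip_yr smooth) lip_wd_part.
have lu : lip_bdd (fun v => k * (y_part v - yr (wd_part v))).
  by apply: (lip_bddZ k); apply: lip_bddB => //; exact: lip_y_part.
have largs : lip_bdd (fun v => (z_part v, y_part v, mu)).
  apply: lip_bdd_pair; last exact: lip_bdd_cst.
  by apply: lip_bdd_pair; [exact: lip_z_part|exact: lip_y_part].
case: smooth => _ _ hf hq _.
have lf := lip_bdd_comp (lip_bdd_C1_triple_rV hf) largs.
have lq := lip_bdd_comp (lip_bdd_C1_triple hq) largs.
have lxi i := lip_bdd_comp (lip_bdd_coord i) lip_xi_part.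
apply: lip_bdd_row_mx; first exact: lip_bdd_comp (lip_s smooth) lip_wd_part.
apply: lip_bdd_row_mx; first exact: lf.
apply: lip_bdd_row_mx; apply: lip_bdd_rV => i.
  rewrite (_ : (fun _ => _) = (fun v => q (z_part v) (y_part v) mu + xi_part v 0 0
    - k * (y_part v - yr (wd_part v)))); last by apply/funext => v; rewrite mxE.
  by apply: lip_bddB => //; apply: lip_bddD; [exact: lq|exact: lxi].
rewrite (_ : (fun _ => _) = (fun v => (if insub i.+1 is Some i' then xi_part v 0 (i' : 'I_d.+1)
    else - phic (xi_part v)) - gainG c kappa 0 i * (k * (y_part v - yr (wd_part v))))).
  apply: lip_bddB; last exact: (lip_bddZ (gainG c kappa 0 i) lu).
  case: insub => [i'|]; first exact: lxi.
  by apply: lip_bddN; exact: lip_bdd_comp lip_phic lip_xi_part.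
by apply/funext => v; rewrite !mxE; congr (_ - _); exact: mulrC.
Qed.

Definition loop_vector (X : trajectory R r n d.+1) (t : R) : 'rV[R]_state :=
  pack (tr_wd X t) (tr_z X t) (tr_y X t) (tr_xi X t).

Lemma is_derive_pack (w : R -> 'rV[R]_r) (z : R -> 'rV[R]_n) (y : R -> R)
    (xi : R -> 'rV[R]_d.+1) (t : R) dw dz dy dxi :
  is_derive t 1 w dw -> is_derive t 1 z dz -> is_derive t 1 y dy -> is_derive t 1 xi dxi ->
  is_derive t 1 (fun t => pack (w t) (z t) (y t) (xi t)) (pack dw dz dy dxi).
Proof.
move=> Dw Dz Dy Dxi; apply: is_derive_row_mx => //; apply: is_derive_row_mx => //.
apply: is_derive_row_mx => //; apply: is_derive_mx => i j.
rewrite (_ : (fun _ => _) = y) ?mxE//.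
by apply/funext => u; rewrite mxE.
Qed.

Lemma is_derive_parts (v : R -> 'rV[R]_state) (t : R) w z y xi :
  is_derive t 1 v (pack w z y xi) ->
  [/\ is_derive t 1 (fun t => wd_part (v t)) w, is_derive t 1 (fun t => z_part (v t)) z,
      is_derive t 1 (fun t => y_part (v t)) y & is_derive t 1 (fun t => xi_part (v t)) xi].
Proof.
move=> D; have D1 := is_derive_rsubmx D; have D2 := is_derive_rsubmx D1.
split.
- by have := is_derive_lsubmx D; rewrite row_mxKl.
- by have := is_derive_lsubmx D1; rewrite row_mxKr row_mxKl.
- by have := is_derive_coord 0 0 (is_derive_lsubmx D2); rewrite !row_mxKr row_mxKl mxE.
- by have := is_derive_rsubmx D2; rewrite !row_mxKr.
Qed.

(** Closed on the right, since an extension beyond t starts from the interval that precedes t; when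
    t is a sampling time the index is lowered by one. *)
Lemma sampling_interval (t : R) : 0 < t -> exists j : nat, j%:R * T < t <= j.+1%:R * T.
Proof.
move=> t0; pose i := Num.truncn (t / T).
have tT : 0 <= t / T by rewrite divr_ge0// ltW.
have h1 : i%:R * T <= t by rewrite -ler_pdivlMr// truncn_le.
have h2 : t < i.+1%:R * T by rewrite -ltr_pdivrMr// truncnS_gt.
move: h1; rewrite le_eqVlt => /predU1P[iE|h1]; last by exists i; rewrite h1 ltW.
have : i != 0%N by apply: contraTneq t0 => i0; rewrite -iE i0 mul0r ltxx.
move: iE; case: (i) => // j jE _; exists j.
by rewrite -jE lexx ltr_pM2r// ltr_nat ltnS leqnn.
Qed.

Lemma no_sampling_interval (t : R) : 0 < t -> (forall i : nat, t != i%:R * T) ->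
  exists j : nat, j%:R * T < t < j.+1%:R * T.
Proof.
move=> t0 ns; have [j /andP[h1]] := sampling_interval t0.
by rewrite le_eqVlt (negPf (ns _)) /= => h2; exists j; rewrite h1.
Qed.

Lemma loop_vector_derive (b : \bar R) X (t : R) : loop b X -> 0 < t -> (t%:E < b)%E ->
  (forall i : nat, t != i%:R * T) ->
  is_derive t 1 (loop_vector X) (loop_field (loop_vector X t)).
Proof.
move=> cl t0 tb ns; have [j /andP[jt tj]] := no_sampling_interval t0 ns.
have := cl_plant cl t0 tb ns; rewrite outGammaE => -[Dz Dy Dxi].
have Dw := cl_wd cl jt tj tb.
by have := is_derive_pack Dw Dz Dy Dxi; rewrite /loop_field !partE.
Qed.

Lemma within_loop_tail X (A : set R) : {within A, continuous (tr_z X)} ->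
  {within A, continuous (tr_y X)} -> {within A, continuous (tr_xi X)} ->
  {within A, continuous (fun t => rsubmx (loop_vector X t))}.
Proof.
move=> cz cy cxi.
rewrite (_ : (fun _ => _) =
  (fun t => row_mx (tr_z X t) (row_mx (const_mx (tr_y X t)) (tr_xi X t)))); last first.
  by apply/funext => t; rewrite /loop_vector /pack row_mxKr.
apply: within_row_mx => //; apply: within_row_mx => // t.
apply: (continuous_comp (f := (tr_y X : subspace A -> R)) (cy t)).
apply: lip_bdd_continuous; apply: lip_bdd_rV => i.
rewrite (_ : (fun _ => _) = idfun) ?(_ : _ = id)//; first exact: lip_bdd_id.
by apply/funext => u; rewrite mxE.
Qed.

(** Covers both positions of B. At a sampling time the old trajectory only has to converge to the
    value [wm] before the reset, from which Y starts afresh; elsewhere Y must prolong the old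
    trajectory differentiably through B. No sampling time lies strictly between B and the new
    end. *)
Lemma closed_loop_glue (B dl : R) (wg : R -> 'rV[R]_r) (Y : R -> 'rV[R]_state)
    (wm : 'rV[R]_r) X : 0 < B -> loop B%:E X ->
  solution s +oo%E wg -> (forall t, 0 <= t -> t < B -> tr_w X t = wg t) ->
  continuous Y ->
  (forall t, B < t -> t < B + dl -> is_derive t 1 Y (loop_field (Y t))) ->
  (forall i : nat, B < i%:R * T -> B + dl <= i%:R * T) ->
  rsubmx (loop_vector X t) @[t --> B^'-] --> rsubmx (Y B) ->
  (forall i : nat, i%:R * T = B -> tr_wd X t @[t --> B^'-] --> wm /\
     wd_part (Y B) = wm + (range i / Nq%:R) *: quantize Nq (range i) (wg B) wm) ->
  ((forall i : nat, B != i%:R * T) -> is_derive B 1 Y (loop_field (Y B)) /\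
     \forall t \near B^'-, loop_vector X t = Y t) ->
  exists X', loop (B + dl)%:E X' /\ agree_on T B%:E X X'.
Proof.
move=> B0 cl swg wgX cY DY ns tailB sampled unsampled.
pose v := glue B (loop_vector X) Y.
have vlt t : t < B -> v t = loop_vector X t by move=> tB; exact: glue_lt.
have vge t : B <= t -> v t = Y t by move=> tB; exact: glue_ge.
pose X' := Trajectory wg (fun t => wd_part (v t))
  (fun i => if i%:R * T < B then tr_wdm X i else wm) (fun t => z_part (v t))
  (fun t => y_part (v t)) (fun t => xi_part (v t)).
have at_B (i : nat) : ((i%:R * T)%:E < (B + dl)%:E)%E -> i%:R * T < B \/ i%:R * T = B.
  rewrite lte_fin => h; have [h1|h1|h1] := ltgtP (i%:R * T) B; [by left| |by right].
  by have := ns i h1; rewrite leNgt h.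
have Dv t : 0 < t -> t < B + dl -> (forall i : nat, t != i%:R * T) ->
    is_derive t 1 v (loop_field (v t)).
  move=> t0 tdl nst; have [tB|tB|tB] := ltgtP t B.
  - apply: is_derive_near (glue_near_lt _ _ tB) _; rewrite vlt//.
    by apply: loop_vector_derive cl t0 _ nst; rewrite lte_fin.
  - by apply: is_derive_near (glue_near_gt _ _ tB) _; rewrite vge ?(ltW tB)//; exact: DY.
  - rewrite tB in nst *; have [DB nearB] := unsampled nst.
    rewrite vge//; apply: is_derive_near DB.
    have h : \forall x \near B, x < B -> loop_vector X x = Y x := nearB.
    near=> x; have [xB|xB] := ltP x B; last exact: vge.
    by rewrite vlt//; move: xB; near: x.
have cwd : continuous (fun t => wd_part (Y t)).
  by move=> t; apply: (continuous_comp (cY t)); exact: (lip_bdd_continuous lip_wd_part).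
exists X'; split; last first.
  split=> [t [t0 tB]|j jB]; last by rewrite /= -lte_fin jB.
  by rewrite lte_fin in tB; rewrite /= vlt// /loop_vector !partE wgX.
constructor.
- have [cw dw] := swg; split=> [|t t0 _]; last by apply: dw => //; exact: ltry.
  by apply: continuous_subspaceW cw => t [t0 _]; split => //; exact: ltry.
- move=> j t jt tj tB; have t0 : 0 < t by apply: le_lt_trans jt; rewrite mulr_ge0// ltW.
  have [] // := is_derive_parts (Dv t t0 _ (no_sampling_between T_gt0 jt tj)).
- move=> j jdl; have [jB|jB] := at_B j jdl.
    have h := cl_wd_right cl (_ : ((j%:R * T)%:E < B%:E)%E).
    rewrite /= vlt// /loop_vector partE; apply: cvg_trans (h _); last by rewrite lte_fin.
    apply: near_eq_cvg; near=> t.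
    have tB : t < B by near: t; exact: nbhs_right_lt.
    by rewrite vlt// /loop_vector partE.
  rewrite jB /= vge//; apply: cvg_trans (cvg_at_right_filter (cwd B)).
  apply: near_eq_cvg; near=> t.
  have tB : B < t by near: t; exact: nbhs_right_gt.
  by rewrite vge// ltW.
- move=> j j0 jdl; have [jB|jB] := at_B j jdl.
    have h := cl_wd_left cl j0 (_ : ((j%:R * T)%:E < B%:E)%E).
    rewrite /= jB; apply: cvg_trans (h _); last by rewrite lte_fin.
    apply: near_eq_cvg; near=> t.
    have tB : t < B.
      by apply: lt_trans jB; near: t; exact: nbhs_left_lt.
    by rewrite vlt// /loop_vector partE.
  have [h _] := sampled j jB.
  rewrite /= jB ltxx; apply: cvg_trans h; apply: near_eq_cvg; near=> t.
  have tB : t < B by near: t; exact: nbhs_left_lt.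
  by rewrite vlt// /loop_vector partE.
- move=> j jdl; have [jB|jB] := at_B j jdl.
    have h := cl_wd_reset cl (_ : ((j%:R * T)%:E < B%:E)%E).
    rewrite /= vlt// jB /loop_vector partE -wgX//; last by rewrite mulr_ge0// ltW.
    by apply: h; rewrite lte_fin.
  by have [_ h] := sampled j jB; rewrite /= jB ltxx vge.
- have [cz cy cxi] := cl_cont cl.
  have ct := within_loop_tail cz cy cxi.
  have cYt : continuous (fun t => rsubmx (Y t)).
    move=> t; apply: (continuous_comp (cY t)).
    exact: (lip_bdd_continuous (@lip_bdd_rsubmx R r (n + (1 + d.+1)))).
  have := glue_within (B := (B + dl)%:E) ct cYt tailB.
  rewrite (_ : glue _ _ _ = (fun t => rsubmx (v t))); last first.
    by apply/funext => t; rewrite /v /glue; case: ifP.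
  move=> cv.
  have comp (V : topologicalType) (g : 'rV[R]_(n + (1 + d.+1)) -> V) : continuous g ->
      {within horizon (B + dl)%:E, continuous (fun t => g (rsubmx (v t)))}.
    by move=> cg t; apply: (continuous_comp (cv t)); exact: cg.
  split.
  + by apply: (comp _ (@lsubmx R 1 n (1 + d.+1)));
      exact: (lip_bdd_continuous (@lip_bdd_lsubmx R n (1 + d.+1))).
  + apply: (comp _ (fun v => lsubmx (rsubmx v) 0 0)); apply: lip_bdd_continuous.
    exact: (lip_bdd_comp (@lip_bdd_coord R 1 0)
      (lip_bdd_comp (@lip_bdd_lsubmx R 1 d.+1) (@lip_bdd_rsubmx R n (1 + d.+1)))).
  + apply: (comp _ (fun v => rsubmx (rsubmx v))); apply: lip_bdd_continuous.
    exact: (lip_bdd_comp (@lip_bdd_rsubmx R 1 d.+1) (@lip_bdd_rsubmx R n (1 + d.+1))).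
- move=> t t0 tdl nst /=; rewrite lte_fin in tdl.
  have [_ Dz Dy Dxi] := is_derive_parts (Dv t t0 tdl nst).
  by rewrite outGammaE.
Unshelve. all: by end_near. Qed.

Lemma natr_mulT_lt (i j : nat) : (i%:R * T < j%:R * T) = (i < j)%N.
Proof. by rewrite ltr_pM2r// ltr_nat. Qed.

(** On the last interval before B the trajectory is a bounded solution of an autonomous equation, so
    it extends past B, if necessary with a reset at B, against maximality. *)
Lemma bounded_not_maximal (B rho : R) X :
  maximal_closed_loop s yr f q W0 Nq M T phic c kappa k mu B%:E X ->
  invariant_set s W0 -> W0 (tr_w X 0) ->
  (forall t, 0 <= t -> t < B -> `|loop_vector X t| <= rho) -> False.
Proof.
move=> [B0 cl maxX] inv W0w bX; rewrite lte_fin in B0.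
have extend dl : 0 < dl -> forall X', agree_on T B%:E X X' -> ~ loop (B + dl)%:E X'.
  by move=> dl0 X'; apply: maxX; rewrite lte_fin ltrDl.
have [wg [wg0 _ _ swg]] := invariant_solution inv W0w.
have wgX t : 0 <= t -> t < B -> tr_w X t = wg t.
  move=> t0 tB; apply: (ode_unique (lip_s smooth) t0) (esym wg0).
    by apply: solution_ode_on (cl_w cl) (lexx 0) _; rewrite lte_fin.
  exact: solution_ode_on swg (lexx 0) (ltry t).
have [j /andP[jB Bj]] := sampling_interval B0.
have jT0 : 0 <= j%:R * T by rewrite mulr_ge0// ltW.
have ode t : j%:R * T < t -> t < B -> ode_on loop_field (loop_vector X) (j%:R * T) t.
  move=> jt tB; have tBE : (t%:E < B%:E)%E by rewrite lte_fin.
  split=> [|u ju ut]; last first.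
    have uB := lt_trans ut tB.
    apply: (loop_vector_derive cl (le_lt_trans jT0 ju)); first by rewrite lte_fin.
    exact: no_sampling_between T_gt0 ju (lt_le_trans uB Bj).
  have [cz cy cxi] := cl_cont cl.
  rewrite (_ : loop_vector X = fun t => row_mx (tr_wd X t) (rsubmx (loop_vector X t))).
    apply: within_row_mx.
      by have [] := decoder_ode_on cl jt (lt_le_trans tB Bj) tBE.
    apply: within_loop_tail; exact: within_horizon tBE.
  by apply/funext => u; rewrite /loop_vector /pack row_mxKr.
have [dl dl0 [U [cU UX DU]]] := extend_solution lip_loop_field jB ode
  (fun t jt => bX t (le_trans jT0 jt)).
have leftU : \forall t \near B^'-, loop_vector X t = U t.
  near=> t; have jt : j%:R * T < t by near: t; exact: nbhs_left_gt.
  have tB : t < B by near: t; exact: nbhs_left_lt.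
  by rewrite UX// ltW.
have limU (V : topologicalType) (g : 'rV[R]_state -> V) : continuous g ->
    g (loop_vector X t) @[t --> B^'-] --> g (U B).
  move=> cg; have h : g (U t) @[t --> B^'-] --> g (U B).
    by apply: cvg_at_left_filter; apply: (continuous_comp (cU B)); exact: cg.
  apply: cvg_trans h; apply: near_eq_cvg.
  by apply: filterS leftU => t ->.
have ctail := lip_bdd_continuous (@lip_bdd_rsubmx R r (n + (1 + d.+1))).
move: Bj; rewrite le_eqVlt => /predU1P[BE|Bj].
  (* B is a sampling time: U crosses it without reset and serves only to supply the left limits. A
     new local solution starts from the reset state, cut to length at most T so that the next
     sampling time is not passed. *)
  pose wm := wd_part (U B); pose l := range j.+1.
  have [dl' dl'0 [Y [cY YB DY]]] := local_solution B
    (row_mx (wm + (l / Nq%:R) *: quantize Nq l (wg B) wm) (rsubmx (U B))) lip_loop_field.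
  have d0 : 0 < Num.min dl' T by rewrite lt_min dl'0.
  have [|i||||X' [clX' agX']] :=
    @closed_loop_glue B (Num.min dl' T) wg Y wm X B0 cl swg wgX cY.
  - move=> t Bt tdl; apply: DY => //; apply: (lt_le_trans tdl).
    by rewrite lerD2l ge_min lexx.
  - rewrite BE natr_mulT_lt => ji; apply: (@le_trans _ _ (j.+2%:R * T)).
      by rewrite -[j.+2%:R]natr1 mulrDl mul1r lerD2l ge_min lexx orbT.
    by rewrite ler_pM2r// ler_nat.
  - by rewrite YB row_mxKr; exact: (limU _ _ ctail).
  - move=> i iB; have {iB} -> : i = j.+1.
      apply/eqP; rewrite -(eqr_nat R); apply/eqP.
      by apply: (mulIf (lt0r_neq0 T_gt0)); rewrite iB.
    split; last by rewrite YB /wd_part row_mxKl.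
    have := limU _ _ (lip_bdd_continuous lip_wd_part).
    by rewrite (_ : (fun _ => _) = tr_wd X)//; apply/funext => t; rewrite /loop_vector partE.
  - by move=> /(_ j.+1); rewrite BE eqxx.
  exact: extend d0 X' agX' clX'.
have jB0 : 0 < j.+1%:R * T - B by rewrite subr_gt0.
have d0 : 0 < Num.min dl (j.+1%:R * T - B) by rewrite lt_min dl0.
have [|i||||X' [clX' agX']] :=
  @closed_loop_glue B (Num.min dl (j.+1%:R * T - B)) wg U 0 X B0 cl swg wgX cU.
- move=> t Bt tdl; apply: DU; first exact: lt_trans Bt.
  by apply: (lt_le_trans tdl); rewrite lerD2l ge_min lexx.
- move=> Bi; have ji : (j < i)%N by rewrite -natr_mulT_lt; exact: lt_trans Bi.
  apply: (@le_trans _ _ (j.+1%:R * T)).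
    by rewrite -lerBrDl ge_min lexx orbT.
  by rewrite ler_pM2r// ler_nat.
- exact: (limU _ _ ctail).
- move=> i iB; move: jB Bj; rewrite -iB !natr_mulT_lt ltnS => ji.
  by rewrite leqNgt ji.
- move=> _; split => //; apply: DU => //.
  by rewrite ltrDl.
exact: extend d0 X' agX' clX'.
Unshelve. all: by end_near. Qed.

End extension.

(** * Convergence *)

Section trajectory.
Variables (R : realType) (p r n d : nat).
Variables (s : 'rV[R]_r -> 'rV[R]_r) (yr : 'rV[R]_r -> R).
Variables (f : 'rV[R]_n -> R -> 'rV[R]_p -> 'rV[R]_n) (q : 'rV[R]_n -> R -> 'rV[R]_p -> R).
Hypothesis smooth : smooth_data s yr f q d.+1.
Variables (P : set 'rV[R]_p) (W : set 'rV[R]_r) (Z : set 'rV[R]_n).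
Variable phic : 'rV[R]_d.+1 -> R.
Local Notation N := (p + (r + n))%N.
Local Notation A0 := (steady_state_set s yr f P W Z).
Local Notation tau := (tau s yr f q d.+1).
Local Notation space := (prod_set P W [set: 'rV[R]_n]).
Local Notation start := (prod_set P W Z).
Variables (c : 'I_d.+1 -> R) (kappa : R) (e : nat) (E : 'M[R]_(d.+1, e)) (K1 : R).
Local Notation G := (gainG c kappa).
Hypothesis K1_gt0 : 0 < K1.
Hypothesis coercive : forall x : 'rV[R]_d.+1, sq x <= K1 * sq (x *m E).
Variables (W0 : set 'rV[R]_r) (Nq : nat) (M : R -> R) (T k : R).
Variables (mu : 'rV[R]_p) (b : \bar R) (X : trajectory R r n d.+1).
Local Notation pert := (perturbed s yr f q P W phic c kappa k).
Local Notation near_steady := (near_steady s yr f q P W Z E).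
Local Notation range := (quantization_range W0 Nq M T).
Hypothesis HW0 : compact W0 /\ invariant_set s W0.
Hypothesis HN : (0 < Nq)%N.
Hypothesis HW : [/\ compact W, W0 `<=` W, invariant_set s W &
  forall w, ~ W w -> Num.sqrt r%:R * (initial_range W0 / (2 * Nq%:R)) < edist W0 w].
Hypothesis HM : [/\ M 0 = 1, forall t, 0 <= t -> 0 < M t &
  forall t t', 0 <= t -> t <= t' -> M t <= M t'].
Hypothesis HMW : forall w1 w2 : R -> 'rV[R]_r,
  solution s +oo%E w1 -> solution s +oo%E w2 -> W (w1 0) -> W (w2 0) ->
  forall t, 0 <= t -> enorm (w1 t - w2 t) <= M t * enorm (w1 0 - w2 0).
Hypothesis T_gt0 : 0 < T.
Hypothesis rate : Num.sqrt r%:R * M T < Nq%:R.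
Hypothesis cl : closed_loop s yr f q W0 Nq M T phic c kappa k mu b X.
Hypothesis W0w : W0 (tr_w X 0).
Hypothesis W0wd : W0 (tr_wdm X 0%N).
Hypothesis Pmu : P mu.
Hypothesis Zz : Z (tr_z X 0).

Local Notation x_at := (fun w t => loop_state mu w (tr_z X t)).
Local Notation eta_at := (fun w t => observer_state yr c kappa w (tr_y X t) (tr_xi X t)).
Local Notation ep_at := (fun w t => tr_y X t - yr w).
Local Notation near_at c' w t := (near_steady c' (x_at w t) (eta_at w t) (ep_at w t)).

Variables (H Eb dl C Cb Cj th : R).
Hypothesis dl_gt0 : 0 < dl.
Hypothesis C_gt0 : 0 < C.
Hypothesis Cj_gt0 : 0 < Cj.
Hypothesis thT : th <= T.
Hypothesis near_start : forall x eta ep, space x -> near_steady (2 * dl) x eta ep -> start x.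
Hypothesis initial : forall w, W w ->
  sq (eta_at w 0 *m E) <= H /\ (ep_at w 0) ^+ 2 <= Eb.
Hypothesis bounded_jump : forall w w' t, W w -> W w' -> near_at dl w t ->
  sq (eta_at w' t *m E) <= H /\ (ep_at w' t) ^+ 2 <= Eb.
Hypothesis small_jump : forall c' J w w' t, W w -> W w' -> `|w' - w| <= J ->
  near_at c' w t -> near_at (5 / 4 * c' + Cj * J ^+ 2) w' t.
Hypothesis interval : forall l x eta ep, 0 <= l -> pert l x eta ep ->
  (start (x 0) -> sq (eta 0 *m E) <= H -> ep 0 ^+ 2 <= Eb ->
      [/\ `|x l| <= Cb, sq (eta l *m E) <= Cb, ep l ^+ 2 <= Cb &
          th <= l -> near_steady dl (x l) (eta l) (ep l)]) /\
  (forall c', 0 < c' -> c' <= 2 * dl -> near_steady c' (x 0) (eta 0) (ep 0) ->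
      near_steady (C * c') (x l) (eta l) (ep l) /\
      (th <= l -> near_steady (c' / 2) (x l) (eta l) (ep l))).

Lemma sampled_decoder j : ((j%:R * T)%:E < b)%E -> exists g : R -> 'rV[R]_r,
  [/\ g 0 = tr_wd X (j%:R * T), forall t, W (g t),
      forall l, 0 <= l -> l <= T -> ((j%:R * T + l)%:E < b)%E ->
        pert l (fun t => x_at (g t) (t + j%:R * T)) (fun t => eta_at (g t) (t + j%:R * T))
          (fun t => ep_at (g t) (t + j%:R * T)),
      forall l, 0 <= l -> l <= T -> ((j%:R * T + l)%:E < b)%E ->
        `|tr_w X (l + j%:R * T) - g l| <= range j.+1 &
      (forall l, 0 <= l -> l < T -> ((j%:R * T + l)%:E < b)%E ->
         tr_wd X (l + j%:R * T) = g l) /\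
      (((j.+1%:R * T)%:E < b)%E -> tr_wdm X j.+1 = g T)].
Proof.
move=> jb; have ls := lip_s smooth.
have [_ hw] := decoder_invariant ls HW0 HN HW HM HMW T_gt0 rate cl W0w W0wd jb.
have [_ Wwd _] := decoder_reset ls HW0 HN HW HM T_gt0 rate cl W0w jb hw.
have [_ _ Winv _] := HW.
have [g [g0 Wg Dg sg]] := invariant_solution Winv Wwd.
have wdg := decoder_interval ls cl Dg g0.
have jS : j.+1%:R * T = j%:R * T + T by rewrite -natr1 mulrDl mul1r.
exists g; split => //.
- by move=> l l0 lT lb; exact: (closed_loop_perturbed smooth T_gt0 Pmu cl l0 lT lb Wg Dg wdg).
- move=> l l0 lT lb.
  have := decoder_close ls HW0 HN HW HM HMW T_gt0 rate cl W0w jb sg g0 hw (t := l + j%:R * T).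
  rewrite addrK lerDr jS addrC lerD2l => /(_ l0 lT lb) h.
  have r0 := range_ge0 HW0 HN HM T_gt0 rate j.+1.
  apply: norm_le_coord => // i; apply: (le_trans (coord_enorm_le _ i)).
  by apply: (le_trans h); rewrite ler_pdivrMr// ler_peMr// ler1n.
- split=> [l l0 lT lb|jb']; last exact: decoder_left_limit ls T_gt0 cl _ _ jb' Dg g0.
  rewrite wdg ?addrK// ?lerDr//; last by rewrite addrC.
  by rewrite jS addrC ltrD2l.
Qed.

Lemma start_split w z : start (loop_state mu w z) -> Z z.
Proof. by case; rewrite z_of_loop. Qed.

Lemma start_loop w z : W w -> Z z -> start (loop_state mu w z).
Proof. by move=> Ww Zz'; split; rewrite ?mu_of_loop ?w_of_loop ?z_of_loop. Qed.

(** The invariant of the sampling induction: after each reset the state satisfies the hypotheses of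
    the global estimate, which brings it within [dl] of the graph before the next reset. *)
Lemma interval_start j : ((j%:R * T)%:E < b)%E ->
  [/\ start (x_at (tr_wd X (j%:R * T)) (j%:R * T)),
      sq (eta_at (tr_wd X (j%:R * T)) (j%:R * T) *m E) <= H &
      ep_at (tr_wd X (j%:R * T)) (j%:R * T) ^+ 2 <= Eb] /\
  (((j.+1%:R * T)%:E < b)%E -> near_at dl (tr_wdm X j.+1) (j.+1%:R * T)).
Proof.
have ls := lip_s smooth.
have Wwd i : ((i%:R * T)%:E < b)%E -> W (tr_wd X (i%:R * T)).
  move=> ib; have [_ hw] := decoder_invariant ls HW0 HN HW HM HMW T_gt0 rate cl W0w W0wd ib.
  by have [] := decoder_reset ls HW0 HN HW HM T_gt0 rate cl W0w ib hw.
have ending i : ((i%:R * T)%:E < b)%E ->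
    [/\ start (x_at (tr_wd X (i%:R * T)) (i%:R * T)),
      sq (eta_at (tr_wd X (i%:R * T)) (i%:R * T) *m E) <= H &
      ep_at (tr_wd X (i%:R * T)) (i%:R * T) ^+ 2 <= Eb] ->
    ((i.+1%:R * T)%:E < b)%E -> near_at dl (tr_wdm X i.+1) (i.+1%:R * T).
  move=> ib [h1 h2 h3] ib'; have [g [g0 Wg hp _ [_ gT]]] := sampled_decoder ib.
  have iS : i.+1%:R * T = i%:R * T + T by rewrite -natr1 mulrDl mul1r.
  have := hp T (ltW T_gt0) (lexx _); rewrite -iS => /(_ ib') hpT.
  have [+ _] := interval (ltW T_gt0) hpT.
  rewrite add0r g0 => /(_ h1 h2 h3)[_ _ _ /(_ thT)].
  by rewrite gT// addrC -iS.
elim: j => [jb|j IH jb].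
  have b0 := jb; rewrite mul0r in b0.
  have h : [/\ start (x_at (tr_wd X (0%:R * T)) (0%:R * T)),
      sq (eta_at (tr_wd X (0%:R * T)) (0%:R * T) *m E) <= H &
      ep_at (tr_wd X (0%:R * T)) (0%:R * T) ^+ 2 <= Eb].
    have := Wwd 0%N jb; rewrite mul0r => W1; have [h1 h2] := initial W1.
    by split => //; exact: start_loop.
  by split => //; exact: ending.
have jb' : ((j%:R * T)%:E < b)%E.
  by apply: lt_trans jb; rewrite lte_fin natr_mulT_lt.
have [_ /(_ jb) nr] := IH jb'.
have [Wm _] := decoder_invariant ls HW0 HN HW HM HMW T_gt0 rate cl W0w W0wd jb.
have W1 := Wwd j.+1 jb.
have [h2 h3] := bounded_jump Wm W1 nr.
have h1 : start (x_at (tr_wd X (j.+1%:R * T)) (j.+1%:R * T)).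
  (* z does not jump, so its membership in Z is read off the state before the reset, which is close
     to A0. *)
  apply: start_loop W1 _; apply: (@start_split (tr_wdm X j.+1)).
  apply: (near_start (eta := eta_at (tr_wdm X j.+1) (j.+1%:R * T))
    (ep := ep_at (tr_wdm X j.+1) (j.+1%:R * T))).
    by split; rewrite ?mu_of_loop ?w_of_loop.
  by apply: near_steady_le nr; have := dl_gt0; lra.
have h := And3 h1 h2 h3.
by split => //; exact: ending.
Qed.

Lemma sampling_decomposition (t : R) : 0 <= t -> exists (j : nat) l,
  [/\ 0 <= l, l < T & t = l + j%:R * T].
Proof.
move=> t0; have tT : 0 <= t / T by rewrite divr_ge0// ltW.
exists (Num.truncn (t / T)), (t - (Num.truncn (t / T))%:R * T).
rewrite subrK; split => //.
  by rewrite subr_ge0 -ler_pdivlMr// truncn_le.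
by rewrite ltrBlDl -[X in _ + X]mul1r -mulrDl natr1 -ltr_pdivrMr// truncnS_gt.
Qed.

(** The bound does not depend on b; it is the input of [bounded_not_maximal]. The squared estimates
    are converted by a <= a^2 + 1. *)
Lemma trajectory_bounded : exists rho : R, forall t, 0 <= t -> (t%:E < b)%E ->
  `|loop_vector X t| <= rho.
Proof.
have [cW _ _ _] := HW; have [B B0 hB] := compact_norm_le cW.
have [By By0 hBy] := lip_bdd_bounded B (lip_yr smooth).
pose Bxi := K1 * `|Cb| + 1 + (`|Cb| + 1) * `|G|.
have Bxi0 : 0 <= Bxi by rewrite addr_ge0 ?addr_ge0 ?mulr_ge0// ltW.
have Cb0 := normr_ge0 Cb; have Cb1 := ler_norm Cb.
exists (B + `|Cb| + (`|Cb| + 1 + By) + Bxi) => t t0 tb.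
have [j [l [l0 lT tE]]] := sampling_decomposition t0.
have jlb : ((j%:R * T + l)%:E < b)%E by rewrite addrC -tE.
have jb : ((j%:R * T)%:E < b)%E by apply: le_lt_trans jlb; rewrite lee_fin lerDl.
have [[h1 h2 h3] _] := interval_start jb.
have [g [g0 Wg hp _ [wdg _]]] := sampled_decoder jb.
have [+ _] := interval l0 (hp l l0 (ltW lT) jlb).
rewrite add0r g0 => /(_ h1 h2 h3)[xB etaB epB _].
have wdE := wdg l l0 lT jlb; rewrite -tE in wdE xB etaB epB.
have sqrt_le (a : R) : 0 <= a -> a ^+ 2 <= `|Cb| -> a <= `|Cb| + 1.
  by move=> a0 a2; have := sqr_ge0 (a - 1); lra.
have epB' : `|ep_at (g l) t| <= `|Cb| + 1.
  by apply: sqrt_le => //; rewrite real_normK ?num_real// (le_trans epB).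
have yrB := hBy _ (hB _ (Wg l)).
have etaB' : `|eta_at (g l) t| <= K1 * `|Cb| + 1.
  have h : `|eta_at (g l) t| ^+ 2 <= K1 * `|Cb|.
    apply: (le_trans (norm_sq_le _)); apply: (le_trans (coercive _)).
    by rewrite ler_wpM2l ?(ltW K1_gt0)// (le_trans etaB).
  by have := mulr_ge0 (ltW K1_gt0) Cb0; have := sqr_ge0 (`|eta_at (g l) t| - 1); lra.
have wB := hB _ (Wg l).
rewrite /loop_vector /pack wdE.
apply: norm_row_mx_le; first by lra.
apply: norm_row_mx_le.
  have : `|tr_z X t| <= `|x_at (g l) t|.
    rewrite -{1}(z_of_loop mu (g l) (tr_z X t)).
    by apply: (le_trans (norm_rsubmx_le _)); exact: norm_rsubmx_le.
  by lra.
apply: norm_row_mx_le.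
  apply: norm_le_coord => [|i]; first by lra.
  rewrite mxE; have := ler_normD (ep_at (g l) t) (yr (g l)); rewrite subrK; lra.
have := ler_normD (eta_at (g l) t) (ep_at (g l) t *: G); rewrite observer_stateK normrZ.
have := ler_wpM2r (normr_ge0 G) epB'; rewrite /Bxi; lra.
Qed.

Hypothesis b_infty : b = +oo%E.


Lemma near_at_step j c1 c2 : 0 < c1 -> near_at c1 (tr_wdm X j) (j%:R * T) ->
  5 / 4 * c1 + Cj * (2 * range j) ^+ 2 <= c2 -> c2 <= 2 * dl ->
  near_at (c2 / 2) (tr_wdm X j.+1) (j.+1%:R * T) /\
  forall l, 0 <= l -> l < T ->
    (ep_at (tr_wd X (l + j%:R * T)) (l + j%:R * T)) ^+ 2 <= C * c2.
Proof.
move=> c10 nr c12 c2dl; have ls := lip_s smooth.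
have bt t : (t%:E < b)%E by rewrite b_infty ltry.
have [Wm hw] := decoder_invariant ls HW0 HN HW HM HMW T_gt0 rate cl W0w W0wd (bt (j%:R * T)).
have [_ Wwd jump] := decoder_reset ls HW0 HN HW HM T_gt0 rate cl W0w (bt (j%:R * T)) hw.
have nr2 := near_steady_le c12 (small_jump Wm Wwd jump nr).
have c20 : 0 < c2.
  apply: lt_le_trans c12; rewrite ltr_pwDl ?mulr_gt0// mulr_ge0 ?sqr_ge0//.
  exact: ltW Cj_gt0.
have [g [g0 Wg hp _ [wdg gT]]] := sampled_decoder (bt (j%:R * T)).
have step l (l0 : 0 <= l) (lT : l <= T) := (interval l0 (hp l l0 lT (bt _))).2.
split.
  have := step T (ltW T_gt0) (lexx _) c2 c20 c2dl; rewrite add0r g0 => /(_ nr2)[_ /(_ thT)].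
  have -> : T + j%:R * T = j.+1%:R * T by rewrite -natr1 mulrDl mul1r addrC.
  by rewrite gT.
move=> l l0 lT; have := step l l0 (ltW lT) c2 c20 c2dl; rewrite add0r g0 => /(_ nr2)[[a [_ _ _ h]] _].
by rewrite wdg.
Qed.

(** The floor 3/4 is the best rate of the distance itself: a reset with its error term costs 5/4 +
    1/4 = 3/2, and the interval after it halves. A common rate then serves the distance and the
    range. *)
Lemma range_geometric : exists (sg A : R), [/\ 3 / 4 <= sg, sg < 1, 0 <= A &
  forall j, range j <= A * sg ^+ j].
Proof.
have /andP[r0 r1] := range_ratio HN HM T_gt0 rate.
exists (Num.max (3 / 4) (Num.sqrt r%:R * (M T / Nq%:R))), (initial_range W0).
have A0 : 0 <= initial_range W0 by apply: initial_range_ge0; case: HW0.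
split => //; first by rewrite le_max lexx.
  by rewrite gt_max r1 andbT; lra.
move=> j; rewrite quantization_rangeE mulrC ler_wpM2l//.
by apply: lerXn2r; rewrite ?nnegrE ?le_max ?r0 ?lexx ?orbT.
Qed.

Lemma tracking_decay : exists (j0 : nat) (sg : R), [/\ 0 <= sg, sg < 1 &
  forall i l, 0 <= l -> l < T -> let t := l + (j0 + i)%:R * T in
    (ep_at (tr_wd X t) t) ^+ 2 <= C * (2 * dl) * sg ^+ i].
Proof.
have bt t : (t%:E < b)%E by rewrite b_infty ltry.
have [sg [A [sg34 sg1 A0 hA]]] := range_geometric.
have sg0 : 0 <= sg by lra.
have dl4 : 0 < dl / 4 by rewrite divr_gt0// dl_gt0.
(* From this index on, the error term of a reset is at most a quarter of the distance
   [dl * sg ^+ i]. One of the two factors of the squared range makes it small, and the other is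
   simply bounded by 1. *)
have [j0 hj0] := geometric_small (Cj * (4 * A ^+ 2)) sg0 sg1 dl4.
have jump i : Cj * (2 * range (j0.+1 + i)) ^+ 2 <= dl / 4 * sg ^+ i.
  have r0 := range_ge0 HW0 HN HM T_gt0 rate (j0.+1 + i).
  have pow m : sg ^+ m <= 1 by rewrite exprn_ile1// ltW.
  have pow0 m : 0 <= sg ^+ m by rewrite exprn_ge0.
  apply: (@le_trans _ _ (Cj * (4 * A ^+ 2) * sg ^+ (j0.+1 + i))).
    rewrite -mulrA ler_wpM2l ?(ltW Cj_gt0)//.
    apply: (@le_trans _ _ ((2 * (A * sg ^+ (j0.+1 + i))) ^+ 2)).
      apply: lerXn2r; rewrite ?nnegrE; last by rewrite ler_wpM2l.
        by rewrite mulr_ge0.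
      by rewrite mulr_ge0// mulr_ge0// pow0.
    have -> : (2 * (A * sg ^+ (j0.+1 + i))) ^+ 2 =
        4 * A ^+ 2 * (sg ^+ (j0.+1 + i) * sg ^+ (j0.+1 + i)) by ring.
    rewrite ler_wpM2l ?mulr_ge0 ?sqr_ge0//.
    by rewrite ler_piMl.
  by rewrite exprD mulrA ler_wpM2r// hj0.
have near_i i : near_at (dl * sg ^+ i) (tr_wdm X (j0.+1 + i)) ((j0.+1 + i)%:R * T) /\
    forall l, 0 <= l -> l < T ->
    (ep_at (tr_wd X (l + (j0.+1 + i)%:R * T)) (l + (j0.+1 + i)%:R * T)) ^+ 2
      <= C * (2 * dl * sg ^+ i).
  have step i' : near_at (dl * sg ^+ i') (tr_wdm X (j0.+1 + i')) ((j0.+1 + i')%:R * T) ->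
    near_at (3 / 2 * (dl * sg ^+ i') / 2) (tr_wdm X (j0.+1 + i').+1) ((j0.+1 + i').+1%:R * T) /\
    forall l, 0 <= l -> l < T ->
    (ep_at (tr_wd X (l + (j0.+1 + i')%:R * T)) (l + (j0.+1 + i')%:R * T)) ^+ 2
      <= C * (3 / 2 * (dl * sg ^+ i')).
    have p0 : 0 < dl * sg ^+ i' by rewrite mulr_gt0 ?dl_gt0// exprn_gt0//; lra.
    move=> nr; apply: (near_at_step p0 nr).
      by have := jump i'; have := p0; move: (_ ^+ 2) => J; lra.
    have : dl * sg ^+ i' <= dl by rewrite ler_piMr ?exprn_ile1 ?(ltW dl_gt0)// ltW.
    by have := dl_gt0; lra.
  have nr : near_at (dl * sg ^+ i) (tr_wdm X (j0.+1 + i)) ((j0.+1 + i)%:R * T).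
    elim: i => [|i IH].
      rewrite expr0 mulr1 addn0.
      by have [_ h] := interval_start (bt (j0%:R * T)); exact: h.
    have [nr _] := step i IH; rewrite addnS; apply: near_steady_le nr.
    have p0 : 0 <= dl * sg ^+ i by rewrite mulr_ge0 ?(ltW dl_gt0)// exprn_ge0.
    rewrite exprSr mulrA; have := ler_wpM2l p0 sg34; lra.
  split => // l l0 lT; have [_ h] := step i nr.
  apply: (le_trans (h l l0 lT)); rewrite ler_wpM2l ?(ltW C_gt0)//.
  have p0 : 0 <= dl * sg ^+ i by rewrite mulr_ge0 ?(ltW dl_gt0)// exprn_ge0.
  by lra.
exists j0.+1, sg; split => // i l l0 lT /=.
by have [_ h] := near_i i; rewrite -!mulrA in h *; exact: h.
Qed.

(** The error is y - yr(w_d), which decays by [tracking_decay], plus yr(w_d) - yr(w), bounded by a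
    Lipschitz constant times the quantization range. *)
Lemma tracking_error_cvg : (tr_y X t - yr (tr_w X t)) @[t --> +oo] --> (0 : R).
Proof.
have bt t : (t%:E < b)%E by rewrite b_infty ltry.
have [j0 [sg [sg0 sg1 decay]]] := tracking_decay.
have [sg' [A [sg34 sg1' A0 hA]]] := range_geometric.
have sg0' : 0 <= sg' by lra.
have [cW W0W _ _] := HW; have [B B0 hB] := compact_norm_le cW.
have [Ly Ly0 hLy] := lip_yr smooth B.
apply/cvgrPdist_le => ee ee0.
have e2 : 0 < ee / 2 by rewrite divr_gt0.
have e4 : 0 < (ee / 2) ^+ 2 by rewrite exprn_gt0.
have [i1 hi1] := geometric_small (C * (2 * dl)) sg0 sg1 e4.
have [i2 hi2] := geometric_small (Ly * A) sg0' sg1' e2.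
near=> t; rewrite sub0r normrN.
have tge : (j0 + (i1 + i2))%:R * T <= t by near: t; apply: nbhs_pinfty_ge; exact: num_real.
have t0 : 0 <= t by apply: le_trans tge; rewrite mulr_ge0// ltW.
have [j [l [l0 lT tE]]] := sampling_decomposition t0.
have jge : (j0 + (i1 + i2) <= j)%N.
  rewrite -ltnS -(natr_mulT_lt T_gt0); apply: (le_lt_trans tge).
  by rewrite tE -natr1 mulrDl mul1r addrC ltrD2l.
have jE : j = (j0 + (j - j0))%N by rewrite subnKC// (leq_trans _ jge)// leq_addr.
have [g [_ Wg _ closew [wdg _]]] := sampled_decoder (bt (j%:R * T)).
have wdE := wdg l l0 lT (bt _); have wE := closew l l0 (ltW lT) (bt _).
have := decay (j - j0)%N l l0 lT; rewrite -jE -tE => ep2.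
rewrite -tE in wdE wE.
have h1 : `|ep_at (tr_wd X t) t| <= ee / 2.
  rewrite -ler_sqr ?nnegrE ?(ltW e2)// real_normK ?num_real//.
  apply: (le_trans ep2); apply: hi1.
  by rewrite leq_subRL ?(leq_trans _ jge) ?leq_addr// leq_add2l leq_addr.
have h2 : `|yr (tr_wd X t) - yr (tr_w X t)| <= ee / 2.
  rewrite wdE.
  have Ww : W (tr_w X t) by apply: W0W; exact: (exosystem_in_W0 (lip_s smooth) HW0 cl W0w t0 (bt t)).
  apply: (le_trans (hLy _ _ (hB _ (Wg l)) (hB _ Ww))).
  rewrite distrC; apply: (le_trans (ler_wpM2l Ly0 wE)).
  apply: (le_trans (ler_wpM2l Ly0 (hA _))); rewrite mulrA; apply: hi2.
  by rewrite (leq_trans _ (leqW jge))// addnA leq_addl.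
have -> : tr_y X t - yr (tr_w X t) = ep_at (tr_wd X t) t + (yr (tr_wd X t) - yr (tr_w X t)).
  by rewrite addrA subrK.
by apply: (le_trans (ler_normD _ _)); rewrite [ee]splitr lerD.
Unshelve. all: by end_near. Qed.

End trajectory.

Theorem proposition3 (R : realType) (p r n d : nat)
  (s : 'rV[R]_r -> 'rV[R]_r) (yr : 'rV[R]_r -> R)
  (f : 'rV[R]_n -> R -> 'rV[R]_p -> 'rV[R]_n)
  (q : 'rV[R]_n -> R -> 'rV[R]_p -> R)
  (W0 W : set 'rV[R]_r) (Nb N : nat) (M : R -> R)
  (P : set 'rV[R]_p) (Z : set 'rV[R]_n) (Y : set R) (Xi : set 'rV[R]_d)
  (phi phic : 'rV[R]_d -> R) (c : 'I_d -> R)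
  (HP : compact P) (HZ : compact Z) (HY : compact Y) (HXi : compact Xi)
  (Hd : (0 < d)%N)
  (Hsmooth : smooth_data s yr f q d)
  (Hs : locally_lipschitz s)
  (HW0 : compact W0 /\ invariant_set s W0)
  (HN : channel_levels r Nb N)
  (HW : [/\ compact W, W0 `<=` W, invariant_set s W &
          forall w, ~ W w ->
            Num.sqrt r%:R * (initial_range W0 / (2 * N%:R)) < edist W0 w])
  (HM : [/\ M 0 = 1, forall t, 0 <= t -> 0 < M t &
          forall t t', 0 <= t -> t <= t' -> M t <= M t'])
  (HMW : forall w1 w2 : R -> 'rV[R]_r,
     solution s +oo%E w1 -> solution s +oo%E w2 -> W (w1 0) -> W (w2 0) ->
     forall t, 0 <= t -> enorm (w1 t - w2 t) <= M t * enorm (w1 0 - w2 0))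
  (Hss : steady_state_assumption s yr f P W Z)
  (Hphi : locally_lipschitz phi)
  (Himm : immersion_assumption s yr f q P W Z phi)
  (Hphic : locally_lipschitz phic)
  (Hphic_supp : compact (closure [set xi | phic xi != 0]))
  (Hphic_phi : forall x, steady_state_set s yr f P W Z x ->
     phic (tau s yr f q d x) = phi (tau s yr f q d x))
  (Hc : hurwitz (char_poly_of c)) :
  exists2 kappa_star : R, 0 < kappa_star &
  forall kappa, kappa_star <= kappa ->
  exists T_star k_star : R, [/\ 0 < T_star, 0 < k_star &
  forall T k : R, T_star < T -> Num.sqrt r%:R * M T < N%:R -> k_star < k ->
  forall (mu : 'rV[R]_p) (b : \bar R) (X : trajectory R r n d),
    P mu -> W0 (tr_w X 0) -> W0 (tr_wdm X 0%N) ->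
    Z (tr_z X 0) -> Y (tr_y X 0) -> Xi (tr_xi X 0) ->
    maximal_closed_loop s yr f q W0 N M T phic c kappa k mu b X ->
    b = +oo%E /\ (tr_y X t - yr (tr_w X t)) @[t --> +oo] --> (0 : R)].
Proof.
case: d Xi phi phic c HXi Hd Hsmooth Hphi Himm Hphic Hphic_supp Hphic_phi Hc => [//|d].
move=> Xi phi phic c HXi _ Hsmooth _ Himm Hphic Hphic_supp Hphic_phi Hc.
have [L L_gt0 phicL] := lipschitz_compact_support Hphic Hphic_supp.
have [kappa_star kappa_star_gt0 hkappa] := observer_contraction Hc L_gt0 phicL.
exists kappa_star => // kappa /hkappa[e [E [K1 [K1_gt0 coercive contraction]]]].
have [cW W0W _ _] := HW.
have [H [Eb [H0 Eb0 init bjump]]] := initial_bounds Hsmooth Hss c kappa E cW HY HXi.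
have [th [dl [C [Cb [kst [[th0 dl0 dl1 C0 kst0] [nstart interval]]]]]]] :=
  sample_interval Hsmooth Hss Himm Hphic_phi L_gt0 phicL K1_gt0 coercive contraction H0 Eb0.
have [Cj Cj0 sjump] := near_steady_jump Hsmooth P Z c kappa E cW.
exists th, kst; split => // T k thT rate kstk mu b X Pmu W0w W0wd Zz Yy Xixi maxX.
have T0 : 0 < T by exact: lt_trans thT.
have [N0 _ _] := HN.
have [_ cl _] := maxX.
have init0 w (Ww : W w) := init w _ _ Ww Yy Xixi.
have bjump0 w w' t (Ww : W w) (Ww' : W w') := @bjump dl mu w w' (tr_z X t) (tr_y X t) (tr_xi X t) Ww Ww' dl1.
have sjump0 c' J w w' t := @sjump c' J mu w w' (tr_z X t) (tr_y X t) (tr_xi X t).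
have interval0 l x eta ep := @interval k l x eta ep (ltW kstk).
have b_infty : b = +oo%E.
  have [rho hrho] := trajectory_bounded Hsmooth K1_gt0 coercive HW0 N0 HW HM HMW T0 rate cl
    W0w W0wd Pmu Zz dl0 (ltW thT) nstart init0 bjump0 interval0.
  (* A real end time contradicts maximality of a bounded trajectory, and minus infinity is excluded
     by 0 < b. *)
  case: b cl maxX hrho => [B cl maxX hrho|//|_ [] //].
  exfalso; apply: (bounded_not_maximal (rho := rho) Hsmooth (locally_lipschitz_bdd Hphic) T0 maxX HW0.2 W0w).
  by move=> t t0 tB; apply: hrho; rewrite ?lte_fin.
split => //; exact: (tracking_error_cvg Hsmooth HW0 N0 HW HM HMW T0 rate cl W0w W0wd Pmu Zz dl0
  C0 Cj0 (ltW thT) nstart init0 bjump0 sjump0 interval0 b_infty).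
Qed.
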